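(* Every three-dimensional tight fan is the face fan of some convex three-dimensional polytope (i.e. it is polytopal).
   Context: A polyhedral cone in $\mathbb E^d$ is a set $\{p+\alpha_1 v_1+\dots+\alpha_k v_k : \alpha_i\ge 0\}$. A fan in $\mathbb E^d$ is a finite family of polyhedral cones such that every (nonempty) face of a cone of the family belongs to the family and the intersection of any two cones is a nonempty face of each. Its cones are called its faces. A fan is complete if its cones cover $\mathbb E^d$, and pointed if its minimal cone is a single point (the vertex). A face $f$ of a complete fan is standard if there is a ball $B$ centered at some relative interior point $p$ of $f$ inside which the fan is centrally symmetric about $p$ (the reflection $x\mapsto 2p-x$ maps the family of intersections of faces of the fan with $B$ to itself). Two cones $c_1,c_2$ with a common face $f$ are locally symmetric in $f$ if there is a ball $B$ centered at some relative interior point $p$ of $f$ such that $c_1\cap B$ and $c_2\cap B$ are centrally symmetric to each other about $p$. A tight fan is a complete pointed $d$-dimensional fan in $\mathbb E^d$ such that the intersection of any two of its $d$-dimensional cones is a standard face of the fan in which these two cones are locally symmetric. The face fan of a convex $d$-polytope $M\subset\mathbb E^d$ with respect to an interior point $v$ of $M$ is $\{\mathrm{cone}_v(F): F\text{ a proper face of }M\}$, where $\mathrm{cone}_v(F)=\{v+\sum_i\alpha_i\overrightarrow{vp_i}:\alpha_i\ge0,\ p_i\in F\}$ and $\mathrm{cone}_v(\emptyset)=\{v\}$. The equality with a face fan is a geometric equality of families of cones, not merely a combinatorial equivalence. *)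

(* Defs.v *)
From HB Require Import structures.
From mathcomp Require Import all_boot all_order all_algebra.
From mathcomp Require Import all_classical all_reals all_analysis.

Set Implicit Arguments.
Unset Strict Implicit.
Unset Printing Implicit Defensive.

Import Order.TTheory GRing.Theory Num.Theory.
Import numFieldNormedType.Exports.

Local Open Scope classical_set_scope.
Local Open Scope ring_scope.

Section TightFans.
Variables (R : realType) (d : nat).
Local Notation E := 'rV[R]_d.
Implicit Types (A B C M c f m : set E) (F : set (set E)) (p u v x : E).

Definition dot u v : R := \sum_(i < d) u 0 i * v 0 i.

(* The norm that the library puts on matrices is the sup norm, hence this
   explicit Euclidean ball.  The induced topology is the library's one. *)
Definition eball p (r : R) : set E :=
  [set x | Num.sqrt (dot (x - p) (x - p)) < r].

Definition reflection p x : E := 2%:R *: p - x.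

Definition affine_hull A : set E :=
  [set x | exists (n : nat) (a : 'I_n -> R) (q : 'I_n -> E),
     [/\ forall i, A (q i), \sum_(i < n) a i = 1 &
         x = \sum_(i < n) a i *: q i]].

Definition convex_hull A : set E :=
  [set x | exists (n : nat) (a : 'I_n -> R) (q : 'I_n -> E),
     [/\ forall i, A (q i), forall i, 0 <= a i, \sum_(i < n) a i = 1 &
         x = \sum_(i < n) a i *: q i]].

(* The empty set has no dimension. *)
Definition has_dim A (k : nat) : Prop :=
  exists (p : E) (U : {vspace E}),
    \dim U = k /\ affine_hull A = [set x | x - p \in U].

Definition relative_interior A : set E :=
  [set p | A p /\
     exists r : R, 0 < r /\ eball p r `&` affine_hull A `<=` A].

Definition polyhedral_cone C : Prop :=
  exists (p : E) (k : nat) (v : 'I_k -> E),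
    C = [set x | exists a : 'I_k -> R,
           (forall i, 0 <= a i) /\ x = p + \sum_(i < k) a i *: v i].

(* Faces of a closed convex polyhedron: its intersections with supporting
   hyperplanes.  Since u = 0 is allowed, C itself (b = 0) and the empty set
   (b = 1) are faces of C. *)
Definition face_of f C : Prop :=
  exists (u : E) (b : R),
    (forall x, C x -> dot u x <= b) /\ f = C `&` [set x | dot u x = b].

Record fan F : Prop := Fan {
  fan_finite : finite_set F;
  fan_cone : forall C, F C -> polyhedral_cone C;
  fan_face : forall C f, F C -> face_of f C -> f !=set0 -> F f;
  fan_meet : forall C1 C2, F C1 -> F C2 ->
    [/\ C1 `&` C2 !=set0, face_of (C1 `&` C2) C1 & face_of (C1 `&` C2) C2]
}.

Definition complete_fan F : Prop := \bigcup_(C in F) C = setT.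

Definition minimal_cone F m : Prop := F m /\ forall C, F C -> m `<=` C.

Definition pointed_fan F : Prop := exists v : E, minimal_cone F [set v].

Definition fan_dim F (k : nat) : Prop :=
  (exists2 C, F C & has_dim C k) /\
  (forall C (j : nat), F C -> has_dim C j -> (j <= k)%N).

Definition fan_inside F B : set (set E) := [set C `&` B | C in F].

Definition standard_face F f : Prop :=
  F f /\
  exists (p : E) (r : R),
    [/\ relative_interior f p, 0 < r &
        [set reflection p @` X | X in fan_inside F (eball p r)] =
        fan_inside F (eball p r)].

Definition locally_symmetric c1 c2 f : Prop :=
  exists (p : E) (r : R),
    [/\ relative_interior f p, 0 < r &
        reflection p @` (c1 `&` eball p r) = c2 `&` eball p r].

Record tight_fan F : Prop := TightFan {
  tight_is_fan : fan F;
  tight_complete : complete_fan F;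
  tight_pointed : pointed_fan F;
  tight_dim : fan_dim F d;
  tight_meet : forall c1 c2, F c1 -> F c2 -> has_dim c1 d -> has_dim c2 d ->
    c1 <> c2 ->
    standard_face F (c1 `&` c2) /\ locally_symmetric c1 c2 (c1 `&` c2)
}.

Definition convex_polytope M (k : nat) : Prop :=
  (exists2 S : set E, finite_set S & M = convex_hull S) /\ has_dim M k.

(* The empty face is proper. *)
Definition proper_face f M : Prop := face_of f M /\ f <> M.

(* The empty combination (n = 0) is allowed, so cone_over v set0 = [set v]. *)
Definition cone_over v A : set E :=
  [set x | exists (n : nat) (a : 'I_n -> R) (q : 'I_n -> E),
     [/\ forall i, A (q i), forall i, 0 <= a i &
         x = v + \sum_(i < n) a i *: (q i - v)]].

Definition face_fan v M : set (set E) :=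
  [set cone_over v f | f in [set f | proper_face f M]].

End TightFans.

(* Main.v *)
Require Import Defs.
From HB Require Import structures.
From mathcomp Require Import all_boot all_order all_algebra.
From mathcomp Require Import all_classical all_reals all_analysis.
From mathcomp Require Import ring lra.
Set Implicit Arguments.
Unset Strict Implicit.
Unset Printing Implicit Defensive.

Import Order.TTheory GRing.Theory Num.Theory.
Import numFieldNormedType.Exports.
Local Open Scope classical_set_scope.
Local Open Scope ring_scope.

(** Put the vertex of the fan at 0 and consider its full-dimensional cones, the
    cells.  Near a common ray of two cells that meet in no more than this ray,
    each cell is the reflection of the other, so that the two planes of their
    walls cut a neighbourhood of the ray into four cells: the ray is four-valent.
    Two cells that meet in the vertex only are opposite, and then the whole fan
    is centrally symmetric ([tight_cells], [tight_fan_cells]).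

    The main tool is [crossing_cells].  Suppose that the facets [i], [l] and
    [j], [m] of a cell [A] can be joined by crossing diagonals inside [A].  If
    the cells across [i] and [l] meet, and those across [j] and [m] as well, the
    two diagonals close up to two curves on the sphere.  Since these cross
    inside [A], they cross a second time ([crossing]), which is possible only in
    a ray common to the four neighbours.  This bounds the number of facets:
    cells with a four-valent ray have three ([ray_three_facets]); if there is no
    four-valent ray, then cells that are not antipodal share a wall, and all
    cells have three facets when there are no antipodal cells
    ([no_antipodes_three]) and at most four when there are ([antipodes_four]).

    Little freedom remains.  Around a four-valent ray there is a star of four
    simplicial cells, and the cells across its outer facets either coincide or
    produce another four-valent ray; this gives, up to the choice of generators
    on the rays, the fans of a quadrangular pyramid, a triangular bipyramid and
    an octahedron ([four_valent_polytopal]).  Without four-valent rays the fan is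
    that of a tetrahedron ([no_antipodes_polytopal]) or of a cube
    ([antipodes_polytopal]).

    In each case suitable generators form a finite set [S] such that every cell
    has a linear form that is at most 1 on [S] and whose points of value 1 in [S]
    generate the cell ([polytopal]).  The polytope is the convex hull of
    [v + S]: the linear forms are the equations of its facets, and the faces of
    the cells correspond to its faces ([fan_eq_face_fan]). *)

(** * Linear algebra of space *)

Ltac vring := apply/rowP => ?; rewrite !mxE; ring.
Ltac vfield := apply/rowP => ?; rewrite !mxE; field.

Section Dot.
Variables (R : realType) (d : nat).
Implicit Types (u v w x : 'rV[R]_d) (a : R).

Lemma dotC u v : dot u v = dot v u.
Proof. by apply: eq_bigr => i _; rewrite mulrC. Qed.

Lemma dotDr u v w : dot u (v + w) = dot u v + dot u w.
Proof. by rewrite -big_split; apply: eq_bigr => i _; rewrite mxE mulrDr. Qed.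

Lemma dotZr a u v : dot u (a *: v) = a * dot u v.
Proof. by rewrite /dot mulr_sumr; apply: eq_bigr => i _; rewrite mxE mulrCA. Qed.

Lemma dotNr u v : dot u (- v) = - dot u v.
Proof. by rewrite -scaleN1r dotZr mulN1r. Qed.

Lemma dotBr u v w : dot u (v - w) = dot u v - dot u w.
Proof. by rewrite dotDr dotNr. Qed.

Lemma dot0r u : dot u 0 = 0.
Proof. by rewrite -(scale0r u) dotZr mul0r. Qed.

Lemma dotDl u v w : dot (v + w) u = dot v u + dot w u.
Proof. by rewrite dotC dotDr !(dotC u). Qed.

Lemma dotZl a u v : dot (a *: v) u = a * dot v u.
Proof. by rewrite dotC dotZr (dotC u). Qed.

Lemma dotNl u v : dot (- v) u = - dot v u.
Proof. by rewrite dotC dotNr (dotC u). Qed.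

Lemma dotBl u v w : dot (v - w) u = dot v u - dot w u.
Proof. by rewrite dotDl dotNl. Qed.

Lemma dot0l u : dot 0 u = 0.
Proof. by rewrite dotC dot0r. Qed.

Definition dotE := (dotDr, dotZr, dotNr, dot0r, dotDl, dotZl, dotNl, dot0l).

Lemma dot_sumr (I : finType) u (F : I -> 'rV[R]_d) :
  dot u (\sum_i F i) = \sum_i dot u (F i).
Proof.
apply: (big_ind2 (fun x y => dot u x = y)) => [|x1 y1 x2 y2 <- <-|//].
  exact: dot0r.
exact: dotDr.
Qed.

Lemma dot_ge0 u : 0 <= dot u u.
Proof. by apply: sumr_ge0 => i _; rewrite -expr2 sqr_ge0. Qed.

Lemma dot_eq0 u : dot u u = 0 -> u = 0.
Proof.
move=> /eqP; rewrite psumr_eq0 => [/allP u0|i _]; last by rewrite -expr2 sqr_ge0.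
apply/rowP => i; move: (u0 i (mem_index_enum i)) => /=.
by rewrite mulf_eq0 orbb mxE => /eqP.
Qed.

Lemma dot_gt0 u : u <> 0 -> 0 < dot u u.
Proof.
by move=> u0; rewrite lt0r dot_ge0 andbT; apply/eqP => /dot_eq0.
Qed.

Lemma dot_delta (i : 'I_d) x : dot (delta_mx 0 i) x = x 0 i.
Proof.
rewrite /dot (bigD1 i) //= big1 ?addr0 => [|j ji].
  by rewrite mxE !eqxx mul1r.
by rewrite mxE (negbTE ji) andbF mul0r.
Qed.

End Dot.

Section Space.
Variable R : realType.
Local Notation E := 'rV[R]_3.
Implicit Types (a b c f g h u w x y : E).

Lemma family_dep {m : nat} (q : 'I_m -> E) : (3 < m)%N ->
  exists c : 'I_m -> R, (exists i, c i != 0) /\ \sum_i c i *: q i = 0.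
Proof.
move=> m3; pose M := \matrix_i q i.
have : kermx M != 0.
  by rewrite -mxrank_eq0 mxrank_ker subn_eq0 -ltnNge (leq_ltn_trans (rank_leq_col M)).
case/rowV0Pn => v /sub_kermxP vM v0; exists (fun i => v 0 i); split.
  by have /matrix0Pn [i [j]] := v0; rewrite (ord1 i) => ?; exists j.
apply: etrans vM; rewrite mulmx_sum_row; apply: eq_bigr => i _.
by rewrite rowK.
Qed.

Definition indep2 u w := forall s t : R, s *: u + t *: w = 0 -> s = 0 /\ t = 0.

Definition indep3 a b c := forall s t r : R,
  s *: a + t *: b + r *: c = 0 -> [/\ s = 0, t = 0 & r = 0].

Definition dual_bases f g h a b c :=
  (forall x, x = dot f x *: a + dot g x *: b + dot h x *: c) /\
  (forall (s t r : R), let x := s *: a + t *: b + r *: c in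
     [/\ dot f x = s, dot g x = t & dot h x = r]).

Lemma indep3_dual f g h : indep3 f g h -> exists a b c, dual_bases f g h a b c.
Proof.
move=> ind; pose M := \matrix_i [:: f; g; h]`_i : 'M[R]_3.
have uM : M \in unitmx.
  rewrite unitmxE unitfE; apply/det0P => -[v v0 vM].
  move: vM; rewrite mulmx_sum_row !big_ord_recl big_ord0 addr0 !rowK /= addrA.
  move=> /ind [e0 e1 e2]; move/eqP: v0; apply; apply/rowP => i; rewrite mxE.
  by case: i => -[|[|[|//]]] lti;
    [rewrite -e0|rewrite -e1|rewrite -e2]; congr (v _ _); apply/val_inj.
have dotM (i : 'I_3) x : dot [:: f; g; h]`_i x = (M *m x^T) i 0.
  rewrite mxE; apply: eq_bigr => j _; by rewrite !mxE.
pose N := (invmx M)^T.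
exists (row 0 N), (row 1 N), (row 2 N).
have lin s t r : s *: row 0 N + t *: row 1 N + r *: row 2 N =
    (\row_i [:: s; t; r]`_i) *m N.
  rewrite mulmx_sum_row !big_ord_recl big_ord0 addr0 !mxE /= addrA.
  by congr (_ + _ + _); congr (_ *: row _ _); apply/val_inj.
split=> [x|s t r].
  rewrite lin (_ : \row_i _ = (M *m x^T)^T).
    by rewrite -trmx_mul mulKmx // trmxK.
  apply/rowP => i; rewrite [LHS]mxE [RHS]mxE -dotM.
  by case: i => -[|[|[|//]]].
rewrite lin.
have key (i : 'I_3) : dot [:: f; g; h]`_i ((\row_j [:: s; t; r]`_j) *m N) = [:: s; t; r]`_i.
  by rewrite dotM trmx_mul trmxK mulKVmx // !mxE.
by split; [exact: (key 0)|exact: (key 1)|exact: (key 2)].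
Qed.

(** The relation depends on [f g h] only through the matrix of scalar products
    with [a b c], which is the identity. *)
Lemma dual_bases_sym f g h a b c : dual_bases f g h a b c ->
  dual_bases a b c f g h.
Proof.
move=> [dec eva].
have [/= fa ga ha] := eva 1 0 0; have [/= fb gb hb] := eva 0 1 0.
have [/= fc gc hc] := eva 0 0 1.
rewrite !dotE in fa ga ha fb gb hb fc gc hc.
have ev s t r : let x := s *: f + t *: g + r *: h in
     [/\ dot a x = s, dot b x = t & dot c x = r].
  move=> x; rewrite /x !dotE !(dotC _ f) !(dotC _ g) !(dotC _ h).
  by split; nra.
split=> // x; apply/eqP; rewrite -subr_eq0; apply/eqP.
have orth y : dot a y = 0 -> dot b y = 0 -> dot c y = 0 -> y = 0.
  move=> ya yb yc; apply: dot_eq0; rewrite {1}(dec y) !dotE ya yb yc.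
  by rewrite !mulr0 !addr0.
have [/= e1 e2 e3] := ev (dot a x) (dot b x) (dot c x).
by apply: orth; rewrite dotBr ?e1 ?e2 ?e3 subrr.
Qed.

Lemma dual_bases_indep f g h a b c : dual_bases f g h a b c -> indep3 a b c.
Proof.
move=> [_ eva] s t r e; have [/= ] := eva s t r.
by rewrite e !dot0r => <- <- <-.
Qed.

Lemma indep3_eq0 f g h x : indep3 f g h ->
  dot f x = 0 -> dot g x = 0 -> dot h x = 0 -> x = 0.
Proof.
move=> /indep3_dual [a [b [c [dec _]]]] e1 e2 e3.
by rewrite (dec x) e1 e2 e3 !scale0r !addr0.
Qed.

Lemma functional_ext u w x f g : indep3 u w x ->
  dot f u = dot g u -> dot f w = dot g w -> dot f x = dot g x -> f = g.
Proof.
move=> ind eu ew ex; apply/eqP; rewrite -subr_eq0; apply/eqP.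
by apply: (indep3_eq0 ind); rewrite dotBr !(dotC _ f) !(dotC _ g); lra.
Qed.

Lemma indep2_extend u w x f : indep2 u w -> dot f u = 0 -> dot f w = 0 ->
  dot f x != 0 -> indep3 u w x.
Proof.
move=> ind fu fw fx s t r e.
have r0 : r = 0.
  have := congr1 (dot f) e; rewrite !dotE fu fw !mulr0 !add0r => /eqP.
  by rewrite mulf_eq0 (negbTE fx) orbF => /eqP.
by move: e; rewrite r0 scale0r addr0 => /ind [-> ->].
Qed.

Lemma dep4 a b c x : exists s t r z : R, [|| s != 0, t != 0, r != 0 | z != 0] /\
  s *: a + t *: b + r *: c + z *: x = 0.
Proof.
have [k [[i ki] e]] := @family_dep 4 (fun i => [:: a; b; c; x]`_i) isT.
exists (k 0), (k 1), (k 2), (k 3); split.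
  move: ki; case: i => -[|[|[|[|//]]]] lti; set j := Ordinal _.
  - by rewrite (_ : j = 0); [move->|exact/val_inj].
  - by rewrite (_ : j = 1); [move->; rewrite orbT|exact/val_inj].
  - by rewrite (_ : j = 2); [move->; rewrite !orbT|exact/val_inj].
  - by rewrite (_ : j = 3); [move->; rewrite !orbT|exact/val_inj].
rewrite -[RHS]e !big_ord_recl big_ord0 addr0 /= !addrA.
by congr (_ *: _ + _ *: _ + _ *: _ + _ *: _); congr k; apply/val_inj.
Qed.

Lemma zero_between (a b : R) : 0 <= a -> b < 0 ->
  exists s : R, [/\ 0 <= s, s < 1 & (1 - s) * a + s * b = 0].
Proof.
move=> a0 b0; have ab : 0 < a - b by lra.
exists (a / (a - b)); split; first by rewrite divr_ge0 // ltW.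
  by rewrite ltr_pdivrMr //; lra.
by field; rewrite gt_eqF.
Qed.

(** The equations make the signs of [s], [t] and [r] pairwise opposite. *)
Lemma cyclic_signs (s t r a b c d g f : R) :
  0 < a -> 0 < b -> 0 < c -> 0 < d -> 0 < g -> 0 < f ->
  t * a + r * b = 0 -> s * c + r * d = 0 -> s * g + t * f = 0 -> s = 0.
Proof.
move=> a0 b0 c0 d0 g0 f0 ei ej el.
have /eqP : s * (g * a * d + c * b * f) = 0.
  rewrite (_ : _ * _ = (s * g + t * f) * (a * d) + (s * c + r * d) * (b * f)
    - (t * a + r * b) * (d * f)); last by ring.
  by rewrite ei ej el !mul0r addr0 subr0.
by rewrite mulf_eq0 [_ + _ == 0]gt_eqF ?orbF ?addr_gt0 ?mulr_gt0 // => /eqP.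
Qed.

(** First exit from a polyhedron along a segment: [f] and [g] are the values of
    the constraints at its ends, and the violated constraint with the smallest
    exit parameter is tight there while the others still hold. *)
Lemma first_exit (T : finType) (f g : T -> R) :
  (forall i, 0 <= f i) -> (exists i, g i < 0) ->
  exists s : R, [/\ 0 <= s, s < 1, (forall i, 0 <= (1 - s) * f i + s * g i) &
    exists i, (1 - s) * f i + s * g i = 0 /\ g i < 0].
Proof.
move=> f0 [i0 gi0]; pose t i := f i / (f i - g i).
have [i gi imin] := @arg_minP _ _ _ i0 (fun i => g i < 0) t gi0.
have pos : 0 < f i - g i by have := f0 i; lra.
exists (t i); split.
- by rewrite divr_ge0 // ltW.
- by rewrite ltr_pdivrMr //; lra.
- move=> j; have [gj|gj] := ltP (g j) 0; last first.
    apply: addr_ge0; apply: mulr_ge0 => //; last by rewrite divr_ge0 // ltW.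
    by rewrite subr_ge0 ler_pdivrMr //; lra.
  have posj : 0 < f j - g j by have := f0 j; lra.
  have := imin _ gj; rewrite {2}/t ler_pdivlMr //; lra.
- exists i; split => //; rewrite /t; field; lra.
Qed.

Lemma first_exit3 (a0 b0 c0 a1 b1 c1 : R) : 0 <= a0 -> 0 <= b0 -> 0 <= c0 ->
  ~ [/\ 0 <= a1, 0 <= b1 & 0 <= c1] ->
  exists s : R, let w (t r : R) := (1 - s) * t + s * r in
    [/\ 0 <= s, s < 1, [/\ 0 <= w a0 a1, 0 <= w b0 b1 & 0 <= w c0 c1] &
     [\/ w a0 a1 = 0, w b0 b1 = 0 | w c0 c1 = 0]].
Proof.
move=> a00 b00 c00 neg.
have [||s [s0 s1 ge [i [ei _]]]] :=
  @first_exit 'I_3 (fun i => [:: a0; b0; c0]`_i) (fun i => [:: a1; b1; c1]`_i).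
- by case=> -[|[|[|//]]].
- apply: contrapT => no; apply: neg; split; rewrite leNgt; apply/negP => h.
  + by apply: no; exists 0.
  + by apply: no; exists 1.
  + by apply: no; exists 2.
exists s; split=> //; first by split; [exact: (ge 0)|exact: (ge 1)|exact: (ge 2)].
case: i ei => -[|[|[|//]]] _ /=; [exact: Or31|exact: Or32|exact: Or33].
Qed.

End Space.

#[local] Opaque dot.

(** * Polyhedral cones *)

Section Small.
Variable R : realType.
Implicit Types (P Q : R -> Prop) (a b e : R).

(** Eventually and frequently along positive numbers that tend to 0. *)
Definition small P := exists2 e0, 0 < e0 & forall e, 0 < e -> e <= e0 -> P e.

Definition often P := forall e0, 0 < e0 -> exists e, [/\ 0 < e, e <= e0 & P e].

Lemma small_and P Q : small P -> small Q -> small (fun e => P e /\ Q e).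
Proof.
move=> [a a0 Pa] [b b0 Qb]; exists (Num.min a b); first by rewrite lt_min a0.
by move=> e e0; rewrite le_min => /andP[ea eb]; split; [exact: Pa|exact: Qb].
Qed.

Lemma small_imp P Q : (forall e, 0 < e -> P e -> Q e) -> small P -> small Q.
Proof. by move=> PQ [a a0 Pa]; exists a => // e e0 ea; apply: PQ => //; exact: Pa. Qed.

Lemma small_ex P : small P -> exists2 e, 0 < e & P e.
Proof. by move=> [a a0 Pa]; exists a => //; apply: Pa. Qed.

Lemma small_always P : (forall e, 0 < e -> P e) -> small P.
Proof. by move=> PP; exists 1 => // e e0 _; exact: PP. Qed.

Lemma small_often P : small P -> often P.
Proof.
move=> [a a0 Pa] e0 e00; exists (Num.min a e0); split.
- by rewrite lt_min a0.
- by rewrite ge_min lexx orbT.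
- by apply: Pa; rewrite ?lt_min ?a0 // ge_min lexx.
Qed.

Lemma often_and P Q : often P -> small Q -> often (fun e => P e /\ Q e).
Proof.
move=> oP [b b0 Qb] e0 e00.
have [|e [pe]] := oP (Num.min b e0); first by rewrite lt_min b0.
by rewrite le_min => /andP[eb ee] Pe; exists e; split => //; split => //; exact: Qb.
Qed.

Lemma often_ex P : often P -> exists2 e, 0 < e & P e.
Proof. by move=> /(_ 1 ltr01) [e [? _ ?]]; exists e. Qed.

Lemma small_seq (T : eqType) (s : seq T) (P : T -> R -> Prop) :
  (forall i, i \in s -> small (P i)) -> small (fun e => forall i, i \in s -> P i e).
Proof.
elim: s => [|i s IH] Ps; first exact: small_always.
have sl : small (fun e => forall i, i \in s -> P i e).
  by apply: IH => j js; apply: Ps; rewrite inE js orbT.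
apply: small_imp (small_and (Ps i (mem_head i s)) sl) => e _ [Pi Pl] j.
by rewrite inE => /orP[/eqP->|/Pl].
Qed.

Lemma small_all (T : finType) (P : T -> R -> Prop) :
  (forall i, small (P i)) -> small (fun e => forall i, P i e).
Proof.
move=> Ps; apply: small_imp (@small_seq _ (enum T) P (fun i _ => Ps i)) => e _ Pe i.
by apply: Pe; rewrite mem_enum.
Qed.

Lemma small_affine_gt a b : 0 < a -> small (fun e => 0 < a + e * b).
Proof.
move=> a0; exists (a / (1 + `|b|) / 2).
  by rewrite !divr_gt0 // ltr_wpDr.
move=> e e0; rewrite -mulrA -invfM ler_pdivlMr; last first.
  by rewrite mulr_gt0 // ltr_wpDr.
have : - (e * `|b|) <= e * b by rewrite -mulrN ler_pM2l // lerNl -normrN ler_norm.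
by nra.
Qed.

Lemma small_affine_ge a b : 0 <= a -> (a = 0 -> 0 <= b) ->
  small (fun e => 0 <= a + e * b).
Proof.
rewrite le_eqVlt => /orP[/eqP <- /(_ erefl) b0|a0 _].
  by apply: small_always => e e0; rewrite add0r mulr_ge0 // ltW.
by apply: small_imp (small_affine_gt b a0) => e _ /ltW.
Qed.

Lemma often_affine a b : often (fun e => 0 <= a + e * b) -> 0 <= a.
Proof.
move=> o; rewrite leNgt; apply/negP => a0.
have [|e e0 [p1 p2]] := often_ex (often_and o (@small_affine_gt (- a) (- b) _)).
  by rewrite oppr_gt0.
by lra.
Qed.

(** Pigeonhole: one set of a finite family is met infinitely often. *)
Lemma often_cover (T : choiceType) (K : set T) (P : T -> R -> Prop) : finite_set K ->
  often (fun e => exists2 C, K C & P C e) -> exists2 C, K C & often (P C).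
Proof.
move=> /finite_seqP [s Ks] o; apply: contrapT => none.
have : small (fun e => forall C, C \in s -> ~ P C e).
  apply: small_seq => C Cs; apply: contrapT => ns; apply: none.
  exists C; first by rewrite Ks.
  move=> e0 e00; apply: contrapT => no; apply: ns; exists e0 => // e pe ee Pe.
  by apply: no; exists e.
move=> /(often_and o) /often_ex [e _ [[C KC PC] /(_ C)]]; apply => //.
by move: KC; rewrite Ks.
Qed.

End Small.

Section Cones.
Variable R : realType.
Local Notation E := 'rV[R]_3.
Implicit Types (A C : set E) (s : seq E) (n p q u v w x y : E).

Definition hcone s : set E := [set x | forall n, n \in s -> 0 <= dot n x].

Definition gcone k (v : 'I_k -> E) : set E :=
  [set x | exists a : 'I_k -> R, (forall i, 0 <= a i) /\ x = \sum_i a i *: v i].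

Lemma ge_all_ex (L : seq R) :
  exists t : R, [/\ 0 <= t, forall l, l \in L -> l <= t & t = 0 \/ t \in L].
Proof.
elim: L => [|l L [t [t0 Lt tL]]]; first by exists 0; split=> //; left.
have [lt|tl] := leP l t.
  exists t; split=> // [m|]; first by rewrite inE => /orP[/eqP->|/Lt].
  by case: tL => [|tL]; [left|right; rewrite inE tL orbT].
exists l; split; first exact: le_trans (ltW tl).
  move=> m; rewrite inE => /orP[/eqP->//|/Lt ml]; exact: le_trans (ltW tl).
by right; rewrite mem_head.
Qed.

(** Fourier-Motzkin elimination of the parameter of a ray. *)
Lemma hcone_add_ray s w : exists s', forall x,
  hcone s' x <-> exists2 t, 0 <= t & hcone s (x - t *: w).
Proof.
exists ([seq n <- s | 0 <= dot n w] ++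
  [seq (- dot m w) *: n + dot n w *: m |
     n <- [seq n <- s | 0 < dot n w], m <- [seq m <- s | dot m w < 0]]) => x.
split=> [xs|[t t0 xs] n].
  pose L := [seq dot m x / dot m w | m <- s & dot m w < 0].
  have [t [t0 Lt tL]] := ge_all_ex L.
  exists t => // n ns; rewrite dotBr dotZr subr_ge0.
  have [nw|nw|nw] := ltgtP (dot n w) 0.
  - rewrite -ler_ndivrMr //; apply: Lt; apply/mapP; exists n => //.
    by rewrite mem_filter nw.
  - case: tL => [->|/mapP [m]].
      by rewrite mul0r; apply: xs; rewrite mem_cat mem_filter ns ltW.
    rewrite mem_filter => /andP[mw ms] ->.
    have : 0 <= dot ((- dot m w) *: n + dot n w *: m) x.
      apply: xs; rewrite mem_cat; apply/orP; right; apply/allpairsP.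
      by exists (n, m); rewrite !mem_filter nw ns mw ms.
    rewrite !dotE => h.
    by rewrite mulrAC ler_ndivrMr //; lra.
  - by rewrite nw mulr0; apply: xs; rewrite mem_cat mem_filter ns nw lexx.
rewrite mem_cat => /orP[|/allpairsP [[n' m'] /=]].
  rewrite mem_filter => /andP[nw ns]; have := xs _ ns.
  rewrite dotBr dotZr; nra.
rewrite !mem_filter => -[/andP[nw ns] /andP[mw ms] ->].
have := xs _ ns; have := xs _ ms; rewrite !dotE => h1 h2.
nra.
Qed.

(** The easy half of the Minkowski-Weyl theorem: the generators are added one
    at a time to the zero cone, each by eliminating its coefficient. *)
Lemma gcone_hcone k (v : 'I_k -> E) : exists s, gcone v = hcone s.
Proof.
elim: k v => [|k IH] v.
  exists ([seq delta_mx 0 i | i <- enum 'I_3] ++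
          [seq - delta_mx 0 i | i <- enum 'I_3]).
  apply/seteqP; split=> [x [a [_ ->]] n _|x xs]; first by rewrite big_ord0 dot0r.
  exists (fun=> 0); split=> //; rewrite big_ord0; apply/rowP => i; rewrite mxE.
  apply: le_anti; rewrite -oppr_ge0 -dot_delta -dotNl; apply/andP; split.
    by apply: xs; rewrite mem_cat (map_f (fun i => - delta_mx 0 i)) ?mem_enum ?orbT.
  by apply: xs; rewrite mem_cat map_f ?mem_enum.
have [s es] := IH (fun i => v (lift ord0 i)).
have [s' es'] := hcone_add_ray s (v ord0); exists s'.
apply/seteqP; split=> x.
  move=> [a [a0 ->]]; apply/es'; exists (a ord0) => //; rewrite -es.
  exists (fun i => a (lift ord0 i)); split=> //.
  by rewrite big_ord_recl addrC addKr.
move=> /es' [t t0]; rewrite -es => -[a [a0 e]].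
exists (fun i => if unlift ord0 i is Some j then a j else t); split=> [i|].
  by case: unliftP.
rewrite big_ord_recl unlift_none -[LHS](subrK (t *: v ord0)) e addrC.
by congr (_ + _); apply: eq_bigr => i _; rewrite liftK.
Qed.

(** The algebraic interior of [A]. *)
Definition core A q := forall x, exists2 e, 0 < e & A (q + e *: x).

(** An irredundant description of a cone by its facets: the point [p i] lies
    on the facet of normal [n i] and strictly inside the other half-spaces. *)
Record facets k A (n p : 'I_k -> E) : Prop := Facets {
  facet_in : forall x, A x <-> forall i, 0 <= dot (n i) x;
  facet_on : forall i, dot (n i) (p i) = 0;
  facet_off : forall i j, i != j -> 0 < dot (n i) (p j)
}.

(** A description by a list of minimal length is irredundant: some [y]
    violates only the constraint [n].  The segment from the interior point [q]
    to [y] leaves the cone at a point where only this constraint is tight. *)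
Lemma hcone_facets s q : core (hcone s) q ->
  exists k (n p : 'I_k -> E), facets (hcone s) n p.
Proof.
set A := hcone s => cq.
(* the least number of half-spaces that define [A] *)
have exm : exists m, `[< exists2 t, size t = m & A = hcone t >].
  by exists (size s); apply/asboolP; exists s.
have [m /asboolP [t tm At] mmin] := ex_minnP exm.
have tu : uniq t.
  rewrite -[uniq t]negbK -ltn_size_undup -leqNgt tm; apply: mmin; apply/asboolP.
  exists (undup t) => //; rewrite At; apply/seteqP; split=> x xt n nt; apply: xt.
    by rewrite mem_undup in nt.
  by rewrite mem_undup.
have irr n : n \in t -> exists2 y, dot n y < 0 &
    forall l, l \in t -> l != n -> 0 <= dot l y.
  move=> nt; apply: contrapT => no.
  suff : (m <= (size t).-1)%N.
    by case: m tm {mmin} => [/size0nil t0|m ->]; [rewrite t0 in nt|rewrite ltnn].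
  apply: mmin; apply/asboolP; exists (rem n t); first by rewrite size_rem.
  rewrite At; apply/seteqP; split=> x xt l.
    by move=> /mem_rem; exact: xt.
  move=> lt; have [->|ln] := eqVneq l n; last first.
    by apply: xt; rewrite mem_rem_uniq // inE ln.
  rewrite leNgt; apply/negP => nx; apply: no; exists x => // l' lt' ln'.
  by apply: xt; rewrite mem_rem_uniq // inE ln'.
have qpos n : n \in t -> 0 < dot n q.
  move=> nt; have [y ny _] := irr _ nt; have [e e0] := cq y.
  by rewrite At => /(_ _ nt); rewrite dotDr dotZr; nra.
have /choice [y yP] (i : 'I_(size t)) : exists y, dot t`_i y < 0 /\
    forall j : 'I_(size t), j != i -> 0 <= dot t`_j y.
  have [y ny oy] := irr _ (mem_nth 0 (ltn_ord i)); exists y; split=> // j ji.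
  by apply: oy; rewrite ?mem_nth // nth_uniq.
exists (size t), (fun i : 'I_(size t) => t`_i),
  (fun i : 'I_(size t) => - dot t`_i (y i) *: q + dot t`_i q *: y i); split.
- move=> x; rewrite At; split=> [xt i|xt l /(nthP 0) [i it <-]].
    by apply: xt; rewrite mem_nth.
  exact: (xt (Ordinal it)).
- by move=> i; rewrite !dotE; ring.
- move=> i j ij; have [ny oy] := yP j; have := oy i ij.
  rewrite !dotE; have := qpos _ (mem_nth 0 (ltn_ord i)).
  have := qpos _ (mem_nth 0 (ltn_ord j)); nra.
Qed.

End Cones.

(** * Cells of a tight fan *)

Section SignPattern.
Variable R : realType.
Local Notation E := 'rV[R]_3.
Variables (k : nat) (n p : 'I_k -> E).
Hypothesis on : forall i, dot (n i) (p i) = 0.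
Hypothesis off : forall i j, i != j -> 0 < dot (n i) (p j).

(** A linear relation between three of the [n i], evaluated at the [p i],
    would give its coefficients pairwise opposite signs. *)
Lemma sign_indep3 i j l : i != j -> i != l -> j != l ->
  indep3 (n i) (n j) (n l).
Proof.
move=> ij il jl s t r e.
have ei := congr1 (fun f => dot f (p i)) e.
have ej := congr1 (fun f => dot f (p j)) e.
have el := congr1 (fun f => dot f (p l)) e.
rewrite /= !dotE !on ?mulr0 ?addr0 ?add0r in ei ej el.
have a1 := off ij; have a2 := off il.
have a3 := off jl; rewrite eq_sym in ij; rewrite eq_sym in il.
rewrite eq_sym in jl.
have a4 := off ij; have a5 := off il.
have a6 := off jl.
have s0 := cyclic_signs a4 a5 a1 a6 a2 a3 ei ej el.
rewrite s0 !mul0r !add0r in ej el; split=> //.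
  by move/eqP: el; rewrite mulf_eq0 (gt_eqF a3) orbF => /eqP.
by move/eqP: ej; rewrite mulf_eq0 (gt_eqF a6) orbF => /eqP.
Qed.

End SignPattern.

Section Facets.
Variable R : realType.
Local Notation E := 'rV[R]_3.
Variables (k : nat) (A : set E) (n p : 'I_k -> E).
Hypothesis fA : facets A n p.

Lemma facet_indep3 i j l : i != j -> i != l -> j != l ->
  indep3 (n i) (n j) (n l).
Proof. exact: (sign_indep3 (facet_on fA) (facet_off fA)). Qed.

Lemma facet_pts_indep3 i j l : i != j -> i != l -> j != l ->
  indep3 (p i) (p j) (p l).
Proof.
apply: (sign_indep3 (n := p) (p := n)) => [a|a b ab]; rewrite dotC.
  exact: (facet_on fA).
by apply: (facet_off fA); rewrite eq_sym.
Qed.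

Lemma facet_eq0 i j l x : i != j -> i != l -> j != l ->
  dot (n i) x = 0 -> dot (n j) x = 0 -> dot (n l) x = 0 -> x = 0.
Proof. by move=> ij il jl; apply/indep3_eq0/facet_indep3. Qed.

Lemma facet_pt_in i : A (p i).
Proof.
apply/(facet_in fA) => j; have [->|ji] := eqVneq j i; first by rewrite (facet_on fA).
exact/ltW/(facet_off fA).
Qed.

Lemma facet_local r x : A r -> (forall i, dot (n i) r = 0 -> 0 <= dot (n i) x) ->
  small (fun e => A (r + e *: x)).
Proof.
move=> /(facet_in fA) Ar rx.
have := @small_all _ _ (fun i e => 0 <= dot (n i) r + e * dot (n i) x) _.
move=> /(_ (fun i => small_affine_ge (Ar i) (rx i))).
by apply: small_imp => e _ Ae; apply/(facet_in fA) => i; rewrite !dotE.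
Qed.

Lemma facet_core q : (forall i, 0 < dot (n i) q) -> core A q.
Proof.
move=> nq x; apply: small_ex; apply: facet_local => [|i e].
  by apply/(facet_in fA) => i; apply: ltW.
by have := nq i; rewrite e ltxx.
Qed.

End Facets.

(** What the classification uses of the full-dimensional cones of a tight fan
    with vertex 0.  Cells meet in faces ([tc_face]); cells that meet in a ray
    are symmetric about it near its points ([tc_ray]); cells that meet in the
    vertex only are opposite, and then the whole family is centrally symmetric
    ([tc_anti]). *)
Record tight_cells (R : realType) (K : set (set 'rV[R]_3)) : Prop := TightCells {
  tc_finite : finite_set K;
  tc_poly : forall C, K C -> exists s, C = hcone s;
  tc_core : forall C, K C -> exists q, core C q;
  tc_pointed : forall C x, K C -> C x -> C (- x) -> x = 0;
  tc_cover : forall x, exists2 C, K C & C x;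
  tc_face : forall C D x y, K C -> K D -> C x -> C y -> D (x + y) -> D x;
  tc_ray : forall C D r, K C -> K D -> C <> D -> r <> 0 -> C r -> D r ->
    (forall x, C x -> D x -> exists t, x = t *: r) ->
    forall x, small (fun e => C (r + e *: x) <-> D (r - e *: x));
  tc_anti : forall C D, K C -> K D -> C <> D ->
    (forall x, C x -> D x -> x = 0) ->
    (forall x, C x <-> D (- x)) /\ forall B, K B -> K [set x | B (- x)]
}.

Section Cells.
Variable R : realType.
Local Notation E := 'rV[R]_3.
Variable K : set (set E).
Hypothesis hK : tight_cells K.
Implicit Types (A C D N : set E) (q r u w x y : E).

Lemma cell0 C : K C -> C 0.
Proof. by move=> /(tc_poly hK) [s ->] n _; rewrite dot0r. Qed.

Lemma cellD C x y : K C -> C x -> C y -> C (x + y).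
Proof.
by move=> /(tc_poly hK) [s ->] Cx Cy n ns; rewrite dotDr addr_ge0 ?Cx ?Cy.
Qed.

Lemma cellZ C a x : K C -> 0 <= a -> C x -> C (a *: x).
Proof.
by move=> /(tc_poly hK) [s ->] a0 Cx n ns; rewrite dotZr mulr_ge0 ?Cx.
Qed.

Lemma cellZK C a x : K C -> 0 < a -> C (a *: x) -> C x.
Proof.
move=> KC a0 Cx; rewrite -[x](scalerK (lt0r_neq0 a0)).
by apply: cellZ => //; rewrite invr_ge0 ltW.
Qed.

Lemma cell_face C D x y a b : K C -> K D -> C x -> C y -> 0 < a -> 0 <= b ->
  D (a *: x + b *: y) -> D x.
Proof.
move=> KC KD Cx Cy a0 b0 Dxy; apply: (@cellZK D a) => //.
by apply: (tc_face hK KC KD _ _ Dxy); apply: cellZ => //; apply: ltW.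
Qed.

Lemma cell_closed C x w : K C -> often (fun e => C (x + e *: w)) -> C x.
Proof.
move=> /(tc_poly hK) [s ->] o n ns; apply: (@often_affine _ _ (dot n w)) => e0 e00.
have [e [e1 e2 Ce]] := o e0 e00; exists e; split=> //.
by have := Ce n ns; rewrite !dotE.
Qed.

Lemma core_cell C q : core C q -> C q.
Proof. by move=> /(_ 0) [e e0]; rewrite scaler0 addr0. Qed.

Lemma core_add C x q e : K C -> C x -> core C q -> 0 < e -> core C (x + e *: q).
Proof.
move=> KC Cx cq e0 w; have [d d0 Cd] := cq w; exists (e * d).
  by rewrite mulr_gt0.
rewrite (_ : _ + _ = x + e *: (q + d *: w)); last by vring.
by apply: cellD => //; apply: cellZ => //; apply: ltW.
Qed.

(** Every [x] of [C] is an end of a segment of [C] through the interior point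
    [q], and [C] meets [D] in a face. *)
Lemma core_subset C D q : K C -> K D -> core C q -> D q -> C `<=` D.
Proof.
move=> KC KD cq Dq x Cx; have [e e0 Ce] := cq (- x).
apply: (cell_face KC KD Cx Ce e0 ler01).
by rewrite (_ : _ + 1 *: _ = q) //; vring.
Qed.

Lemma core_inj C D q : K C -> K D -> core C q -> D q -> C = D.
Proof.
move=> KC KD cq Dq; have CD := core_subset KC KD cq Dq.
apply/seteqP; split=> //; apply: (core_subset KD KC _ (core_cell cq)).
by move=> x; have [e e0 /CD De] := cq x; exists e.
Qed.

Lemma cell_opp_neq C x : K C -> C x -> x <> 0 -> ~ C (- x).
Proof. by move=> KC Cx x0 Cn; exact: x0 (tc_pointed hK KC Cx Cn). Qed.

Lemma often_cell x w : exists2 C, K C & often (fun e => C (x + e *: w)).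
Proof.
apply: (often_cover (P := fun C e => C (x + e *: w)) (tc_finite hK)).
apply: small_often; apply: small_always => e _.
exact: (tc_cover hK).
Qed.

Lemma low_kernel {m : nat} (f : 'I_m -> E) : (m < 3)%N ->
  exists2 x, x != 0 & forall i, dot (f i) x = 0.
Proof.
move=> m3; pose M := \matrix_(i, j) f j 0 i.
have : kermx M != 0.
  by rewrite -mxrank_eq0 mxrank_ker subn_eq0 -ltnNge (leq_ltn_trans (rank_leq_col M)).
case/rowV0Pn => v /sub_kermxP vM v0; exists v => // i.
have := congr1 (fun B : 'rV[R]_m => B 0 i) vM; rewrite /= !mxE => <-.
by apply: eq_bigr => j _; rewrite !mxE mulrC.
Qed.

Section OneCell.
Variables (k : nat) (A : set E) (n p : 'I_k -> E).
Hypotheses (KA : K A) (fA : facets A n p).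

(** The boundary planes of fewer than three half-spaces share a line. *)
Lemma facets_ge3 : (3 <= k)%N.
Proof.
rewrite leqNgt; apply/negP => /(low_kernel n) [x x0 nx].
move/eqP: x0; apply; apply: (tc_pointed hK KA); apply/(facet_in fA) => i.
  by rewrite nx.
by rewrite dotNr nx oppr0.
Qed.

Lemma facet_other (i j : 'I_k) : exists l, i != l /\ j != l.
Proof.
apply: contrapT => no; have := facets_ge3; rewrite leqNgt => /negP; apply.
have : (#|'I_k| <= #|[set i; j]%SET|)%N.
  apply/subset_leq_card/fintype.subsetP => l _; rewrite !inE; apply/negPn/negP.
  by rewrite negb_or => /andP[li lj]; apply: no; exists l; rewrite eq_sym li eq_sym.
by rewrite card_ord cards2 ltnS => /leq_trans; apply; case: (i != j).
Qed.

End OneCell.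
End Cells.

(** * Neighbours of a cell *)

Section Neighbours.
Variable R : realType.
Local Notation E := 'rV[R]_3.
Variable K : set (set E).
Hypothesis hK : tight_cells K.
Implicit Types (C D N : set E) (q r u w x y : E).

Section OneCell.
Variables (k : nat) (A : set E) (n p : 'I_k -> E).
Hypotheses (KA : K A) (fA : facets A n p).

Lemma facet_normal_neq0 i : n i <> 0.
Proof.
have [l [il _]] := facet_other hK KA fA i i => e.
by have := facet_off fA il; rewrite e dot0l ltxx.
Qed.

Lemma facet_pt_neq0 i : p i <> 0.
Proof.
have [l [il _]] := facet_other hK KA fA i i => e; rewrite eq_sym in il.
by have := facet_off fA il; rewrite e dot0r ltxx.
Qed.

Lemma core_gt0 q i : core A q -> 0 < dot (n i) q.
Proof.
move=> cq; have [e e0 /(facet_in fA) /(_ i)] := cq (- n i).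
rewrite !dotE mulrN subr_ge0; apply: lt_le_trans.
exact/mulr_gt0/dot_gt0/facet_normal_neq0.
Qed.

(** A cell that contains points beyond the facet arbitrarily close to [p i]
    contains [p i]. *)
Lemma neighbour_ex i : exists N, [/\ K N, N <> A & N (p i)].
Proof.
have [q cq] := tc_core hK KA.
have [N KN oN] := often_cell hK (p i) (- q); exists N; split=> //.
  move=> NA; have [e e0] := often_ex oN; rewrite NA => /(facet_in fA) /(_ i).
  by rewrite !dotE (facet_on fA) add0r mulrN oppr_ge0 leNgt mulr_gt0 // core_gt0.
exact: (cell_closed hK KN oN).
Qed.

(** [p i] is in the relative interior of the facet. *)
Lemma facet_sub_neighbour N i x : K N -> N (p i) -> A x -> dot (n i) x = 0 -> N x.
Proof.
move=> KN Np Ax nx.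
have : small (fun e => A (p i + e *: - x)).
  apply: (facet_local fA) => [|j]; first exact: facet_pt_in fA i.
  have [->|ji] := eqVneq j i; first by rewrite dotNr nx oppr0.
  by move=> e; have := facet_off fA ji; rewrite e ltxx.
move=> /small_ex [e e0 Ae]; apply: (cell_face hK KA KN Ax Ae e0 ler01).
by rewrite (_ : _ + 1 *: _ = p i) //; vring.
Qed.

(** Otherwise [p i + x] would be an interior point of [A] that is in [N]. *)
Lemma neighbour_meet N i x : K N -> N <> A -> N (p i) ->
  A x -> N x -> dot (n i) x = 0.
Proof.
move=> KN NA Np Ax Nx; apply/eqP; rewrite eq_le; apply/andP; split; last first.
  exact: (proj1 (facet_in fA x)).
rewrite leNgt; apply/negP => nx; apply: NA; symmetry.
apply: (core_inj hK KA KN (q := p i + x)); last exact: (cellD hK).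
apply: (facet_core fA) => j; rewrite dotDr; have [->|ji] := eqVneq j i.
  by rewrite (facet_on fA) add0r.
by rewrite ltr_wpDr ?(facet_off fA) //; apply: (proj1 (facet_in fA x)).
Qed.

Lemma neighbour_side N i x : K N -> N <> A -> N (p i) -> N x -> dot (n i) x <= 0.
Proof.
move=> KN NA Np Nx; rewrite leNgt; apply/negP => nx.
have : small (fun e => A (p i + e *: x)).
  apply: (facet_local fA) => [|j]; first exact: facet_pt_in fA i.
  have [->|ji] := eqVneq j i; first by rewrite ltW.
  by move=> e; have := facet_off fA ji; rewrite e ltxx.
move=> /small_ex [e e0 Ae].
have /(neighbour_meet KN NA Np Ae) : N (p i + e *: x).
  by apply: (cellD hK) => //; apply: (cellZ hK) => //; apply: ltW.
by rewrite !dotE (facet_on fA) add0r => /eqP; rewrite mulf_eq0 !gt_eqF.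
Qed.

Lemma side_core f N q : f <> 0 -> (forall x, N x -> dot f x <= 0) -> core N q ->
  dot f q < 0.
Proof.
move=> f0 Nf /(_ f) [e e0 /Nf]; rewrite !dotE => h.
by have := mulr_gt0 e0 (dot_gt0 f0); lra.
Qed.

Lemma neighbour_core N i q : K N -> N <> A -> N (p i) -> core N q -> dot (n i) q < 0.
Proof.
move=> KN NA Np; apply: side_core; first exact: facet_normal_neq0.
by move=> x; exact: neighbour_side.
Qed.

(** Interior points [q] and [q'] of the two cells can be scaled so that [q - q']
    is in the plane of the facet; then the cells overlap near [p i]. *)
Lemma neighbour_uniq N N' i : K N -> N <> A -> N (p i) ->
  K N' -> N' <> A -> N' (p i) -> N = N'.
Proof.
move=> KN NA Np KN' NA' Np'.
have [q cq] := tc_core hK KN; have [q' cq'] := tc_core hK KN'.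
have nq := neighbour_core KN NA Np cq; have nq' := neighbour_core KN' NA' Np' cq'.
pose c := dot (n i) q / dot (n i) q'; pose w := q - c *: q'.
have c0 : 0 < c by rewrite /c -mulrNN -invrN divr_gt0 // oppr_gt0.
have nw : dot (n i) w = 0 by rewrite /w !dotE /c divfK ?subrr // lt_eqF.
have : small (fun e => A (p i + e *: w)).
  apply: (facet_local fA) => [|j]; first exact: facet_pt_in fA i.
  have [->|ji] := eqVneq j i; first by rewrite nw.
  by move=> e; have := facet_off fA ji; rewrite e ltxx.
move=> /small_ex [e e0 Ae]; apply: (core_inj hK KN KN' (q := p i + e *: q)).
  exact: (core_add hK).
rewrite (_ : _ + _ = (p i + e *: w) + (e * c) *: q'); last by rewrite /w; vring.
apply: (cellD hK) => //; last first.
  by apply: (cellZ hK _ (ltW (mulr_gt0 e0 c0))) => //; exact: core_cell cq'.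
by apply: (facet_sub_neighbour KN' Np' Ae); rewrite dotDr dotZr nw (facet_on fA) mulr0 addr0.
Qed.

(** The ray of [r] is [A `&` C], and it is where the facets [i] and [j] meet. *)
Record ray_meet C i j r : Prop := RayMeet {
  rm_neq : i != j;
  rm_l : A r;
  rm_r : C r;
  rm_ni : dot (n i) r = 0;
  rm_nj : dot (n j) r = 0;
  rm_pos : forall l, i != l -> j != l -> 0 < dot (n l) r;
  rm_line : forall x, A x -> C x -> exists t, x = t *: r
}.

(** The set of facets of [A] that contain [A `&` C] determines the type of the
    intersection: one facet, two facets meeting in a ray, or at least three,
    which leave only the vertex. *)
Lemma meet_cases C : K C -> C <> A ->
  [\/ exists i, C (p i), exists i j r, ray_meet C i j r |
      forall x, A x -> C x -> x = 0].
Proof.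
move=> KC CA.
pose J i := forall x, A x -> C x -> dot (n i) x = 0.
have [z [Az Cz nz]] : exists z, [/\ A z, C z & forall i, ~ J i -> 0 < dot (n i) z].
  suff: exists z, [/\ A z, C z & forall i, i \in enum 'I_k -> ~ J i -> 0 < dot (n i) z].
    by move=> [z [Az Cz nz]]; exists z; split=> // i; apply: nz; rewrite mem_enum.
  elim: (enum 'I_k) => [|i s [z [Az Cz nz]]].
    by exists 0; split=> //; [exact: (cell0 hK KA)|exact: (cell0 hK KC)].
  have [Ji|nJ] := pselect (J i).
    exists z; split=> // j; rewrite inE => /orP[/eqP->|]; [by []|exact: nz].
  have [x [Ax Cx nx]] : exists x, [/\ A x, C x & dot (n i) x <> 0].
    apply: contrapT => no; apply: nJ => x Ax Cx; apply: contrapT => nx.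
    by apply: no; exists x.
  exists (z + x); split; [exact: (cellD hK)|exact: (cellD hK)|].
  have xge j : 0 <= dot (n j) x by apply: (proj1 (facet_in fA x)).
  have zge j : 0 <= dot (n j) z by apply: (proj1 (facet_in fA z)).
  move=> j; rewrite inE dotDr => /orP[/eqP-> _|js nj].
    by rewrite ltr_wpDl // lt0r xge andbT; apply/eqP.
  by rewrite ltr_pwDl // nz.
have zcore : ~ (forall i, 0 < dot (n i) z).
  by move=> /(facet_core fA) cz; apply: CA; symmetry; exact: (core_inj hK KA KC cz).
have [i Ji] : exists i, J i.
  by apply: contrapT => no; apply: zcore => i; apply: nz => Ji; apply: no; exists i.
have [[j [ij Jj]]|no2] := pselect (exists j, i != j /\ J j); last first.
  apply: Or31; exists i.
  have : small (fun e => A (z + e *: - p i)).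
    apply: (facet_local fA) => // j; have [->|ji] := eqVneq j i.
      by rewrite dotNr (facet_on fA) oppr0.
    have /nz h : ~ J j by move=> Jj; apply: no2; exists j; rewrite eq_sym.
    by move=> e; move: h; rewrite e ltxx.
  move=> /small_ex [e e0 Ae].
  apply: (cell_face hK KA KC (facet_pt_in fA i) Ae e0 ler01).
  by rewrite (_ : _ + 1 *: _ = z) //; vring.
have [[l [il jl Jl]]|no3] := pselect (exists l, [/\ i != l, j != l & J l]).
  apply: Or33 => x Ax Cx.
  by apply: (facet_eq0 fA ij il jl); [exact: Ji|exact: Jj|exact: Jl].
have nz' l : i != l -> j != l -> 0 < dot (n l) z.
  by move=> il jl; apply: nz => Jl; apply: no3; exists l.
apply: Or32; exists i, j, z; split=> //; [exact: Ji|exact: Jj|].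
move=> x Ax Cx; have [l [il jl]] := facet_other hK KA fA i j.
exists (dot (n l) x / dot (n l) z).
apply/eqP; rewrite -subr_eq0; apply/eqP; apply: (facet_eq0 fA ij il jl).
- by rewrite !dotE (Ji x) // (Ji z) // mulr0 subrr.
- by rewrite !dotE (Jj x) // (Jj z) // mulr0 subrr.
- by rewrite !dotE divfK ?subrr // gt_eqF // nz'.
Qed.

End OneCell.
End Neighbours.

(** * Crossing segments *)

Section Crossing.
Variable R : realType.
Local Notation E := 'rV[R]_3.
Implicit Types (p q pa pb pc pd x y w : E).

(** On the sphere, the arcs [p x] and [q y] meet. *)
Definition cross p x q y := exists a b c d : R,
  [/\ 0 <= a, 0 <= b, 0 <= c & 0 <= d] /\
  (a *: p + b *: x = c *: q + d *: y /\ a *: p + b *: x <> 0).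

(** The segment from [p] to [x] avoids 0, which is not a point of the sphere. *)
Definition not_opposite x p := forall s : R, 0 <= s -> x <> - (s *: p).

(** On the sphere, a great circle that touches the quadrilateral
    [p0 p1 p2 p3] in [p0] only separates it from [x]. *)
Definition beyond p0 p1 p2 p3 x := exists n : E,
  [/\ dot n p0 = 0, dot n p1 > 0, dot n p2 > 0 & dot n p3 > 0] /\ dot n x <= 0.

(** A point of the segment [q y] on the boundary of the triangle [pa pc x] is on
    one of the two sides through [x]: the side [pa pc] is strictly on the other
    side of the plane of normal [n]. *)
Lemma boundary_cross pa pc q x y (n : E) (g d a b c : R) :
  dot n q = 0 -> 0 < dot n pa -> 0 < dot n pc -> dot n y <= 0 ->
  q <> 0 -> not_opposite y q -> 0 <= g -> 0 <= d -> 0 < g + d ->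
  0 <= a -> 0 <= b -> 0 <= c -> [\/ a = 0, b = 0 | c = 0] ->
  g *: q + d *: y = a *: pa + b *: pc + c *: x ->
  cross pa x q y \/ cross pc x q y.
Proof.
move=> nq na nc ny q0 opp g0 d0 gd a0 b0 c0 z e.
have w0 : g *: q + d *: y <> 0.
  have [d00|d00] := eqVneq d 0.
    rewrite d00 scale0r addr0 => /eqP; rewrite scaler_eq0 => /orP[/eqP g00|/eqP //].
    by move: gd; rewrite g00 d00 addr0 ltxx.
  move=> w0; apply: (opp (d^-1 * g)); first by rewrite mulr_ge0 // invr_ge0.
  apply: (scalerI d00); rewrite scalerN scalerA mulVKf //.
  by apply/eqP; rewrite -addr_eq0 addrC w0.
case: z => z0.
- right; exists b, c, g, d; split=> //; rewrite e z0 scale0r add0r.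
  by split=> //; move: w0; rewrite e z0 scale0r add0r.
- left; exists a, c, g, d; split=> //; rewrite e z0 scale0r addr0.
  by split=> //; move: w0; rewrite e z0 scale0r addr0.
case: w0; have := congr1 (dot n) e; rewrite z0 !dotE nq mulr0 add0r mul0r addr0.
move=> e1.
have a00 : a = 0 by nra.
have b00 : b = 0 by nra.
by rewrite e z0 a00 b00 !scale0r !addr0.
Qed.

Lemma diagonal_indep pa pb pc pd x y :
  beyond pa pb pc pd x -> beyond pc pa pb pd y -> indep2 pa pc.
Proof.
move=> [na [[na0 nab nac nad] _]] [nc [[nc0 nca ncb ncd] _]] s t e.
have := congr1 (dot na) e; have := congr1 (dot nc) e.
rewrite !dotE na0 nc0 !mulr0 addr0 add0r => /eqP es /eqP et.
move: es et; rewrite !mulf_eq0 (gt_eqF nac) (gt_eqF nca) !orbF.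
by move=> /eqP -> /eqP ->.
Qed.

(** Suppose that [x] is on the side of [pd] of the plane of the diagonal
    [pa pc].  Then the triangle [pa pc x] contains [pd] but not [pb], and the
    path from [pb] to [pd] through [y] leaves it across [pa x] or [pc x]. *)
Lemma crossing_side pa pb pc pd x y f : pa + pc = pb + pd ->
  beyond pa pb pc pd x -> beyond pc pa pb pd x ->
  beyond pb pa pc pd y -> beyond pd pa pb pc y ->
  not_opposite x pa -> not_opposite x pc ->
  not_opposite y pb -> not_opposite y pd ->
  dot f pa = 0 -> dot f pc = 0 -> 0 < dot f pd -> 0 <= dot f x ->
  exists q, (q = pb \/ q = pd) /\ (cross pa x q y \/ cross pc x q y).
Proof.
move=> diag ba bc bb bd oxa oxc oyb oyd fa fc fd fx.
have ind := diagonal_indep ba bc.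
have fb : dot f pb = - dot f pd.
  have := congr1 (dot f) diag; rewrite !dotDr fa fc; lra.
case: ba bc bb bd => na [[na0 nab nac nad] nax] [nc [[nc0 nca ncb ncd] ncx]]
  [nb [[nb0 nba nbc nbd] nby]] [nd [[nd0 nda ndb ndc] ndy]].
have pb0 : pb <> 0 by move=> e; move: nab; rewrite e dot0r ltxx.
have pd0 : pd <> 0 by move=> e; move: nad; rewrite e dot0r ltxx.
have viab (s a b c : R) : 0 <= s -> s < 1 -> 0 <= a -> 0 <= b -> 0 <= c ->
    [\/ a = 0, b = 0 | c = 0] ->
    (1 - s) *: y + s *: pb = a *: pa + b *: pc + c *: x ->
    exists q, (q = pb \/ q = pd) /\ (cross pa x q y \/ cross pc x q y).
  move=> s0 s1 a0 b0 c0 z; rewrite addrC => e; exists pb; split; first by left.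
  apply: (boundary_cross nb0 nba nbc nby pb0 oyb s0 _ _ a0 b0 c0 z e); lra.
have viad (s a b c : R) : 0 <= s -> s <= 1 -> 0 <= a -> 0 <= b -> 0 <= c ->
    [\/ a = 0, b = 0 | c = 0] ->
    (1 - s) *: pd + s *: y = a *: pa + b *: pc + c *: x ->
    exists q, (q = pb \/ q = pd) /\ (cross pa x q y \/ cross pc x q y).
  move=> s0 s1 a0 b0 c0 z e; exists pd; split; first by right.
  by apply: (boundary_cross nd0 nda ndc ndy pd0 oyd _ s0 _ a0 b0 c0 z e); lra.
have [fx0|fx0] := ltP 0 (dot f x).
  have [a [b [c D]]] := indep3_dual (indep2_extend ind fa fc (lt0r_neq0 fx0)).
  have [dec _] := dual_bases_sym D.
  have cf z : dot f z = dot c z * dot f x.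
    by rewrite {1}(dec z) !dotE fa fc !mulr0 !add0r.
  have cd : 0 < dot c pd by have := cf pd; nra.
  have cb : dot c pb < 0 by have := cf pb; nra.
  have ad : 0 < dot a pd.
    have := congr1 (dot nc) (dec pd); rewrite !dotE nc0; nra.
  have bd : 0 < dot b pd.
    have := congr1 (dot na) (dec pd); rewrite !dotE na0; nra.
  have [[ya yb yc]|yT] := pselect [/\ 0 <= dot a y, 0 <= dot b y & 0 <= dot c y].
    have [|s /= [s0 s1 [wa wb wc] z]] := @first_exit3 _ _ _ _ (dot a pb) (dot b pb)
      (dot c pb) ya yb yc.
      by move=> [_ _]; rewrite leNgt cb.
    apply: (viab s _ _ _ s0 s1 wa wb wc z).
    rewrite {1}(dec y) {1}(dec pb).
    by move: (dot a y) (dot b y) (dot c y) (dot a pb) (dot b pb) (dot c pb) => *; vring.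
  have [s /= [s0 s1 [wa wb wc] z]] := @first_exit3 _ _ _ _ _ _ _
    (ltW ad) (ltW bd) (ltW cd) yT.
  apply: (viad s _ _ _ s0 (ltW s1) wa wb wc z).
  rewrite {1}(dec y) {1}(dec pd).
  by move: (dot a y) (dot b y) (dot c y) (dot a pd) (dot b pd) (dot c pd) => *; vring.
(* When [x] is in the plane of the diagonal, the rays of [pa], [pc] and [x]
   positively span this plane, and the path through [y] crosses it anyway. *)
have {fx fx0} fx : dot f x = 0 by lra.
have [a [b [c D]]] := indep3_dual (indep2_extend ind fa fc (lt0r_neq0 fd)).
have [dec _] := dual_bases_sym D.
have dec0 z : dot f z = 0 -> z = dot a z *: pa + dot b z *: pc.
  move=> fz; have := congr1 (dot f) (dec z); rewrite !dotE fz fa fc !mulr0 !add0r.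
  move=> /esym/eqP; rewrite mulf_eq0 (gt_eqF fd) orbF => /eqP cz.
  by rewrite {1}(dec z) cz scale0r addr0.
have ex := dec0 x fx; move: (dot a x) (dot b x) ex => al ga ex.
have al0 : al < 0.
  have : al <= 0 by move: ncx; rewrite ex !dotE nc0; nra.
  rewrite le_eqVlt => /orP[/eqP al0|//]; exfalso.
  apply: (oxc (- ga)); last by rewrite ex al0; vring.
  by move: nax; rewrite ex !dotE na0 al0; nra.
have ga0 : ga < 0.
  have : ga <= 0 by move: nax; rewrite ex !dotE na0; nra.
  rewrite le_eqVlt => /orP[/eqP ga0|//]; exfalso.
  by apply: (oxa (- al)); [lra|rewrite ex ga0; vring].
have tri w : dot f w = 0 -> exists u v t : R,
    [/\ 0 <= u, 0 <= v, 0 <= t & [\/ u = 0, v = 0 | t = 0]] /\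
    w = u *: pa + v *: pc + t *: x.
  move=> /dec0; move: (dot a w) (dot b w) => l m ->.
  have [/andP[l0 m0]|neg] := boolP ((0 <= l) && (0 <= m)).
    exists l, m, 0; split; first by split=> //; exact: Or33.
    by rewrite scale0r addr0.
  have [P lP] : exists P : R, l = P * al by exists (l / al); rewrite divfK // lt_eqF.
  have [Q mQ] : exists Q : R, m = Q * ga by exists (m / ga); rewrite divfK // lt_eqF.
  move: neg; rewrite {}lP {}mQ negb_and -!ltNge => neg.
  have [QP|PQ] := leP Q P.
    exists 0, ((Q - P) * ga), P; split; last by rewrite ex; vring.
    split=> //; [nra| |exact: Or31].
    by case/orP: neg; nra.
  exists ((P - Q) * al), 0, Q; split; last by rewrite ex; vring.
  split=> //; [nra| |exact: Or32].
  by case/orP: neg; nra.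
have fb0 : dot f pb < 0 by rewrite fb oppr_lt0.
have [fy|fy] := leP 0 (dot f y).
  have [s [s0 s1 es]] := zero_between fy fb0.
  have [|u [v [t [[u0 v0 t0 z] e]]]] := tri ((1 - s) *: y + s *: pb).
    by rewrite dotDr !dotZr es.
  exact: viab s0 s1 u0 v0 t0 z e.
have [s [s0 s1 es]] := zero_between (ltW fd) fy.
have [|u [v [t [[u0 v0 t0 z] e]]]] := tri ((1 - s) *: pd + s *: y).
  by rewrite dotDr !dotZr es.
exact: viad s0 (ltW s1) u0 v0 t0 z e.
Qed.

(** Two closed curves on the sphere cannot cross only once: if the diagonals
    [pa pc] and [pb pd] cross, then the closed paths through [pa pc x] and
    [pb pd y] cross a second time.  Up to the exchange of [pb] and [pd], the
    point [x] is on the side of [pd] of the plane of [pa pc]. *)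
Lemma crossing pa pb pc pd x y : pa + pc = pb + pd ->
  beyond pa pb pc pd x -> beyond pc pa pb pd x ->
  beyond pb pa pc pd y -> beyond pd pa pb pc y ->
  not_opposite x pa -> not_opposite x pc ->
  not_opposite y pb -> not_opposite y pd ->
  exists p q, [/\ p = pa \/ p = pc, q = pb \/ q = pd & cross p x q y].
Proof.
move=> diag ba bc bb bd oxa oxc oyb oyd.
have ind := diagonal_indep ba bc.
have ind3 : indep3 pa pc pd.
  case: ba bc bd => na [[na0 nab nac nad] _] [nc [[nc0 nca ncb ncd] _]]
    [nd [[nd0 nda ndb ndc] _]] s t r e.
  have r0 : r = 0.
    have e1 := congr1 (dot na) e; have e2 := congr1 (dot nc) e.
    have e3 := congr1 (dot nd) e; rewrite !dotE ?na0 ?nc0 ?nd0 in e1 e2 e3.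
    apply: (@cyclic_signs _ r s t _ _ _ _ _ _ nda ndc nad nac ncd nca).
    - by rewrite -[RHS]e3; ring.
    - by rewrite -[RHS]e1; ring.
    - by rewrite -[RHS]e2; ring.
  by move: e; rewrite r0 scale0r addr0 => /ind [-> ->].
have [a [b [f [_ ev]]]] := indep3_dual ind3.
have [/= fa fc fd] := ev 0 0 1.
rewrite !scale0r !add0r scale1r in fa fc fd.
have fb : dot f pb = - 1.
  have := congr1 (dot f) diag.
  by rewrite !dotDr (dotC f pa) (dotC f pc) (dotC f pd) fa fc fd; lra.
have [fx|fx] := leP 0 (dot f x).
  have [|||q [q2 c]] := crossing_side diag ba bc bb bd oxa oxc oyb oyd _ _ _ fx.
  - by rewrite dotC fa.
  - by rewrite dotC fc.
  - by rewrite dotC fd.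
  by case: c => c; [exists pa, q|exists pc, q]; split=> //; [left|right].
have [|||||||||q [q2 c]] :=
  crossing_side (pa := pa) (pb := pd) (pc := pc) (pd := pb) (x := x) (y := y)
    (f := - f) _ _ _ _ _ oxa oxc oyd oyb.
- by rewrite diag addrC.
- by case: ba => n [[? ? ? ?] ?]; exists n.
- by case: bc => n [[? ? ? ?] ?]; exists n.
- by case: bd => n [[? ? ? ?] ?]; exists n.
- by case: bb => n [[? ? ? ?] ?]; exists n.
- by rewrite dotNl dotC fa oppr0.
- by rewrite dotNl dotC fc oppr0.
- by rewrite dotNl fb opprK.
- by rewrite dotNl oppr_ge0 ltW.
by case: c => c; [exists pa, q|exists pc, q]; split; (by []) || tauto.
Qed.

End Crossing.

(** * Crossing of neighbouring cells *)

Section Signs.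
Variable R : realType.
Implicit Types s t r z : R.

(** In each equation the three coefficients cannot all have the same sign.  So
    two of the four are positive and two are negative. *)
Lemma four_signs s t r z (a1 a2 a3 b1 b2 b3 c1 c2 c3 d1 d2 d3 : R) :
  [/\ 0 < a1, 0 < a2 & 0 < a3] -> [/\ 0 < b1, 0 < b2 & 0 < b3] ->
  [/\ 0 < c1, 0 < c2 & 0 < c3] -> [/\ 0 < d1, 0 < d2 & 0 < d3] ->
  t * a1 + r * a2 + z * a3 = 0 -> s * b1 + r * b2 + z * b3 = 0 ->
  s * c1 + t * c2 + z * c3 = 0 -> s * d1 + t * d2 + r * d3 = 0 ->
  0 < s ->
  [\/ [/\ 0 < t, r < 0 & z < 0], [/\ t < 0, 0 < r & z < 0] |
      [/\ t < 0, r < 0 & 0 < z]].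
Proof.
move=> [a10 a20 a30] [b10 b20 b30] [c10 c20 c30] [d10 d20 d30] ea eb ec ed s0.
have pos u v : 0 < u -> 0 < v -> 0 < u * v :> R by exact: mulr_gt0.
have neg u v : u < 0 -> 0 < v -> u * v < 0 :> R by move=> *; rewrite pmulr_llt0.
have sb := pos _ _ s0 b10; have sc := pos _ _ s0 c10; have sd := pos _ _ s0 d10.
have [t0|t0|t0] := ltgtP t 0.
- have t1 := neg _ _ t0 a10; have t2 := neg _ _ t0 c20.
  have t3 := neg _ _ t0 d20.
  have [r0|r0|r0] := ltgtP r 0.
  + apply: Or33; split=> //; rewrite ltNge; apply/negP => z0.
    have r1 := neg _ _ r0 a20; have := mulr_le0_ge0 z0 (ltW a30); lra.
  + apply: Or32; split=> //; rewrite ltNge; apply/negP => z0.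
    have r2 := pos _ _ r0 b20; have := mulr_ge0 z0 (ltW b30); lra.
  + exfalso; move: ea eb; rewrite r0 !mul0r addr0 => ea eb.
    have [z0|z0] := leP z 0; first by have := mulr_le0_ge0 z0 (ltW a30); lra.
    have := pos _ _ z0 b30; lra.
- have t1 := pos _ _ t0 a10; have t2 := pos _ _ t0 c20.
  have t3 := pos _ _ t0 d20.
  apply: Or31; split=> //; rewrite ltNge; apply/negP => h.
    have := mulr_ge0 h (ltW d30); lra.
  have := mulr_ge0 h (ltW c30); lra.
- exfalso; move: ea ec ed; rewrite t0 !mul0r !addr0 add0r => ea ec ed.
  have [z0|z0] := leP 0 z; first by have := mulr_ge0 z0 (ltW c30); lra.
  have [r0|r0] := leP 0 r; first by have := mulr_ge0 r0 (ltW d30); lra.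
  have := neg _ _ z0 a30; have := neg _ _ r0 a20; lra.
Qed.

End Signs.

Section Around.
Variable R : realType.
Local Notation E := 'rV[R]_3.
Variable K : set (set E).
Hypothesis hK : tight_cells K.
Implicit Types (C D N : set E) (q r u w x y : E).

Definition across A x N := [/\ K N, N <> A & N x].

(** The rays of [a], [b], [c], [d] are the edges of a cone over a quadrilateral
    with diagonals [a b] and [c d]. *)
Definition paired (a b c d : E) := exists s t r z : R,
  [/\ 0 < s, 0 < t, 0 < r & 0 < z] /\ s *: a + t *: b = r *: c + z *: d.

Section SignPattern.
Variables (k : nat) (n p : 'I_k -> E).
Hypothesis on : forall i, dot (n i) (p i) = 0.
Hypothesis off : forall i j, i != j -> 0 < dot (n i) (p j).

(** Radon's theorem: four vectors are dependent, and convex position leaves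
    only relations with two coefficients of each sign. *)
Lemma sign_paired i j l m : uniq [:: i; j; l; m] ->
  [\/ paired (p i) (p j) (p l) (p m), paired (p i) (p l) (p j) (p m) |
      paired (p i) (p m) (p j) (p l)].
Proof.
rewrite /= !inE !negb_or andbT => /andP[/and3P[ij il im] /andP[/andP[jl jm] lm]].
have [s [t [r [z [nz e]]]]] := dep4 (p i) (p j) (p l) (p m).
have pos (a b c d : 'I_k) : a != b -> a != c -> a != d ->
    [/\ 0 < dot (n a) (p b), 0 < dot (n a) (p c) & 0 < dot (n a) (p d)].
  by move=> *; split; apply: off.
have ei := congr1 (dot (n i)) e; have ej := congr1 (dot (n j)) e.
have el := congr1 (dot (n l)) e; have em := congr1 (dot (n m)) e.
rewrite !dotE !on ?mulr0 ?addr0 ?add0r in ei ej el em.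
have hi := pos i j l m ij il im.
have hj : [/\ 0 < dot (n j) (p i), 0 < dot (n j) (p l) & 0 < dot (n j) (p m)].
  by apply: pos; rewrite // eq_sym.
have hl : [/\ 0 < dot (n l) (p i), 0 < dot (n l) (p j) & 0 < dot (n l) (p m)].
  by apply: pos; rewrite // eq_sym.
have hm : [/\ 0 < dot (n m) (p i), 0 < dot (n m) (p j) & 0 < dot (n m) (p l)].
  by apply: pos; rewrite // eq_sym.
have main (s' t' r' z' : R) : 0 < s' ->
    s' *: p i + t' *: p j + r' *: p l + z' *: p m = 0 ->
    [\/ [/\ 0 < t', r' < 0 & z' < 0], [/\ t' < 0, 0 < r' & z' < 0] |
      [/\ t' < 0, r' < 0 & 0 < z']] ->
    [\/ paired (p i) (p j) (p l) (p m), paired (p i) (p l) (p j) (p m) |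
      paired (p i) (p m) (p j) (p l)].
  move=> s0 e0 [[t0 r0 z0]|[t0 r0 z0]|[t0 r0 z0]].
  - apply: Or31; exists s', t', (- r'), (- z'); rewrite !oppr_gt0; split=> //.
    by apply/eqP; rewrite -subr_eq0 -[X in _ == X]e0; apply/eqP; vring.
  - apply: Or32; exists s', r', (- t'), (- z'); rewrite !oppr_gt0; split=> //.
    by apply/eqP; rewrite -subr_eq0 -[X in _ == X]e0; apply/eqP; vring.
  - apply: Or33; exists s', z', (- t'), (- r'); rewrite !oppr_gt0; split=> //.
    by apply/eqP; rewrite -subr_eq0 -[X in _ == X]e0; apply/eqP; vring.
have [s0|s0|s0] := ltgtP s 0.
- apply: (main (- s) (- t) (- r) (- z)).
  + by rewrite oppr_gt0.
  + by rewrite -[RHS]oppr0 -e; vring.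
  apply: (@four_signs _ (- s) (- t) (- r) (- z) _ _ _ _ _ _ _ _ _ _ _ _ hi hj hl hm).
  + by rewrite -[RHS]oppr0 -ei; ring.
  + by rewrite -[RHS]oppr0 -ej; ring.
  + by rewrite -[RHS]oppr0 -el; ring.
  + by rewrite -[RHS]oppr0 -em; ring.
  + by rewrite oppr_gt0.
- exact: (main s t r z s0 e (four_signs hi hj hl hm ei ej el em s0)).
exfalso; move: ei ej el em nz; rewrite s0 eqxx !mul0r !add0r /= => ei ej el em.
case: hi hj hl hm => [hij hil him] [hji hjl hjm] [hli hlj hlm] [hmi hmj hml].
have t0 : t = 0 := cyclic_signs hjl hjm hlj hlm hmj hml ej el em.
have r0 : r = 0.
  by move/eqP: em; rewrite t0 mul0r add0r mulf_eq0 (gt_eqF hml) orbF => /eqP.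
have z0 : z = 0.
  by move/eqP: ej; rewrite r0 mul0r add0r mulf_eq0 (gt_eqF hjm) orbF => /eqP.
by rewrite t0 r0 z0 eqxx.
Qed.

End SignPattern.

Section OneCell.
Variables (k : nat) (A : set E) (n p : 'I_k -> E).
Hypotheses (KA : K A) (fA : facets A n p).

Lemma facets_paired i j l m : uniq [:: i; j; l; m] ->
  [\/ paired (p i) (p j) (p l) (p m), paired (p i) (p l) (p j) (p m) |
      paired (p i) (p m) (p j) (p l)].
Proof. exact: (sign_paired (facet_on fA) (facet_off fA)). Qed.

Lemma normals_paired i j l m : uniq [:: i; j; l; m] ->
  [\/ paired (n i) (n j) (n l) (n m), paired (n i) (n l) (n j) (n m) |
      paired (n i) (n m) (n j) (n l)].
Proof.
apply: (sign_paired (n := p) (p := n)) => [a|a b ab]; rewrite dotC.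
  exact: (facet_on fA).
by apply: (facet_off fA); rewrite eq_sym.
Qed.

Section CrossingCells.
Variables (i l j m : 'I_k) (Ni Nl Nj Nm : set E).
Hypothesis dif : uniq [:: i; l; j; m].
Hypotheses (aNi : across A (p i) Ni) (aNl : across A (p l) Nl).
Hypotheses (aNj : across A (p j) Nj) (aNm : across A (p m) Nm).

Lemma across_not_opposite N x (c : R) i0 : across A (p i0) N -> N x -> x <> 0 ->
  0 <= c -> not_opposite x (c *: p i0).
Proof.
move=> [KN NA Np] Nx x0 c0 s s0 e; apply: x0; apply: (tc_pointed hK KN Nx).
by rewrite e opprK; do 2 apply: (cellZ hK) => //.
Qed.

(** If the diagonals [p i p l] and [p j p m] of [A] cross, then the paths
    [p i x p l] and [p j y p m] outside [A] cross as well, at a common point of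
    a cell across [i] or [l] and one across [j] or [m].  These cells meet in
    faces and do not contain each other's facet points, so that this point is a
    multiple of both [x] and [y]. *)
Lemma crossing_cells x y : paired (p i) (p l) (p j) (p m) ->
  Ni x -> Nl x -> x <> 0 -> Nj y -> Nm y -> y <> 0 ->
  exists2 c, 0 < c & y = c *: x.
Proof.
move: dif; rewrite /= !inE !negb_or andbT.
move=> /andP[/and3P[il ij im] /andP[/andP[lj lm] jm]].
move=> [a [b [c [d [[a0 b0 c0 d0] diag]]]]] Nix Nlx x0 Njy Nmy y0.
have side f i0 N z : across A (p i0) N -> N z -> f = n i0 -> dot f z <= 0.
  by move=> [KN NA Np] Nz ->; exact: (neighbour_side hK KA fA KN NA Np Nz).
have bey (i0 i1 i2 i3 : 'I_k) (e0 e1 e2 e3 : R) N z : across A (p i0) N -> N z ->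
    0 < e1 -> 0 < e2 -> 0 < e3 -> i0 != i1 -> i0 != i2 -> i0 != i3 ->
    beyond (e0 *: p i0) (e1 *: p i1) (e2 *: p i2) (e3 *: p i3) z.
  move=> aN Nz e1p e2p e3p h1 h2 h3; exists (n i0); split; last exact: side aN Nz _.
  by rewrite !dotZr (facet_on fA) mulr0; split=> //; apply: mulr_gt0 => //;
    apply: (facet_off fA).
have [P [Q [hP hQ [al [be [ga [de [[al0 be0 ga0 de0] [e nz]]]]]]]]] :
    exists P Q, [/\ P = a *: p i \/ P = b *: p l, Q = c *: p j \/ Q = d *: p m &
      cross P x Q y].
  apply: (crossing diag); (try by apply: bey; eassumption || rewrite eq_sym);
   by apply: across_not_opposite; eauto using ltW.
(* a weight on [p i0] would put this point of [A] in the cell across [i1] *)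
have step N N' i0 i1 z z' (u v s t e0 e1 : R) : across A (p i0) N ->
    across A (p i1) N' -> i0 != i1 -> N z -> N' z' -> 0 <= u -> 0 <= v ->
    0 <= s -> 0 <= t -> 0 < e0 -> 0 < e1 ->
    u *: (e0 *: p i0) + v *: z = s *: (e1 *: p i1) + t *: z' -> u = 0.
  move=> [KN NA Np] [KN' NA' Np'] i01 Nz Nz' u0 v0 s0 t0 e00 e10 e'.
  apply/eqP; rewrite eq_le u0 andbT leNgt; apply/negP => up.
  have Nu' : N' (p i0).
    apply: (cell_face hK KN KN' Np Nz (mulr_gt0 up e00) v0).
    rewrite -scalerA e'; apply: (cellD hK) => //; last exact: (cellZ hK).
    by do 2 apply: (cellZ hK) => //; exact: ltW.
  have := neighbour_meet hK KA fA KN' NA' Np' (facet_pt_in fA i0) Nu'.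
  by move=> h; rewrite eq_sym in i01; have := facet_off fA i01; rewrite h ltxx.
have [al00 ga00] : al = 0 /\ ga = 0.
  have both N N' i0 i1 (e0 e1 : R) : across A (p i0) N -> across A (p i1) N' ->
      i0 != i1 -> N x -> N' y -> 0 < e0 -> 0 < e1 ->
      al *: (e0 *: p i0) + be *: x = ga *: (e1 *: p i1) + de *: y ->
      al = 0 /\ ga = 0.
    move=> aN aN' i01 Nx Ny e00 e10 e'; split.
      exact: (step _ _ _ _ _ _ _ _ _ _ _ _ aN aN' i01 Nx Ny al0 be0 ga0 de0 e00 e10 e').
    rewrite eq_sym in i01.
    exact: (step _ _ _ _ _ _ _ _ _ _ _ _ aN' aN i01 Ny Nx ga0 de0 al0 be0 e10 e00 (esym e')).
  case: hP e {nz} => -> ; case: hQ => -> e.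
  - exact: both aNi aNj ij Nix Njy a0 c0 e.
  - exact: both aNi aNm im Nix Nmy a0 d0 e.
  - exact: both aNl aNj lj Nlx Njy b0 c0 e.
  - exact: both aNl aNm lm Nlx Nmy b0 d0 e.
move: e nz; rewrite al00 ga00 !scale0r !add0r => e nz.
have bep : 0 < be.
  by rewrite lt0r be0 andbT; apply/eqP => z; apply: nz; rewrite z scale0r.
have dep : 0 < de.
  by rewrite lt0r de0 andbT; apply/eqP => z; apply: nz; rewrite e z scale0r.
exists (de^-1 * be); first by rewrite mulr_gt0 ?invr_gt0.
by rewrite -scalerA e scalerK // gt_eqF.
Qed.
End CrossingCells.

End OneCell.
End Around.

(** * Four-valent rays *)

Section FourValent.
Variable R : realType.
Local Notation E := 'rV[R]_3.
Variable K : set (set E).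
Hypothesis hK : tight_cells K.
Implicit Types (C D N : set E) (q r u w x y : E).

Lemma cell_facets C : K C -> exists k (n p : 'I_k -> E), facets C n p.
Proof.
move=> KC; have [q cq] := tc_core hK KC; have [s e] := tc_poly hK KC.
by rewrite e in cq *; exact: hcone_facets cq.
Qed.

Section OneCell.
Variables (k : nat) (A : set E) (n p : 'I_k -> E).
Hypotheses (KA : K A) (fA : facets A n p).

Lemma across_ex i : exists N, across K A (p i) N.
Proof. by have [N [KN NA Np]] := neighbour_ex hK KA fA i; exists N. Qed.

Lemma across_neq i j N N' : i != j -> across K A (p i) N -> across K A (p j) N' ->
  N <> N'.
Proof.
move=> ij [KN NA Np] [_ _ Np'] e; rewrite -e in Np'.
have := neighbour_meet hK KA fA KN NA Np (facet_pt_in fA j) Np'.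
by have := facet_off fA ij => /[swap] ->; rewrite ltxx.
Qed.

Section Ray.
Variables (C : set E) (i j : 'I_k) (r : E).
Hypotheses (KC : K C) (CA : C <> A) (rm : ray_meet A n C i j r).

Lemma ray_meet_sym : ray_meet A n C j i r.
Proof.
case: rm => ij Ar Cr ni nj pos line; split=> //; first by rewrite eq_sym.
by move=> l jl il; apply: pos.
Qed.

Lemma ray_neq0 : r <> 0.
Proof.
have [l [il jl]] := facet_other hK KA fA i j => e.
by have := rm_pos rm il jl; rewrite e dot0r ltxx.
Qed.

Lemma on_ray x : dot (n i) x = 0 -> dot (n j) x = 0 -> exists t, x = t *: r.
Proof.
move=> nix njx; have [l [il jl]] := facet_other hK KA fA i j.
exists (dot (n l) x / dot (n l) r).
apply/eqP; rewrite -subr_eq0; apply/eqP.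
apply: (facet_eq0 fA (rm_neq rm) il jl); rewrite dotBr dotZr.
- by rewrite nix (rm_ni rm) mulr0 subrr.
- by rewrite njx (rm_nj rm) mulr0 subrr.
- by rewrite divfK ?subrr // gt_eqF // (rm_pos rm).
Qed.

Lemma ray_local x : small (fun e => A (r + e *: x) <-> C (r - e *: x)).
Proof.
apply: (tc_ray hK KA KC) => [e||||]; first by apply: CA.
- exact: ray_neq0.
- exact: rm_l rm.
- exact: rm_r rm.
- exact: rm_line rm.
Qed.

(** Near [r], the cell [C] is the reflection of the wedge of [A]. *)
Lemma ray_side x : C x -> dot (n i) x <= 0 /\ dot (n j) x <= 0.
Proof.
move=> Cx; have [e e0] := small_ex (ray_local (- x)).
have : C (r - e *: - x).
  rewrite scalerN opprK; apply: (cellD hK) => //; first exact: rm_r rm.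
  by apply: (cellZ hK) => //; apply: ltW.
move=> /[swap] -[_ h] /h /(facet_in fA) Ae.
have := Ae i; have := Ae j; rewrite !dotE (rm_ni rm) (rm_nj rm); nra.
Qed.

Lemma ray_wedge x : dot (n i) x <= 0 -> dot (n j) x <= 0 ->
  small (fun e => C (r + e *: x)).
Proof.
move=> nix njx.
have : small (fun e => A (r + e *: - x)).
  apply: (facet_local fA) => [|l nl]; first exact: rm_l rm.
  have [->|il] := eqVneq l i; first by rewrite dotNr oppr_ge0.
  have [->|jl] := eqVneq l j; first by rewrite dotNr oppr_ge0.
  by rewrite eq_sym in il; rewrite eq_sym in jl; have := rm_pos rm il jl; rewrite nl ltxx.
move=> sA; apply: small_imp (small_and sA (ray_local (- x))) => e _ [Ae [h _]].
by have := h Ae; rewrite scalerN opprK.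
Qed.

Lemma ray_neighbour N : across K A (p i) N -> N r.
Proof.
move=> [KN NA Np].
exact: (facet_sub_neighbour hK KA fA KN Np (rm_l rm) (rm_ni rm)).
Qed.

(** Otherwise the interior of [N] would reach into the wedge of [C] at [r]. *)
Lemma ray_neighbour_side N x : across K A (p i) N -> N x -> 0 <= dot (n j) x.
Proof.
move=> aN Nx; have [KN NA Np] := aN; rewrite leNgt; apply/negP => njx.
have nix := neighbour_side hK KA fA KN NA Np Nx.
have [q cq] := tc_core hK KN.
have niq := neighbour_core hK KA fA KN NA Np cq.
have : 0 < - dot (n j) x by rewrite oppr_gt0.
move=> /(small_affine_gt (- dot (n j) q)) /small_ex [e e0 he].
have cc := core_add hK KN Nx cq e0.
have : small (fun t => C (r + t *: (x + e *: q))).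
  by apply: ray_wedge; rewrite dotDr dotZr; nra.
move=> /small_ex [t t0 Ct].
have NC := core_inj hK KN KC (core_add hK KN (ray_neighbour aN) cc t0) Ct.
rewrite NC in Np; have [s ps] := rm_line rm (facet_pt_in fA i) Np.
have ji : j != i by rewrite eq_sym (rm_neq rm).
by have := facet_off fA ji; rewrite ps dotZr (rm_nj rm) mulr0 ltxx.
Qed.

End Ray.

Lemma ray_neighbours_meet C i j r N N' x : K C -> C <> A -> ray_meet A n C i j r ->
  across K A (p i) N -> across K A (p j) N' -> N x -> N' x -> exists t, x = t *: r.
Proof.
move=> KC CA rm aN aN' Nx Nx'.
have s1 := ray_neighbour_side KC CA rm aN Nx.
have s2 := ray_neighbour_side KC CA (ray_meet_sym rm) aN' Nx'.
case: aN aN' => KN NA Np [KN' NA' Np'].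
have s3 := neighbour_side hK KA fA KN NA Np Nx.
have s4 := neighbour_side hK KA fA KN' NA' Np' Nx'.
by apply: (on_ray rm); lra.
Qed.

(** Among the cells, only the one across the facet [i] can reach into the wedge
    beyond that facet at [r]. *)
Lemma ray_neighbour_wedge C i j r N x : K C -> C <> A -> ray_meet A n C i j r ->
  across K A (p i) N -> dot (n i) x <= 0 -> 0 <= dot (n j) x ->
  small (fun e => N (r + e *: x)).
Proof.
move=> KC CA rm aN nix njx; have [KN NA Np] := aN.
have r0 := ray_neq0 rm.
have strict y : dot (n i) y < 0 -> 0 < dot (n j) y ->
    often (fun e => N (r + e *: y)).
  move=> niy njy; have [D KD oD] := often_cell hK r y.
  have Dr := cell_closed hK KD oD; have [e e0 De] := often_ex oD.
  have nie : dot (n i) (r + e *: y) < 0.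
    by rewrite dotDr dotZr (rm_ni rm) add0r; nra.
  have nje : 0 < dot (n j) (r + e *: y).
    by rewrite dotDr dotZr (rm_nj rm) add0r; nra.
  (* [A] and the opposite cells are out of the open wedge, and so is the cell
     across any facet but [i] *)
  have [DA|DA] := pselect (D = A).
    by move: nie; rewrite ltNge; move: De; rewrite DA => /(facet_in fA) ->.
  have [[l Dl]|[i' [j' [r' rm']]]|D0] := meet_cases hK KA fA KD DA; last first.
  - by case: r0; apply: D0 Dr; exact: rm_l rm.
  - exfalso.
    have [t rt] := rm_line rm' (rm_l rm) Dr.
    have z i0 : dot (n i0) r = 0 -> i0 = i \/ i0 = j.
      have [->|il] := eqVneq i0 i; first by left.
      have [->|jl] := eqVneq i0 j; first by right.
      rewrite eq_sym in il; rewrite eq_sym in jl => n0.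
      by have := rm_pos rm il jl; rewrite n0 ltxx.
    have ij' := rm_neq rm'.
    have : i' = j \/ j' = j.
      have [|ii|->] := z i'; [|move: ij'|by left].
        by rewrite rt dotZr (rm_ni rm') mulr0.
      have [|->|->] := z j'; [|by rewrite ii eqxx|by right].
      by rewrite rt dotZr (rm_nj rm') mulr0.
    have [h1 h2] := ray_side KD DA rm' De.
    by case=> ejj; move: nje; rewrite -ejj; lra.
  - have nl := neighbour_meet hK KA fA KD DA Dl (rm_l rm) Dr.
    have li : l = i.
      apply/eqP/negPn/negP => li; rewrite eq_sym in li.
      have [lj|lj] := eqVneq j l.
        have := neighbour_side hK KA fA KD DA Dl De; rewrite -lj; lra.
      by have := rm_pos rm li lj; rewrite nl ltxx.
    rewrite li in Dl.
    by rewrite (neighbour_uniq hK KA fA KN NA Np KD DA Dl).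
have [q cq] := tc_core hK KA.
have qi := core_gt0 hK KA fA i cq; have qj := core_gt0 hK KA fA j cq.
have ji : j != i by rewrite eq_sym (rm_neq rm).
have pj := facet_off fA ji.
have [y [niy njy]] : exists y, dot (n i) y < 0 /\ 0 < dot (n j) y.
  exists (((dot (n j) q + 1) / dot (n j) (p i)) *: p i - q).
  rewrite !dotBr !dotZr (facet_on fA) mulr0 add0r oppr_lt0 divfK ?gt_eqF //.
  by split=> //; lra.
have [k' [m [p' fN]]] := cell_facets KN.
apply: (facet_local fN) => [|a ma]; first exact: (ray_neighbour rm aN).
apply: (@often_affine _ _ (dot (m a) y)); apply: small_often; apply: small_always.
move=> e e0.
have [||d d0] := often_ex (strict (x + e *: y) _ _).
- by rewrite dotDr dotZr; nra.
- by rewrite dotDr dotZr; nra.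
move=> /(facet_in fN) /(_ a).
by rewrite dotDr ma add0r dotZr dotDr dotZr pmulr_rge0.
Qed.

(** A ray where two cells meet in no more than the ray is surrounded by four
    cells, and each of them has three facets.  If [A] had two facets [l] and [m]
    off the ray, then [p i] and [p j] would not be paired, because [p l] and
    [p m] are on the same side of their plane.  For the other pairings
    [crossing_cells] applies and puts the ray on the facet [l] or [m]. *)
Lemma ray_three_facets C i j r l m : K C -> C <> A -> ray_meet A n C i j r ->
  i != l -> j != l -> i != m -> j != m -> l = m.
Proof.
move=> KC CA rm il jl im jm; apply/eqP/negPn/negP => lm.
have ij := rm_neq rm.
have [Ni aNi] := across_ex i; have [Nj aNj] := across_ex j.
have [Nl aNl] := across_ex l; have [Nm aNm] := across_ex m.
(* otherwise the two cells are antipodal, and the first one contains [- p l0] *)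
have share i0 j0 l0 N N' : ray_meet A n C i0 j0 r -> across K A (p i0) N ->
    i0 != l0 -> j0 != l0 -> across K A (p l0) N' ->
    exists x, [/\ N x, N' x & x <> 0].
  move=> rm0 aN il0 jl0 aN'; apply: contrapT => no.
  have [KN NA Np] := aN; have [KN' NA' Np'] := aN'.
  have [|opp _] := tc_anti hK KN KN' (across_neq il0 aN aN').
    by move=> x Nx N'x; apply: contrapT => x0; apply: no; exists x.
  have : N (- p l0) by apply/opp; rewrite opprK.
  move=> /(ray_neighbour_side KC CA rm0 aN); rewrite dotNr oppr_ge0 leNgt.
  by rewrite (facet_off fA jl0).
have final i0 j0 l0 m0 N N' M M' : ray_meet A n C i0 j0 r ->
    across K A (p i0) N -> across K A (p j0) N' -> across K A (p l0) M ->
    across K A (p m0) M' -> i0 != l0 -> j0 != l0 -> i0 != m0 -> j0 != m0 ->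
    l0 != m0 -> ~ paired (p i0) (p l0) (p j0) (p m0).
  move=> rm0 aN aN' aM aM' il0 jl0 im0 jm0 lm0 pr.
  have [x [Nx Mx x0]] := share _ _ _ _ _ rm0 aN il0 jl0 aM.
  have [y [Ny My y0]] := share _ _ _ _ _ (ray_meet_sym rm0) aN' jm0 im0 aM'.
  have dif : uniq [:: i0; l0; j0; m0].
    by rewrite /= !inE !negb_or il0 (rm_neq rm0) im0 lm0 jm0 eq_sym jl0.
  have [c c0 e] := crossing_cells hK KA fA dif aN aM aN' aM' pr Nx Mx x0 Ny My y0.
  have [KN' NA' Np'] := aN'; have [KN NA Np] := aN; have [KM MA Mp] := aM.
  have Nx' : N' x by apply: (cellZK hK KN' c0); rewrite -e.
  have [t xt] := ray_neighbours_meet KC CA rm0 aN aN' Nx Nx'.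
  have t0 : 0 < t.
    rewrite ltNge; apply/negP => t0; apply: x0; apply: (tc_pointed hK KN Nx).
    rewrite xt -scaleNr; apply: (cellZ hK) => //; first by rewrite oppr_ge0.
    exact: (ray_neighbour rm0 aN).
  have Nr : M r by apply: (cellZK hK KM t0); rewrite -xt.
  have := neighbour_meet hK KA fA KM MA Mp (rm_l rm0) Nr.
  by have := rm_pos rm0 il0 jl0 => /[swap] ->; rewrite ltxx.
have [|pr|pr|pr] := @facets_paired _ _ _ _ _ fA i j l m.
- by rewrite /= !inE !negb_or ij il im jl jm lm.
- move: pr => [a [b [c [d [[a0 b0 c0 d0] e]]]]].
  have r0 := ray_neq0 rm.
  have ji : j != i by rewrite eq_sym.
  have pij := facet_off fA ij; have pji := facet_off fA ji.
  have ind : indep3 (p i) (p j) r.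
    move=> s t z es; have ei := congr1 (dot (n i)) es.
    have ej := congr1 (dot (n j)) es.
    rewrite !dotE (facet_on fA) (rm_ni rm) !mulr0 add0r addr0 in ei.
    rewrite !dotE (facet_on fA) (rm_nj rm) !mulr0 !addr0 in ej.
    have t0 : t = 0.
      by move/eqP: ei; rewrite mulf_eq0 (gt_eqF pij) orbF => /eqP.
    have s0 : s = 0.
      by move/eqP: ej; rewrite mulf_eq0 (gt_eqF pji) orbF => /eqP.
    split=> //; move/eqP: es; rewrite s0 t0 !scale0r !add0r scaler_eq0.
    by move=> /orP[/eqP//|/eqP/r0].
  have [f [g [h D]]] := indep3_dual ind.
  have [dec _] := dual_bases_sym D; have [_ ev] := D.
  have [/= hi hj _] := ev 0 0 1; rewrite !scale0r !add0r scale1r in hi hj.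
  have neg l0 : i != l0 -> j != l0 -> dot h (p l0) < 0.
    move=> il0 jl0.
    have ei := congr1 (dot (n i)) (dec (p l0)).
    have ej := congr1 (dot (n j)) (dec (p l0)).
    have el := congr1 (dot (n l0)) (dec (p l0)).
    rewrite !dotE !(facet_on fA) (rm_ni rm) !mulr0 add0r addr0 in ei.
    rewrite !dotE !(facet_on fA) (rm_nj rm) !mulr0 !addr0 in ej.
    rewrite !dotE !(facet_on fA) in el.
    have h1 := facet_off fA il0; have h2 := facet_off fA jl0.
    have h3 := rm_pos rm il0 jl0.
    rewrite eq_sym in il0; rewrite eq_sym in jl0.
    have h4 := facet_off fA il0; have h5 := facet_off fA jl0.
    rewrite ei pmulr_lgt0 // in h1; rewrite ej pmulr_lgt0 // in h2.
    by have := mulr_gt0 h1 h5; have := mulr_gt0 h2 h4; nra.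
  have := congr1 (dot h) e.
  rewrite !dotDr !dotZr (dotC h (p i)) (dotC h (p j)) hi hj !mulr0 addr0.
  by have := neg l il jl; have := neg m im jm; nra.
- exact: final rm aNi aNj aNl aNm il jl im jm lm pr.
- by apply: (final _ _ _ _ _ _ _ _ rm aNi aNj aNm aNl _ _ _ _ _ pr) => //; rewrite eq_sym.
Qed.

End OneCell.
End FourValent.

(** * Simplicial cells and stars *)

Section Simplicial.
Variable R : realType.
Local Notation E := 'rV[R]_3.
Implicit Types (C : set E) (a b c u w x y : E).

Definition simplicial C a b c := indep3 a b c /\
  forall s t r : R, C (s *: a + t *: b + r *: c) <-> [/\ 0 <= s, 0 <= t & 0 <= r].

Lemma indep3_coord a b c x : indep3 a b c ->
  exists s t r : R, x = s *: a + t *: b + r *: c.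
Proof.
move=> /indep3_dual [f [g [h D]]]; have [dec _] := dual_bases_sym D.
by exists (dot f x), (dot g x), (dot h x).
Qed.

Lemma indep3_inj a b c (s t r s' t' r' : R) : indep3 a b c ->
  s *: a + t *: b + r *: c = s' *: a + t' *: b + r' *: c ->
  [/\ s = s', t = t' & r = r'].
Proof.
move=> ind e; have [|e1 e2 e3] := ind (s - s') (t - t') (r - r').
  apply/eqP; rewrite -(inj_eq (addIr (s' *: a + t' *: b + r' *: c))) add0r.
  by rewrite -[X in _ == X]e; apply/eqP; vring.
by split; lra.
Qed.

Lemma indep3_functional a b c (s t r : R) : indep3 a b c ->
  exists l, [/\ dot l a = s, dot l b = t & dot l c = r].
Proof.
move=> /indep3_dual [f [g [h [_ ev]]]]; exists (s *: f + t *: g + r *: h).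
by rewrite dotC (dotC _ b) (dotC _ c); exact: ev.
Qed.

Lemma indep3_swap a b c : indep3 a b c -> indep3 b a c.
Proof.
by move=> ind s t r e; have [|-> -> ->] := ind t s r; rewrite // (addrC (t *: a)).
Qed.

Lemma indep3_rot a b c : indep3 a b c -> indep3 b c a.
Proof.
move=> ind s t r e; have [|-> -> ->] := ind r s t; last by [].
by rewrite -[RHS]e; vring.
Qed.

Lemma simplicial_swap C a b c : simplicial C a b c -> simplicial C b a c.
Proof.
move=> [ind cC]; split; first exact: indep3_swap.
move=> s t r; rewrite (addrC (s *: b)).
by split=> [/cC []|[*]]; [|apply/cC].
Qed.

Lemma simplicial_flip C a b c : simplicial C a b c -> simplicial C a c b.
Proof.
move=> [ind cC]; split.
  exact: indep3_swap (indep3_rot (indep3_rot ind)).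
move=> s t r; rewrite -addrA (addrC (t *: c)) addrA.
by split=> [/cC []|[*]]; [|apply/cC].
Qed.
Lemma simplicial_rot C a b c : simplicial C a b c -> simplicial C b c a.
Proof.
move=> [ind cC]; split; first exact: indep3_rot.
move=> s t r; rewrite (_ : _ + _ = r *: a + s *: b + t *: c); last by vring.
by split=> [/cC []|[*]]; [|apply/cC].
Qed.

Lemma simplicial_coord C a b c x : simplicial C a b c -> C x ->
  exists s t r : R, [/\ 0 <= s, 0 <= t, 0 <= r & x = s *: a + t *: b + r *: c].
Proof.
move=> [ind cC] Cx; have [s [t [r e]]] := indep3_coord x ind.
by exists s, t, r; move: Cx; rewrite e => /cC [].
Qed.

Lemma simplicial_gens C a b c : simplicial C a b c -> [/\ C a, C b & C c].
Proof.
move=> [_ cC]; split.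
- by rewrite (_ : a = 1 *: a + 0 *: b + 0 *: c); [apply/cC; rewrite ler01 lexx|vring].
- by rewrite (_ : b = 0 *: a + 1 *: b + 0 *: c); [apply/cC; rewrite ler01 lexx|vring].
- by rewrite (_ : c = 0 *: a + 0 *: b + 1 *: c); [apply/cC; rewrite ler01 lexx|vring].
Qed.

Lemma indep3_neq0 a b c : indep3 a b c -> a <> 0.
Proof.
move=> ind e; have [|/eqP] := ind 1 0 0; last by rewrite oner_eq0.
by rewrite e; vring.
Qed.

Lemma indep3_2 a b c : indep3 a b c -> indep2 a b.
Proof. by move=> ind s t e; have [] := ind s t 0; rewrite // e scale0r addr0. Qed.

Lemma simplicial_facets C a b c : simplicial C a b c ->
  exists n : 'I_3 -> E,
    [/\ facets C n (fun i => [:: b + c; a + c; a + b]`_i),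
        [/\ dot (n 0) a = 1, dot (n 0) b = 0 & dot (n 0) c = 0],
        [/\ dot (n 1) a = 0, dot (n 1) b = 1 & dot (n 1) c = 0] &
        [/\ dot (n 2) a = 0, dot (n 2) b = 0 & dot (n 2) c = 1]].
Proof.
move=> sC; have [ind cC] := sC.
have [f [fa fb fc]] := indep3_functional 1 0 0 ind.
have [g [ga gb gc]] := indep3_functional 0 1 0 ind.
have [h [ha hb hc]] := indep3_functional 0 0 1 ind.
exists (fun i : 'I_3 => [:: f; g; h]`_i); split=> //; split.
- move=> x; have [s [t [r ->]]] := indep3_coord x ind; rewrite cC.
  have ef : dot f (s *: a + t *: b + r *: c) = s by rewrite !dotE fa fb fc; ring.
  have eg : dot g (s *: a + t *: b + r *: c) = t by rewrite !dotE ga gb gc; ring.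
  have eh : dot h (s *: a + t *: b + r *: c) = r by rewrite !dotE ha hb hc; ring.
  split=> [[s0 t0 r0]|all].
    by case=> -[|[|[|//]]] ? /=; rewrite ?ef ?eg ?eh.
  by split; [rewrite -ef; exact: (all 0)|rewrite -eg; exact: (all 1)|
    rewrite -eh; exact: (all 2)].
- by case=> -[|[|[|//]]] ? /=; rewrite !dotE ?fb ?fc ?ga ?gc ?ha ?hb addr0.
- case=> -[|[|[|//]]] ? [] [|[|[|//]]] ? //= _; rewrite !dotE ?fa ?fb ?fc ?ga ?gb ?gc ?ha ?hb ?hc; lra.
Qed.

End Simplicial.

Section Star.
Variable R : realType.
Local Notation E := 'rV[R]_3.
Variable K : set (set E).
Hypothesis hK : tight_cells K.
Implicit Types (A B C D N X Y Z : set E) (q r u w x y : E).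

Definition line_meet X Y r := forall x, X x -> Y x -> exists t, x = t *: r.

Lemma line_meet_sym X Y r : line_meet X Y r -> line_meet Y X r.
Proof. by move=> l x Yx Xx; exact: l. Qed.

Lemma indep2_not_line u w r : indep2 u w -> (exists t, u = t *: r) ->
  (exists t, w = t *: r) -> False.
Proof.
move=> ind [s us] [t wt].
have [|t0 s0] := ind t (- s); first by rewrite us wt; vring.
have s00 : s = 0 by rewrite -[s]opprK s0 oppr0.
have [|/eqP] := ind 1 0; last by rewrite oner_eq0.
by rewrite us s00 !scale0r scaler0 addr0.
Qed.

Lemma line_or_indep X Y r : r <> 0 ->
  line_meet X Y r \/ exists x, [/\ X x, Y x & indep2 r x].
Proof.
move=> r0; have [l|nl] := pselect (line_meet X Y r); [by left|right].
apply: contrapT => no; apply: nl => x Xx Yx; apply: contrapT => nx; apply: no.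
exists x; split=> // s t e.
have [t0|t0] := eqVneq t 0.
  move/eqP: e; rewrite t0 scale0r addr0 scaler_eq0 => /orP[/eqP -> //|/eqP].
  by move/r0.
exfalso; apply: nx; exists (- (s / t)).
apply: (scalerI t0); rewrite scalerA mulrN mulrC divfK // scaleNr.
by apply/eqP; rewrite -addr_eq0 addrC e.
Qed.

Section Rep.
Variables (k : nat) (X : set E) (m p : 'I_k -> E).
Hypotheses (KX : K X) (fX : facets X m p).

Lemma shared_across Y u w : K Y -> Y <> X -> X u -> Y u -> X w -> Y w ->
  indep2 u w -> exists a, [/\ across K X (p a) Y, dot (m a) u = 0 & dot (m a) w = 0].
Proof.
move=> KY YX Xu Yu Xw Yw ind.
have [[a Ya]|[i [j [r rm]]]|z] := meet_cases hK KX fX KY YX.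
- by exists a; split=> //; apply: (neighbour_meet hK KX fX KY YX Ya).
- by case: (indep2_not_line ind (rm_line rm Xu Yu) (rm_line rm Xw Yw)).
- by case: (indep2_not_line (r := 0) ind); exists 0; rewrite scale0r; apply: z.
Qed.

(** Both [g] and a facet normal vanish on [u] and [w] and are positive at an
    interior point of [X]. *)
Lemma shared_normal Y u w g : K Y -> Y <> X -> X u -> Y u -> X w -> Y w ->
  indep2 u w -> g <> 0 -> dot g u = 0 -> dot g w = 0 ->
  (forall x, X x -> 0 <= dot g x) ->
  exists a, (exists2 c, 0 < c & m a = c *: g) /\
    (forall x, X x -> dot g x = 0 -> Y x).
Proof.
move=> KY YX Xu Yu Xw Yw ind g0 gu gw gX.
have [a [[_ _ Ya] au aw]] := shared_across KY YX Xu Yu Xw Yw ind.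
have [q cq] := tc_core hK KX; have mq := core_gt0 hK KX fX a cq.
have gq : 0 < dot g q.
  have := @side_core _ (- g) X q _ _ cq; rewrite dotNl oppr_lt0; apply.
    by move/eqP; rewrite oppr_eq0 => /eqP.
  by move=> x /gX; rewrite dotNl oppr_le0.
pose c := dot (m a) q / dot g q.
have mc : m a = c *: g.
  apply: (functional_ext (indep2_extend ind gu gw (lt0r_neq0 gq))).
  - by rewrite dotZl gu mulr0.
  - by rewrite dotZl gw mulr0.
  - by rewrite dotZl /c divfK // gt_eqF.
exists a; split; first by exists c => //; rewrite /c divr_gt0.
move=> x Xx gx; apply: (facet_sub_neighbour hK KX fX KY Ya Xx).
by rewrite mc dotZl gx mulr0.
Qed.

(** A common facet would contain two independent vectors. *)
Lemma ray_meet_of Y r : K Y -> Y <> X -> X r -> Y r -> r <> 0 -> line_meet X Y r ->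
  exists a b, ray_meet X m Y a b r.
Proof.
move=> KY YX Xr Yr r0 line.
have [[a Ya]|[i [j [r' rm]]]|z] := meet_cases hK KX fX KY YX; last first.
- by case: r0; apply: z.
- have [t rt] := rm_line rm Xr Yr.
  have [s rs] := line _ (rm_l rm) (rm_r rm).
  have s0 : 0 < s.
    rewrite ltNge; apply/negP => s0; apply: (ray_neq0 hK KX fX rm).
    apply: (tc_pointed hK KX (rm_l rm)); rewrite rs -scaleNr.
    by apply: (cellZ hK) => //; rewrite oppr_ge0.
  have ext l : dot (m l) r' = s * dot (m l) r by rewrite rs dotZr.
  exists i, j; split=> //; first exact: rm_neq rm.
  + by have := ext i; rewrite (rm_ni rm) => /esym/eqP; rewrite mulf_eq0 gt_eqF //= => /eqP.
  + by have := ext j; rewrite (rm_nj rm) => /esym/eqP; rewrite mulf_eq0 gt_eqF //= => /eqP.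
  + by move=> l il jl; have := rm_pos rm il jl; rewrite ext pmulr_rgt0.
exfalso.
have [y y0 ny] := @low_kernel R 2 (fun i => [:: m a; p a]`_i) isT.
have may : dot (m a) y = 0 by exact: (ny 0).
have pay : dot (p a) y = 0 by exact: (ny 1).
have : small (fun e => X (p a + e *: y)).
  apply: (facet_local fX) => [|l]; first exact: facet_pt_in fX a.
  have [->|la] := eqVneq l a; first by rewrite may.
  by move=> e; have := facet_off fX la; rewrite e ltxx.
move=> /small_ex [e e0 Xe].
have Ye : Y (p a + e *: y).
  apply: (facet_sub_neighbour hK KX fX KY Ya Xe).
  by rewrite dotDr dotZr may (facet_on fX) mulr0 addr0.
apply: (@indep2_not_line (p a) (p a + e *: y) r); last 2 first.
- exact: line (facet_pt_in fX a) Ya.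
- exact: line Xe Ye.
move=> s t st.
have := congr1 (dot y) st; rewrite !dotE (dotC y (p a)) pay mulr0 !add0r => /eqP.
rewrite !mulf_eq0 (gt_eqF e0) (gt_eqF (dot_gt0 (elimN eqP y0))) /= !orbF => /eqP t0.
move/eqP: st; rewrite t0 scale0r addr0 scaler_eq0 => /orP[/eqP-> //|/eqP].
by move/(facet_pt_neq0 hK KX fX).
Qed.

End Rep.

(** The plane of [u] and [w] determines the facet of [X], and the facet
    determines the cell across it. *)
Lemma three_share X Y Z u w : K X -> K Y -> K Z -> indep2 u w ->
  X u -> X w -> Y u -> Y w -> Z u -> Z w -> Y <> X -> Z <> X -> Y = Z.
Proof.
move=> KX KY KZ ind Xu Xw Yu Yw Zu Zw YX ZX.
have [k [m [p fX]]] := cell_facets hK KX.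
have [a [[_ _ Ya] au aw]] := shared_across KX fX KY YX Xu Yu Xw Yw ind.
have [b [[_ _ Zb] bu bw]] := shared_across KX fX KZ ZX Xu Zu Xw Zw ind.
have ab : a = b.
  apply/eqP/negPn/negP => ab; have [l [al bl]] := facet_other hK KX fX a b.
  have [q cq] := tc_core hK KX; have aq := core_gt0 hK KX fX a cq.
  have ind3 := indep2_extend ind au aw (lt0r_neq0 aq).
  pose c := dot (m b) q / dot (m a) q.
  have e : m b = c *: m a.
    apply: (functional_ext ind3); rewrite dotZl ?au ?aw ?bu ?bw ?mulr0 //.
    by rewrite /c divfK // gt_eqF.
  have [|_ /eqP] := facet_indep3 fX ab al bl (s := c) (t := -1) (r := 0) _.
    by rewrite e; vring.
  by rewrite oppr_eq0 oner_eq0.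
by rewrite -ab in Zb; exact: (neighbour_uniq hK KX fX KY YX Ya KZ ZX Zb).
Qed.

Lemma four_indices k (a b c d : 'I_k) : (k <= 3)%N -> uniq [:: a; b; c] ->
  [\/ d = a, d = b | d = c].
Proof.
move=> k3 abc.
have [d3|nd] := boolP (d \in [:: a; b; c]).
  move: d3; rewrite !inE => /or3P[] /eqP->; [exact: Or31|exact: Or32|exact: Or33].
have u : uniq (d :: [:: a; b; c]) by rewrite cons_uniq nd.
have := max_card (mem (d :: [:: a; b; c])); rewrite (card_uniqP u) card_ord /=.
by move=> /leq_trans/(_ k3).
Qed.

(** By [ray_three_facets], a cell with a four-valent ray [r] is determined by
    its two facets at [r], up to shears along [r] that place the third facet. *)
Lemma wedge_cell X Y Z1 Z2 r f g u1 u2 u w : K X -> K Y -> Y <> X -> X r -> Y r ->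
  r <> 0 -> line_meet X Y r ->
  K Z1 -> Z1 <> X -> Z1 r -> X u1 -> Z1 u1 -> indep2 r u1 -> dot f u1 = 0 ->
  K Z2 -> Z2 <> X -> Z2 r -> X u2 -> Z2 u2 -> indep2 r u2 -> dot g u2 = 0 ->
  dot f r = 0 -> dot g r = 0 ->
  (forall x, X x -> 0 <= dot f x) -> (forall x, X x -> 0 <= dot g x) ->
  dot f u = 1 -> dot g u = 0 -> dot f w = 0 -> dot g w = 1 ->
  [/\ exists s t, simplicial X r (u + s *: r) (w + t *: r),
      forall x, X x -> dot f x = 0 -> Z1 x & forall x, X x -> dot g x = 0 -> Z2 x].
Proof.
move=> KX KY YX Xr Yr r0 line KZ1 Z1X Z1r Xu1 Z1u1 ind1 fu1.
move=> KZ2 Z2X Z2r Xu2 Z2u2 ind2 gu2 fr gr fX gX fu gu fw gw.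
have [k [m [p fcX]]] := cell_facets hK KX.
have [i0 [j0 rm]] := ray_meet_of KX fcX KY YX Xr Yr r0 line.
have f0 : f <> 0 by move=> e; move/eqP: fu; rewrite e dot0l eq_sym oner_eq0.
have g0 : g <> 0 by move=> e; move/eqP: gw; rewrite e dot0l eq_sym oner_eq0.
have [a [[c c0 ma] subf]] :=
  shared_normal KX fcX KZ1 Z1X Xr Z1r Xu1 Z1u1 ind1 f0 fr fu1 fX.
have [b [[d d0 mb] subg]] :=
  shared_normal KX fcX KZ2 Z2X Xr Z2r Xu2 Z2u2 ind2 g0 gr gu2 gX.
split=> //.
have ab : a != b.
  apply/eqP => e; have := congr1 (fun v => dot v u) mb.
  by rewrite /= -e ma !dotZl fu gu mulr1 mulr0 => /eqP; rewrite gt_eqF.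
have k3 : (k <= 3)%N.
  have [l [il jl]] := facet_other hK KX fcX i0 j0.
  have sub : {subset enum 'I_k <= [:: i0; j0; l]}.
    move=> l' _; rewrite !inE; have [//|il'] := eqVneq l' i0.
    have [//|jl'] := eqVneq l' j0; rewrite /= eq_sym in il' *; rewrite eq_sym in jl'.
    by rewrite (ray_three_facets hK KX fcX KY YX rm il jl il' jl').
  by have := uniq_leq_size (enum_uniq 'I_k) sub; rewrite size_enum_ord.
have [l [al bl]] := facet_other hK KX fcX a b.
have ml : 0 < dot (m l) r.
  rewrite lt0r (proj1 (facet_in fcX r)) // andbT; apply/eqP => lr; apply: r0.
  by apply: (facet_eq0 fcX ab al bl) => //; rewrite ?ma ?mb dotZl ?fr ?gr mulr0.
exists (- (dot (m l) u / dot (m l) r)), (- (dot (m l) w / dot (m l) r)).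
split.
  move=> s t z e.
  have ef : t = 0 by move: (congr1 (dot f) e); rewrite !dotE fr fu fw => <-; ring.
  have eg : z = 0 by move: (congr1 (dot g) e); rewrite !dotE gr gu gw => <-; ring.
  move: e; rewrite ef eg !scale0r !addr0 => /eqP; rewrite scaler_eq0.
  by move=> /orP[/eqP -> //|/eqP/r0].
move=> s t z; set x := _ + _.
have xf : dot f x = t by rewrite /x !dotE fr fu fw; ring.
have xg : dot g x = z by rewrite /x !dotE gr gu gw; ring.
have xl : dot (m l) x = s * dot (m l) r.
  by rewrite /x !dotE; field; rewrite gt_eqF.
split=> [Xx|[s0 t0 z0]].
  split; [|by rewrite -xf; exact: fX|by rewrite -xg; exact: gX].
  by have := proj1 (facet_in fcX x) Xx l; rewrite xl pmulr_lge0.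
apply/(facet_in fcX) => i.
have [|->|->|->] := @four_indices _ a b l i k3.
- by rewrite /= !inE negb_or ab al bl.
- by rewrite ma dotZl xf mulr_ge0 // ltW.
- by rewrite mb dotZl xg mulr_ge0 // ltW.
- by rewrite xl mulr_ge0 // ltW.
Qed.

End Star.

Section StarOfRay.
Variable R : realType.
Local Notation E := 'rV[R]_3.
Variable K : set (set E).
Hypothesis hK : tight_cells K.
Implicit Types (A B C D N X Y Z : set E) (q r u w x y : E) (a b : R).

(** The four cells around a four-valent ray, in cyclic order: opposite walls
    lie in the two planes spanned by [r] and [e1], and by [r] and [e2]. *)
Record star r (e1 e2 : E) a b A B C D : Prop := Star {
  st_A : K A;
  st_B : K B;
  st_C : K C;
  st_D : K D;
  st_sA : simplicial A r e1 e2;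
  st_sB : simplicial B r e2 (a *: r - e1);
  st_sC : simplicial C r (a *: r - e1) (b *: r - e2);
  st_sD : simplicial D r (b *: r - e2) e1
}.

Lemma simp_in X u w x (s t z : R) y : simplicial X u w x ->
  y = s *: u + t *: w + z *: x -> X y -> [/\ 0 <= s, 0 <= t & 0 <= z].
Proof. by move=> [_ h] -> /h. Qed.

(** [wedge_cell] gives the cells around [r] up to shears along [r].  The
    generators of two consecutive cells on their common wall agree, because each
    of them is in the other cell. *)
Lemma star_ex r (e1 e2 : E) A C : K A -> simplicial A r e1 e2 -> K C -> C <> A -> C r ->
  line_meet A C r -> exists a b B D, star r e1 e2 a b A B C D.
Proof.
move=> KA sA KC CA Cr line; have [ind _] := sA.
have [Ar Ae1 Ae2] := simplicial_gens sA.
have r0 := indep3_neq0 ind.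
have [n [fA [n0r n01 n02] [n1r n11 n12] [n2r n21 n22]]] := simplicial_facets sA.
have rm : ray_meet A n C 1 2 r.
  have [i [j rm]] := ray_meet_of hK KA fA KC CA Ar Cr r0 line.
  have z (l : 'I_3) : dot (n l) r = 0 -> l = 1 \/ l = 2.
    case: l => -[|[|[|//]]] h.
    - rewrite (_ : Ordinal h = 0); last exact/val_inj.
      by rewrite n0r => /eqP; rewrite oner_eq0.
    - by left; apply/val_inj.
    - by right; apply/val_inj.
  have := rm_neq rm; have [ei|ei] := z _ (rm_ni rm); have [ej|ej] := z _ (rm_nj rm).
  - by rewrite ei ej eqxx.
  - by move=> _; move: rm; rewrite ei ej.
  - by move=> _; apply: ray_meet_sym; move: rm; rewrite ei ej.
  - by rewrite ei ej eqxx.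
have rm' := ray_meet_sym rm.
have [B aB] := across_ex hK KA fA 1; have [D aD] := across_ex hK KA fA 2.
have [KB BA Bp] := aB; have [KD DA Dp] := aD.
have Br := ray_neighbour hK KA fA rm aB; have Dr := ray_neighbour hK KA fA rm' aD.
have Be2 := facet_sub_neighbour hK KA fA KB Bp Ae2 n12.
have De1 := facet_sub_neighbour hK KA fA KD Dp Ae1 n21.
have BD : B <> D by apply: (across_neq hK KA fA _ aB aD).
have lBD : line_meet B D r.
  by move=> x Bx Dx; apply: (ray_neighbours_meet hK KA fA KC CA rm aB aD Bx Dx).
(* the signs of [n 1] and [n 2] tell the four cells apart *)
have n1B x : B x -> dot (n 1) x <= 0 by exact: (neighbour_side hK KA fA KB BA Bp).
have n2D x : D x -> dot (n 2) x <= 0 by exact: (neighbour_side hK KA fA KD DA Dp).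
have n2B x : B x -> 0 <= dot (n 2) x by exact: (ray_neighbour_side hK KA fA KC CA rm aB).
have n1D x : D x -> 0 <= dot (n 1) x by exact: (ray_neighbour_side hK KA fA KC CA rm' aD).
have n1C x : C x -> dot (n 1) x <= 0 by move=> /(ray_side hK KA fA KC CA rm) [].
have n2C x : C x -> dot (n 2) x <= 0 by move=> /(ray_side hK KA fA KC CA rm) [].
have CB : C <> B.
  by move=> e; move: Be2; rewrite -e => /n2C; rewrite n22 ler10.
have CD : C <> D.
  by move=> e; move: De1; rewrite -e => /n1C; rewrite n11 ler10.
have [e e0 [Bu Cu]] : exists2 e, 0 < e & B (r + e *: - e1) /\ C (r + e *: - e1).
  apply: small_ex; apply: small_and.
    by apply: (ray_neighbour_wedge hK KA fA KC CA rm aB);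
      rewrite dotNr ?n11 ?n21 ?oppr0 ?oppr_le0 ?ler01.
  by apply: (ray_wedge hK KA fA KC CA rm); rewrite dotNr ?n11 ?n21 ?oppr0 ?oppr_le0 ?ler01.
have [d d0 [Du Cw]] : exists2 d, 0 < d & D (r + d *: - e2) /\ C (r + d *: - e2).
  apply: small_ex; apply: small_and.
    by apply: (ray_neighbour_wedge hK KA fA KC CA rm' aD);
      rewrite dotNr ?n22 ?n12 ?oppr0 ?oppr_le0 ?ler01.
  by apply: (ray_wedge hK KA fA KC CA rm); rewrite dotNr ?n22 ?n12 ?oppr0 ?oppr_le0 ?ler01.
have ind1 : indep2 r e1 by exact: indep3_2 ind.
have ind2 : indep2 r e2 by exact: indep3_2 (indep3_swap (indep3_rot (indep3_rot ind))).
have shear (v : E) c : indep2 r v -> 0 < c -> indep2 r (r + c *: - v).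
  move=> iv c0 s t st; have [|h1 /eqP] := iv (s + t) (- (t * c)).
    by rewrite -[RHS]st; vring.
  rewrite oppr_eq0 mulf_eq0 (gt_eqF c0) orbF => /eqP h2.
  by move: h1; rewrite h2 addr0.
have indu := shear _ _ ind1 e0; have indw := shear _ _ ind2 d0.
have ptu : dot (n 2) (r + e *: - e1) = 0 by rewrite dotDr dotZr dotNr n2r n21; ring.
have ptw : dot (n 1) (r + d *: - e2) = 0 by rewrite dotDr dotZr dotNr n1r n12; ring.
have [[sB [tB cB]] BsA BsC] : [/\ exists s t, simplicial B r (- e1 + s *: r) (e2 + t *: r),
    forall x, B x -> dot (- n 1) x = 0 -> A x & forall x, B x -> dot (n 2) x = 0 -> C x].
  apply: (wedge_cell (Y := D) (u1 := e2) (u2 := r + e *: - e1) hK KB KD) => //;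
    rewrite ?dotNl ?dotNr ?n1r ?n2r ?n11 ?n12 ?n21 ?n22 ?oppr0 ?opprK //.
  - by move=> /esym.
  - by move=> /esym.
  - by move=> x /n1B; rewrite dotNl oppr_ge0.
have [[sD [tD cD]] DsC DsA] : [/\ exists s t, simplicial D r (e1 + s *: r) (- e2 + t *: r),
    forall x, D x -> dot (n 1) x = 0 -> C x & forall x, D x -> dot (- n 2) x = 0 -> A x].
  apply: (wedge_cell (Y := B) (u1 := r + d *: - e2) (u2 := e1) hK KD KB) => //;
    rewrite ?dotNl ?dotNr ?n1r ?n2r ?n11 ?n12 ?n21 ?n22 ?oppr0 ?opprK //.
  - exact: line_meet_sym.
  - by move=> /esym.
  - by move=> x /n2D; rewrite dotNl oppr_ge0.
have [[sC [tC cC]] CsD CsB] : [/\ exists s t, simplicial C r (- e1 + s *: r) (- e2 + t *: r),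
    forall x, C x -> dot (- n 1) x = 0 -> D x & forall x, C x -> dot (- n 2) x = 0 -> B x].
  apply: (wedge_cell (Y := A) (u1 := r + d *: - e2) (u2 := r + e *: - e1) hK KC KA) => //;
    rewrite ?dotNl ?dotNr ?n1r ?n2r ?n11 ?n12 ?n21 ?n22 ?oppr0 ?opprK ?ptu ?ptw ?oppr0 //.
  - by move=> /esym.
  - exact: line_meet_sym.
  - by move=> /esym.
  - by move=> /esym.
  - by move=> x /n1C; rewrite dotNl oppr_ge0.
  - by move=> x /n2C; rewrite dotNl oppr_ge0.
have [_ gB1 gB2] := simplicial_gens cB; have [_ gD1 gD2] := simplicial_gens cD.
have [_ gC1 gC2] := simplicial_gens cC.
have tB0 : tB = 0.
  have [h1 _ _] : [/\ 0 <= - tB, 0 <= (0 : R) & 0 <= (1 : R)].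
    by apply: (simp_in cB _ Be2); vring.
  have [||h2 _ _] := @simp_in A r e1 e2 tB 0 1 (e2 + tB *: r) sA.
  - by vring.
  - by apply: BsA gB2 _; rewrite dotNl dotDr dotZr n12 n1r mulr0 addr0 oppr0.
  by lra.
have sD0 : sD = 0.
  have [h1 _ _] : [/\ 0 <= - sD, 0 <= (1 : R) & 0 <= (0 : R)].
    by apply: (simp_in cD _ De1); vring.
  have [||h2 _ _] := @simp_in A r e1 e2 sD 1 0 (e1 + sD *: r) sA.
  - by vring.
  - by apply: DsA gD1 _; rewrite dotNl dotDr dotZr n21 n2r mulr0 addr0 oppr0.
  by lra.
have sBC : sC = sB.
  have [||h1 _ _] := @simp_in _ _ _ _ (sB - sC) 1 0 (- e1 + sB *: r) cC.
  - by vring.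
  - by apply: BsC gB1 _; rewrite dotDr dotZr dotNr n21 n2r mulr0 addr0 oppr0.
  have [||h2 _ _] := @simp_in _ _ _ _ (sC - sB) 1 0 (- e1 + sC *: r) cB.
  - by vring.
  - by apply: CsB gC1 _; rewrite dotNl dotDr dotZr dotNr n21 n2r mulr0 addr0 !oppr0.
  by lra.
have tDC : tC = tD.
  have [||h1 _ _] := @simp_in _ _ _ _ (tD - tC) 0 1 (- e2 + tD *: r) cC.
  - by vring.
  - by apply: DsC gD2 _; rewrite dotDr dotZr dotNr n12 n1r mulr0 addr0 oppr0.
  have [||h2 _ _] := @simp_in _ _ _ _ (tC - tD) 0 1 (- e2 + tC *: r) cD.
  - by vring.
  - by apply: CsD gC2 _; rewrite dotNl dotDr dotZr dotNr n12 n1r mulr0 addr0 !oppr0.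
  by lra.
move: cB cC cD; rewrite tB0 sD0 sBC tDC !scale0r !addr0.
rewrite ![- _ + _ *: r]addrC => cB cC cD.
exists sB, tD, B, D; split=> //.
  exact: simplicial_flip cB.
exact: simplicial_flip cD.
Qed.

End StarOfRay.

(** * Polytopality of a family of cells *)

Section Polytopal.
Variable R : realType.
Local Notation E := 'rV[R]_3.
Implicit Types (A B C D X Y Z : set E) (q r u w x y l : E) (S : seq E).

Inductive pos_span (P : E -> Prop) : E -> Prop :=
| pos_span0 : pos_span P 0
| pos_span_cons a s y : 0 <= a -> P s -> pos_span P y -> pos_span P (a *: s + y).

Lemma pos_spanD P x y : pos_span P x -> pos_span P y -> pos_span P (x + y).
Proof.
move=> px py; elim: px => [|a s z a0 Ps _ IH]; first by rewrite add0r.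
by rewrite -addrA; exact: pos_span_cons.
Qed.

Lemma pos_spanZ P a s : 0 <= a -> P s -> pos_span P (a *: s).
Proof. by move=> a0 Ps; rewrite -[_ *: _]addr0; apply: pos_span_cons => //; exact: pos_span0. Qed.

(** The points of [S] where [l] is 1 generate the cell [C]: they are the
    vertices of a facet of the convex hull of [S], and [l = 1] is the plane of
    this facet. *)
Definition supports S C l :=
  [/\ forall s, s \in S -> dot l s <= 1,
      forall s, s \in S -> dot l s = 1 -> C s &
      forall x, C x -> pos_span (fun s => s \in S /\ dot l s = 1) x].

Definition polytopal (K : set (set E)) :=
  exists S, forall C, K C -> exists l, supports S C l.

Lemma supports_simplicial S C a b c l : simplicial C a b c ->
  {subset [:: a; b; c] <= S} -> dot l a = 1 -> dot l b = 1 -> dot l c = 1 ->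
  (forall s, s \in S -> s \in [:: a; b; c] \/ dot l s < 1) -> supports S C l.
Proof.
move=> sC sub la lb lc lS.
have one s : s \in [:: a; b; c] -> dot l s = 1.
  by rewrite !inE => /or3P[] /eqP->.
have [Ca Cb Cc] := simplicial_gens sC; split=> [s /lS[/one->//|/ltW//]|s /lS[|h e]|x].
- by rewrite !inE => /or3P[] /eqP->.
- by rewrite e ltxx in h.
move=> /(simplicial_coord sC) [s [t [r [s0 t0 r0 ->]]]].
by do 2?apply: pos_spanD; apply: pos_spanZ => //; split=> //; apply: sub;
  rewrite !inE eqxx ?orbT.
Qed.

Lemma simplicial_scale C a b c (s t r : R) : 0 < s -> 0 < t -> 0 < r ->
  simplicial C a b c -> simplicial C (s *: a) (t *: b) (r *: c).
Proof.
move=> s0 t0 r0 [ind cC]; split=> [x y z e|x y z].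
  have [|] := ind (x * s) (y * t) (z * r); first by rewrite -[RHS]e; vring.
  move=> /eqP + /eqP + /eqP; rewrite !mulf_eq0 (gt_eqF s0) (gt_eqF t0) (gt_eqF r0).
  by rewrite !orbF => /eqP -> /eqP -> /eqP ->.
by rewrite !scalerA cC !pmulr_lge0.
Qed.

Lemma cover_with K S Y u w z (c d t : R) x : K Y -> (exists l, supports S Y l) ->
  simplicial Y u w z -> 0 <= c -> 0 <= d -> 0 <= t ->
  x = c *: u + d *: w + t *: z ->
  exists X, [/\ K X, exists l, supports S X l & X x].
Proof. by move=> KY hY [_ sY] c0 d0 t0 ->; exists Y; split=> //; apply/sY. Qed.

End Polytopal.
Arguments cover_with {R K S Y u w z} c d t {x}.

(* Closes the side conditions of [supports_simplicial] when the points are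
   listed and the context gives the values of the linear form on them. *)
Ltac in_list := move=> ?; rewrite !inE; repeat case/orP; move/eqP=> ->;
  rewrite ?eqxx ?orbT.
Ltac supported sC :=
  apply: (supports_simplicial sC); [by in_list|lra|lra|lra|
    move=> ?; rewrite !inE; repeat case/orP; move/eqP=> ->;
    solve [by left; rewrite ?eqxx ?orbT | by right; lra]].

(** * Fans with a four-valent ray *)

Section Stars.
Variable R : realType.
Local Notation E := 'rV[R]_3.
Implicit Types (A B C D X Y Z : set E) (q r u w x y l : E) (S : seq E).
Variable K : set (set E).
Hypothesis hK : tight_cells K.

(** Any other cell would have an interior point in one of the cells of [P]. *)
Lemma cells_among (P : set E -> Prop) : (forall x, exists X, [/\ K X, P X & X x]) ->
  forall C, K C -> P C.
Proof.
move=> cov C KC; have [q cq] := tc_core hK KC; have [X [KX PX Xq]] := cov q.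
by rewrite (core_inj hK KC KX cq Xq).
Qed.

Lemma simplicial_core C a b c (s t r : R) : simplicial C a b c ->
  0 < s -> 0 < t -> 0 < r -> core C (s *: a + t *: b + r *: c).
Proof.
move=> [ind cC] s0 t0 r0 x; have [s' [t' [r' ->]]] := indep3_coord x ind.
apply: small_ex.
have := small_and (small_affine_gt s' s0) (small_and (small_affine_gt t' t0) (small_affine_gt r' r0)).
apply: small_imp => e _ [h1 [h2 h3]].
rewrite (_ : _ + e *: _ = (s + e * s') *: a + (t + e * t') *: b + (r + e * r') *: c); last by vring.
by apply/cC; split; apply: ltW.
Qed.

Lemma simplicial_subset A X a b c : K A -> K X -> simplicial A a b c ->
  X a -> X b -> X c -> A = X.
Proof.
move=> KA KX sA Xa Xb Xc.
apply: (core_inj hK KA KX (simplicial_core sA ltr01 ltr01 ltr01)).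
by rewrite !scale1r; do 2?apply: (cellD hK).
Qed.

(** [Z] contains the generators with a positive coefficient. *)
Lemma simplicial_coord_eq0 A Z a b c (s t r : R) : K A -> K Z -> simplicial A a b c ->
  0 <= s -> 0 <= t -> 0 <= r -> Z (s *: a + t *: b + r *: c) ->
  [/\ ~ Z a -> s = 0, ~ Z b -> t = 0 & ~ Z c -> r = 0].
Proof.
move=> KA KZ sA s0 t0 r0 Zx; have [Aa Ab Ac] := simplicial_gens sA.
have main u w v (x y z : R) : A u -> A w -> A v -> 0 <= x -> 0 <= y -> 0 <= z ->
    Z (x *: u + y *: w + z *: v) -> ~ Z u -> x = 0.
  move=> Au Aw Av x0 y0 z0 Zy nZ; apply/eqP; rewrite eq_le x0 andbT leNgt.
  apply/negP => xp; apply: nZ.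
  have Ay : A (y *: w + z *: v) by apply: (cellD hK) => //; apply: (cellZ hK).
  by apply: (cell_face hK KA KZ Au Ay xp ler01); rewrite scale1r addrA.
split; [exact: main Zx|apply: (main b c a t r s)|apply: (main c a b r s t)] => //.
  by rewrite (_ : _ + _ = s *: a + t *: b + r *: c) //; vring.
by rewrite (_ : _ + _ = s *: a + t *: b + r *: c) //; vring.
Qed.

Lemma simplicial_neighbour A a b c : K A -> simplicial A a b c ->
  exists X, [/\ K X, X <> A, X b & X c].
Proof.
move=> KA sA; have [n [fA [na nb nc] _ _]] := simplicial_facets sA.
have [X [KX XA Xp]] := across_ex hK KA fA 0; have [_ Ab Ac] := simplicial_gens sA.
by exists X; split=> //;
  [exact: (facet_sub_neighbour hK KA fA KX Xp Ab nb)|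
   exact: (facet_sub_neighbour hK KA fA KX Xp Ac nc)].
Qed.

Lemma star_rot r e1 e2 a b A B C D : star K r e1 e2 a b A B C D ->
  star K r e2 (a *: r - e1) b a B C D A.
Proof.
have e : a *: r - (a *: r - e1) = e1 by vring.
by case=> KA KB KC KD sA sB sC sD; split; rewrite ?e.
Qed.

Lemma star_scale r e1 e2 a b A B C D (s t : R) : 0 < s -> 0 < t ->
  star K r e1 e2 a b A B C D ->
  star K r (s *: e1) (t *: e2) (s * a) (t * b) A B C D.
Proof.
move=> s0 t0; case=> KA KB KC KD sA sB sC sD.
have ea : (s * a) *: r - s *: e1 = s *: (a *: r - e1) by vring.
have eb : (t * b) *: r - t *: e2 = t *: (b *: r - e2) by vring.
by split=> //; rewrite ?ea ?eb -[r]scale1r; apply: simplicial_scale; rewrite ?scale1r.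
Qed.

(** The generators [b *: r - e2] and [b' *: e1 - e2] are both in the cell across
    the wall of [r] and [e1]; their coordinates there force [b] and [b'] to be
    0, so that the stars are flat across this wall. *)
Lemma star_adjacent r e1 e2 a b A B C D a' b' B1 C1 D1 :
  star K r e1 e2 a b A B C D -> star K e1 r e2 a' b' A B1 C1 D1 ->
  [/\ b = 0, b' = 0 & D1 = D].
Proof.
case=> KA KB KC KD sA sB sC sD [_ KB1 KC1 KD1 sA1 sB1 sC1 sD1].
have [ind _] := sA; have [Ar A1 A2] := simplicial_gens sA.
have [Dr Db D1e] := simplicial_gens sD; have [E1 Eb Er] := simplicial_gens sD1.
have DA : D <> A.
  move=> e; rewrite e in Db.
  have [|_ _] := @simp_in _ _ _ _ _ b 0 (-1) _ sA _ Db; first by vring.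
  by rewrite oppr_ge0 ler10.
have D1A : D1 <> A.
  move=> e; rewrite e in Eb.
  have [|_ _] := @simp_in _ _ _ _ _ 0 b' (-1) _ sA _ Eb; first by vring.
  by rewrite oppr_ge0 ler10.
have DD := three_share hK KA KD1 KD (indep3_2 ind) Ar A1 Er E1 Dr D1e D1A DA.
rewrite DD in sD1 Eb.
have [|h1 _ h2] := @simp_in _ _ _ _ _ (- b') 1 b _ sD1 _ Db; first by vring.
have [|h3 _ h4] := @simp_in _ _ _ _ _ (- b) 1 b' _ sD _ Eb; first by vring.
by split=> //; lra.
Qed.

(** If the cells across the outer facets of [A] and [D] differ, then the second
    one meets [A] in the ray [e1] only, which is thus four-valent. *)
Lemma star_second r e1 e2 a b A B C D X X' : star K r e1 e2 a b A B C D ->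
  K X -> X <> A -> X e1 -> X e2 ->
  K X' -> X' <> D -> X' e1 -> X' (b *: r - e2) -> X <> X' ->
  b = 0 /\ exists a' B1 C1, star K e1 r e2 a' 0 A B1 C1 D.
Proof.
move=> st KX XA X1 X2 KX' XD X'1 X'b XX'; case: (st) => KA KB KC KD sA sB sC sD.
have [ind _] := sA; have [Ar A1 A2] := simplicial_gens sA.
have X'A : X' <> A.
  move=> e; rewrite e in X'b.
  have [|_ _] := @simp_in _ _ _ _ _ b 0 (-1) _ sA _ X'b; first by vring.
  by rewrite oppr_ge0 ler10.
have line : line_meet A X' e1.
  move=> x Ax; have [s [t [u [s0 t0 u0 ->]]]] := simplicial_coord sA Ax => X'x.
  have [s00 _ u00] := simplicial_coord_eq0 KA KX' sA s0 t0 u0 X'x.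
  exists t; rewrite s00 ?u00; first by vring.
    move=> X'2; apply: XX'; apply: (three_share hK KA KX KX' _ A1 A2 X1 X2 X'1 X'2) => //.
    exact: indep3_2 (indep3_rot ind).
  by move=> X'r; apply: XD; symmetry; exact: (simplicial_subset KD KX' sD).
have [a' [b' [B1 [D1 st1]]]] :=
  star_ex hK KA (simplicial_swap sA) KX' X'A X'1 line.
have [b0 b'0 D1D] := star_adjacent st st1; split=> //.
by exists a', B1, X'; rewrite -D1D -[X in star _ _ _ _ _ X]b'0.
Qed.

Lemma star_wedges r e1 e2 a b A B C D x : star K r e1 e2 a b A B C D ->
  let wedge u w := exists c d t : R, [/\ 0 <= d, 0 <= t & x = c *: r + d *: u + t *: w] in
  [\/ wedge e1 e2, wedge e2 (a *: r - e1), wedge (a *: r - e1) (b *: r - e2) |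
      wedge (b *: r - e2) e1].
Proof.
case=> _ _ _ _ [ind _] _ _ _ /=; have [c [d [t ->]]] := indep3_coord x ind.
have [d0|d0] := leP 0 d; have [t0|t0] := leP 0 t.
- by apply: Or41; exists c, d, t.
- by apply: Or44; exists (c + t * b), (- t), d; split=> //; [lra|vring].
- by apply: Or42; exists (c + d * a), t, (- d); split=> //; [lra|vring].
- by apply: Or43; exists (c + d * a + t * b), (- d), (- t); split; [lra|lra|vring].
Qed.

(** A star closed by a single cell is the fan of a pyramid with apex [r].  The
    closing cell does not contain [r], so [a] and [b] are negative, and scaling
    makes the base a parallelogram with centre [- r]. *)
Lemma pyramid r e1 e2 a b A B C D X : star K r e1 e2 a b A B C D ->
  K X -> X <> A -> X e1 -> X e2 -> X (a *: r - e1) -> X (b *: r - e2) ->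
  polytopal K.
Proof.
move=> st KX XA X1 X2 X3 X4; case: (st) => KA KB KC KD sA sB sC sD.
have [ind _] := sA.
have nXr : ~ X r by move=> Xr; apply: XA; rewrite (simplicial_subset KA KX sA Xr X1 X2).
have neg c e : X e -> e <> 0 -> X (c *: r - e) -> c < 0.
  move=> Xe e0 Xc; rewrite ltNge le_eqVlt; apply/negP => /orP[/eqP c0|c0].
    by move: Xc; rewrite -c0 scale0r add0r; exact: (cell_opp_neq hK KX Xe e0).
  by apply: nXr; apply: (cellZK hK KX c0); rewrite -(subrK e (c *: r)); exact: (cellD hK).
have e10 : e1 <> 0 := indep3_neq0 (indep3_rot ind).
have e20 : e2 <> 0 := indep3_neq0 (indep3_rot (indep3_rot ind)).
have a0 := neg _ _ X1 e10 X3; have b0 := neg _ _ X2 e20 X4.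
have s0 : 0 < - 2 / a by rewrite -mulrNN -invrN divr_gt0 // oppr_gt0 ?oppr_lt0.
have t0 : 0 < - 2 / b by rewrite -mulrNN -invrN divr_gt0 // oppr_gt0 ?oppr_lt0.
have st2 := star_scale s0 t0 st.
have X1' : X ((- 2 / a) *: e1) by apply: (cellZ hK KX (ltW s0)).
have X2' : X ((- 2 / b) *: e2) by apply: (cellZ hK KX (ltW t0)).
have X3' : X ((- 2 / a * a) *: r - (- 2 / a) *: e1).
  rewrite (_ : _ - _ = (- 2 / a) *: (a *: r - e1)); last by vring.
  by apply: (cellZ hK KX (ltW s0)).
have X4' : X ((- 2 / b * b) *: r - (- 2 / b) *: e2).
  rewrite (_ : _ - _ = (- 2 / b) *: (b *: r - e2)); last by vring.
  by apply: (cellZ hK KX (ltW t0)).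
rewrite !divfK ?lt_eqF // in st2 X3' X4'.
move: (_ *: e1) (_ *: e2) st2 X1' X2' X3' X4' => {sA sB sC sD st X1 X2 X3 X4 e10 e20 ind}.
move=> {}e1 {}e2 st X1 X2 X3 X4; case: (st) => _ _ _ _ sA sB sC sD.
have [ind _] := sA.
have low Y u w (c d t : R) : K Y -> simplicial Y r u w -> 0 <= d -> 0 <= t ->
    X (c *: r + d *: u + t *: w) -> c <= 0.
  move=> KY sY d0 t0' Xx; rewrite leNgt; apply/negP => c0; apply: nXr.
  have [Yr Yu Yw] := simplicial_gens sY.
  have Ydt : Y (d *: u + t *: w) by apply: (cellD hK) => //; apply: (cellZ hK).
  by apply: (cell_face hK KY KX Yr Ydt c0 ler01); rewrite scale1r addrA.
set S := [:: r; e1; e2; -2 *: r - e1; -2 *: r - e2].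
exists S.
have P (s t u : R) : exists l, [/\ dot l r = s, dot l e1 = t, dot l e2 = u,
    dot l (-2 *: r - e1) = -2 * s - t & dot l (-2 *: r - e2) = -2 * s - u].
  have [l [lr l1 l2]] := indep3_functional s t u ind; exists l.
  by rewrite !dotBr !dotZr lr l1 l2.
have hA : exists l, supports S A l.
  by have [l [v1 v2 v3 v4 v5]] := P 1 1 1; exists l; supported sA.
have hB : exists l, supports S B l.
  by have [l [v1 v2 v3 v4 v5]] := P 1 (-3) 1; exists l; supported sB.
have hC : exists l, supports S C l.
  by have [l [v1 v2 v3 v4 v5]] := P 1 (-3) (-3); exists l; supported sC.
have hD : exists l, supports S D l.
  by have [l [v1 v2 v3 v4 v5]] := P 1 1 (-3); exists l; supported sD.
have hX : exists l, supports S X l.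
  have [l [v1 v2 v3 v4 v5]] := P (-1) 1 1; exists l; split.
  - by move=> s; rewrite !inE; repeat case/orP; move/eqP=> ->; lra.
  - by move=> s; rewrite !inE; repeat case/orP; move/eqP=> -> //; lra.
  move=> x Xx; pose V s := s \in S /\ dot l s = 1.
  have V1 : V e1 by split => //; rewrite !inE eqxx ?orbT.
  have V2 : V e2 by split => //; rewrite !inE eqxx ?orbT.
  have V3 : V (-2 *: r - e1) by split; [rewrite !inE eqxx ?orbT|lra].
  have V4 : V (-2 *: r - e2) by split; [rewrite !inE eqxx ?orbT|lra].
  have span u w c d t : V u -> V w -> 0 <= d -> 0 <= t -> c <= 0 ->
      pos_span V (c *: r + d *: u + t *: w).
    move=> Vu Vw d0 t0' c0; do 2?apply: pos_spanD; try exact: pos_spanZ.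
    rewrite (_ : c *: r = (- c / 2) *: e1 + (- c / 2) *: (-2 *: r - e1)); last by vfield.
    by apply: pos_spanD; apply: pos_spanZ => //; lra.
  have [[c [d [t [d0 t0' e]]]]|[c [d [t [d0 t0' e]]]]|[c [d [t [d0 t0' e]]]]|[c [d [t [d0 t0' e]]]]] :=
    star_wedges x st; rewrite e in Xx *; apply: span => //.
  - exact: low KA sA d0 t0' Xx.
  - exact: low KB sB d0 t0' Xx.
  - exact: low KC sC d0 t0' Xx.
  - exact: low KD sD d0 t0' Xx.
apply: cells_among => x.
have cov Y u w : K Y -> (exists l, supports S Y l) -> simplicial Y r u w -> X u -> X w ->
    (exists c d t : R, [/\ 0 <= d, 0 <= t & x = c *: r + d *: u + t *: w]) ->
    exists Y, [/\ K Y, exists l, supports S Y l & Y x].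
  move=> KY hY [_ sY] Xu Xw [c [d [t [d0 t0' ->]]]].
  have [c0|c0] := leP 0 c; first by exists Y; split=> //; apply/sY.
  exists X; split=> //; do 2?apply: (cellD hK) => //; try exact: (cellZ hK).
  rewrite (_ : c *: r = (- c / 2) *: e1 + (- c / 2) *: (-2 *: r - e1)); last by vfield.
  by apply: (cellD hK) => //; apply: (cellZ hK) => //; lra.
case: (star_wedges x st) => w.
- exact: cov KA hA sA X1 X2 w.
- exact: cov KB hB sB X2 X3 w.
- exact: cov KC hC sC X3 X4 w.
- exact: cov KD hD sD X4 X1 w.
Qed.

End Stars.

Section FourValentClassification.
Variable R : realType.
Local Notation E := 'rV[R]_3.
Variable K : set (set E).
Hypothesis hK : tight_cells K.
Implicit Types (A B C D X Y Z : set E) (q r u w x y l : E).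

(** [wedge_cell] for the two facets at the ray. *)
Lemma simplicial_ray A C r : K A -> K C -> C <> A -> A r -> C r -> r <> 0 ->
  line_meet A C r -> exists e1 e2 : E, simplicial A r e1 e2.
Proof.
move=> KA KC CA Ar Cr r0 line; have [k [n [p fA]]] := cell_facets hK KA.
have [i [j rm]] := ray_meet_of hK KA fA KC CA Ar Cr r0 line.
have ij := rm_neq rm; have ji : j != i by rewrite eq_sym.
have pij := facet_off fA ij; have pji := facet_off fA ji.
have [Ni aNi] := across_ex hK KA fA i; have [Nj aNj] := across_ex hK KA fA j.
have Nir := ray_neighbour hK KA fA rm aNi.
have Njr := ray_neighbour hK KA fA (ray_meet_sym rm) aNj.
case: aNi aNj => KNi NiA Nip [KNj NjA Njp].
have ind (i0 j0 : 'I_k) : i0 != j0 -> dot (n i0) r = 0 -> indep2 r (p j0).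
  move=> ij0 nr s t e; have := congr1 (dot (n i0)) e.
  rewrite !dotE nr mulr0 add0r => /eqP.
  rewrite mulf_eq0 (gt_eqF (facet_off fA ij0)) orbF => /eqP t0.
  split=> //; move/eqP: e; rewrite t0 scale0r addr0 scaler_eq0.
  by move=> /orP[/eqP//|/eqP/r0].
have [||||[s [t sA]] _ _] := wedge_cell (u := (dot (n i) (p j))^-1 *: p j)
  (w := (dot (n j) (p i))^-1 *: p i)
  hK KA KC CA Ar Cr r0 line KNi NiA Nir (facet_pt_in fA i) Nip
  (ind _ _ ji (rm_nj rm)) (facet_on fA i) KNj NjA Njr (facet_pt_in fA j) Njp
  (ind _ _ ij (rm_ni rm)) (facet_on fA j) (rm_ni rm) (rm_nj rm)
  (fun x Ax => proj1 (facet_in fA x) Ax i) (fun x Ax => proj1 (facet_in fA x) Ax j)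
  _ _ _ _.
- by rewrite dotZr mulVf // gt_eqF.
- by rewrite dotZr (facet_on fA) mulr0.
- by rewrite dotZr (facet_on fA) mulr0.
- by rewrite dotZr mulVf // gt_eqF.
exists ((dot (n i) (p j))^-1 *: p j + s *: r), ((dot (n j) (p i))^-1 *: p i + t *: r).
exact: sA.
Qed.

(** The points [r], [e1], [P] of sum 0 are the equator of the bipyramid, and
    [e2], [- e2] its apices. *)
Lemma bipyramid A B C D B1 C1 r (e1 e2 P : E) : P = - r - e1 ->
  [/\ K A, K B, K C & K D] -> K B1 -> K C1 ->
  simplicial A r e1 e2 -> simplicial B r e2 P -> simplicial C r P (- e2) ->
  simplicial D r (- e2) e1 -> simplicial B1 e1 e2 P -> simplicial C1 e1 P (- e2) ->
  polytopal K.
Proof.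
move=> eP [KA KB KC KD] KB1 KC1 sA sB sC sD sB1 sC1; have [ind _] := sA.
set S := [:: r; e1; e2; P; - e2]; exists S.
have val (s t u : R) : exists l, [/\ dot l r = s, dot l e1 = t, dot l e2 = u,
    dot l P = - s - t & dot l (- e2) = - u].
  have [l [lr l1 l2]] := indep3_functional s t u ind; exists l.
  by rewrite eP dotBr !dotNr lr l1 l2.
have hA : exists l, supports S A l.
  by have [l [v1 v2 v3 v4 v5]] := val 1 1 1; exists l; supported sA.
have hB : exists l, supports S B l.
  by have [l [v1 v2 v3 v4 v5]] := val 1 (-2) 1; exists l; supported sB.
have hC : exists l, supports S C l.
  by have [l [v1 v2 v3 v4 v5]] := val 1 (-2) (-1); exists l; supported sC.
have hD : exists l, supports S D l.
  by have [l [v1 v2 v3 v4 v5]] := val 1 1 (-1); exists l; supported sD.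
have hB1 : exists l, supports S B1 l.
  by have [l [v1 v2 v3 v4 v5]] := val (-2) 1 1; exists l; supported sB1.
have hC1 : exists l, supports S C1 l.
  by have [l [v1 v2 v3 v4 v5]] := val (-2) 1 (-1); exists l; supported sC1.
apply: (cells_among hK) => x; have [c [d [t ->]]] := indep3_coord x ind.
have [cd|cd] := leP c d; have [t0|t0] := leP 0 t.
- have [c0|c0] := leP 0 c.
    by apply: (cover_with c d t KA hA sA) => //; lra.
  by apply: (cover_with (d - c) t (- c) KB1 hB1 sB1); [lra|lra|lra|rewrite eP; vring].
- have [c0|c0] := leP 0 c.
    by apply: (cover_with c (- t) d KD hD sD); [lra|lra|lra|vring].
  by apply: (cover_with (d - c) (- c) (- t) KC1 hC1 sC1); [lra|lra|lra|rewrite eP; vring].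
- have [d0|d0] := leP 0 d.
    by apply: (cover_with c d t KA hA sA) => //; lra.
  by apply: (cover_with (c - d) t (- d) KB hB sB); [lra|lra|lra|rewrite eP; vring].
- have [d0|d0] := leP 0 d.
    by apply: (cover_with c (- t) d KD hD sD); [lra|lra|lra|vring].
  by apply: (cover_with (c - d) (- d) (- t) KC hC sC); [lra|lra|lra|rewrite eP; vring].
Qed.

(** The octant opposite to [A] is the cell antipodal to [A]: a cell in that
    direction meets [A] in the vertex only. *)
Lemma octahedron A B C D B1 C1 X r (e1 e2 : E) :
  [/\ K A, K B, K C & K D] -> K B1 -> K C1 -> K X ->
  simplicial A r e1 e2 -> simplicial B r (- e1) e2 -> simplicial C r (- e1) (- e2) ->
  simplicial D r e1 (- e2) -> simplicial B1 (- r) e1 e2 ->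
  simplicial C1 (- r) e1 (- e2) -> simplicial X (- r) (- e1) e2 ->
  polytopal K.
Proof.
move=> [KA KB KC KD] KB1 KC1 KX sA sB sC sD sB1 sC1 sX; have [ind cA] := sA.
have [Z KZ Zy] := tc_cover hK (- (r + e1 + e2)).
have [Ar A1 A2] := simplicial_gens sA.
have ZA : Z <> A.
  move=> e; rewrite e in Zy.
  have [|h _ _] := @simp_in _ _ _ _ _ (-1) (-1) (-1) _ sA _ Zy; first by vring.
  by move: h; rewrite oppr_ge0 ler10.
have half0 : (0 : R) < 1 / 2 by lra.
have contra Y u w z v : K Y -> simplicial Y u w z -> Z v ->
    v + (1 / 2) *: - (r + e1 + e2) = (1 / 2) *: u + (1 / 2) *: w + (1 / 2) *: z ->
    Y = Z.
  move=> KY sY Zv e; apply: (core_inj hK KY KZ (simplicial_core sY half0 half0 half0)).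
  by rewrite -e; apply: (cellD hK) => //; apply: (cellZ hK) => //; lra.
have nr : ~ Z r.
  move=> Zr; have e := contra _ _ _ _ _ KC sC Zr; rewrite -e in Zy; last by vfield.
  have [|h _ _] := @simp_in _ _ _ _ _ (-1) 1 1 _ sC _ Zy; first by vring.
  by move: h; rewrite oppr_ge0 ler10.
have n1 : ~ Z e1.
  move=> Z1; have e := contra _ _ _ _ _ KC1 sC1 Z1; rewrite -e in Zy; last by vfield.
  have [|_ h _] := @simp_in _ _ _ _ _ 1 (-1) 1 _ sC1 _ Zy; first by vring.
  by move: h; rewrite oppr_ge0 ler10.
have n2 : ~ Z e2.
  move=> Z2; have e := contra _ _ _ _ _ KX sX Z2; rewrite -e in Zy; last by vfield.
  have [|_ _ h] := @simp_in _ _ _ _ _ 1 1 (-1) _ sX _ Zy; first by vring.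
  by move: h; rewrite oppr_ge0 ler10.
have [|opp _] := tc_anti hK KZ KA ZA.
  move=> x Zx Ax; have [c [d [t [c0 d0 t0 e]]]] := simplicial_coord sA Ax.
  rewrite e in Zx *.
  have [c00 d00 t00] := simplicial_coord_eq0 hK KA KZ sA c0 d0 t0 Zx.
  by rewrite (c00 nr) (d00 n1) (t00 n2); vring.
have sZ : simplicial Z (- r) (- e1) (- e2).
  split=> [s t u e|s t u].
    have [|-> -> ->] := ind s t u; last by [].
    by rewrite -[RHS]oppr0 -e; vring.
  rewrite opp -cA (_ : - _ = s *: r + t *: e1 + u *: e2) //; vring.
set S := [:: r; e1; e2; - r; - e1; - e2]; exists S.
have val (s t u : R) : exists l, [/\ dot l r = s, dot l e1 = t & dot l e2 = u] /\
    [/\ dot l (- r) = - s, dot l (- e1) = - t & dot l (- e2) = - u].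
  have [l [lr l1 l2]] := indep3_functional s t u ind; exists l.
  by rewrite !dotNr lr l1 l2.
have hA : exists l, supports S A l.
  by have [l [[v1 v2 v3] [v4 v5 v6]]] := val 1 1 1; exists l; supported sA.
have hB : exists l, supports S B l.
  by have [l [[v1 v2 v3] [v4 v5 v6]]] := val 1 (-1) 1; exists l; supported sB.
have hC : exists l, supports S C l.
  by have [l [[v1 v2 v3] [v4 v5 v6]]] := val 1 (-1) (-1); exists l; supported sC.
have hD : exists l, supports S D l.
  by have [l [[v1 v2 v3] [v4 v5 v6]]] := val 1 1 (-1); exists l; supported sD.
have hB1 : exists l, supports S B1 l.
  by have [l [[v1 v2 v3] [v4 v5 v6]]] := val (-1) 1 1; exists l; supported sB1.
have hC1 : exists l, supports S C1 l.
  by have [l [[v1 v2 v3] [v4 v5 v6]]] := val (-1) 1 (-1); exists l; supported sC1.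
have hX : exists l, supports S X l.
  by have [l [[v1 v2 v3] [v4 v5 v6]]] := val (-1) (-1) 1; exists l; supported sX.
have hZ : exists l, supports S Z l.
  by have [l [[v1 v2 v3] [v4 v5 v6]]] := val (-1) (-1) (-1); exists l; supported sZ.
apply: (cells_among hK) => x; have [c [d [t ->]]] := indep3_coord x ind.
have [c0|c0] := leP 0 c; have [d0|d0] := leP 0 d; have [t0|t0] := leP 0 t.
- by apply: (cover_with c d t KA hA sA).
- by apply: (cover_with c d (- t) KD hD sD) => //; [lra|vring].
- by apply: (cover_with c (- d) t KB hB sB) => //; [lra|vring].
- by apply: (cover_with c (- d) (- t) KC hC sC) => //; [lra|lra|vring].
- by apply: (cover_with (- c) d t KB1 hB1 sB1) => //; [lra|vring].
- by apply: (cover_with (- c) d (- t) KC1 hC1 sC1) => //; [lra|lra|vring].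
- by apply: (cover_with (- c) (- d) t KX hX sX) => //; [lra|lra|vring].
- by apply: (cover_with (- c) (- d) (- t) KZ hZ sZ); [lra|lra|lra|vring].
Qed.

End FourValentClassification.

Section FourValentTheorem.
Variable R : realType.
Local Notation E := 'rV[R]_3.
Variable K : set (set E).
Hypothesis hK : tight_cells K.
Implicit Types (A B C D X Y Z : set E) (q r u w x y l : E).

(** Two stars flat across their common wall: the cells [B] and [B1] on the
    same side meet either along the ray [e2] only, which is then four-valent
    and leads to the octahedron, or along a facet, whose second ray is the third
    point of the equator of a bipyramid. *)
Lemma two_stars r (e1 e2 : E) (a a' : R) A B C D B1 C1 :
  star K r e1 e2 a 0 A B C D -> star K e1 r e2 a' 0 A B1 C1 D -> polytopal K.
Proof.
move=> st st1; case: (st) => KA KB KC KD sA sB sC sD.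
case: (st1) => _ KB1 KC1 _ _ sB1 sC1 _; have [ind cA] := sA.
have [Ar A1 A2] := simplicial_gens sA; have [Br B2 BP] := simplicial_gens sB.
have [B11 B12 B1Q] := simplicial_gens sB1.
have e20 : e2 <> 0 := indep3_neq0 (indep3_rot (indep3_rot ind)).
have [line|[x [Bx B1x ind2]]] := line_or_indep B B1 e20.
- have B1B : B1 <> B.
    move=> e; rewrite e in B11.
    have [|_ _ h] := @simp_in _ _ _ _ _ a 0 (-1) _ sB _ B11; first by vring.
    by move: h; rewrite oppr_ge0 ler10.
  have [a2 [b2 [X [Y st2]]]] := star_ex hK KB (simplicial_swap sB) KB1 B1B B12 line.
  have [a0 b20 _] := star_adjacent hK (star_rot st) st2.
  have [a3 [b3 [X' [Y' st3]]]] := star_ex hK KB1 (simplicial_swap sB1) KB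
    (nesym B1B) B2 (line_meet_sym line).
  have [a'0 _ _] := star_adjacent hK (star_rot st1) st3.
  have z (v w : E) : 0 *: v - w = - w by vring.
  move: sB sC sD sB1 sC1 (st_sB st2) (st_sC st2); rewrite a0 a'0 b20 !z opprK.
  move=> sB sC sD sB1 sC1 sX sB1'.
  have a20 : a2 = 0.
    have [_ g _] := simplicial_gens sB1'; have [_ _ g'] := simplicial_gens sB1.
    have [|_ h1 _] := @simp_in _ _ _ _ _ 0 a2 1 _ sB1 _ g; first by vring.
    have [|h2 _ _] := @simp_in _ _ _ _ _ (- a2) 1 0 _ sB1' _ g'; first by vring.
    by lra.
  rewrite a20 z in sX.
  apply: (octahedron hK (A := A) (B := B) (C := C) (D := D) (B1 := B1) (C1 := C1)
    (X := X) _ KB1 KC1 (st_B st2) sA) => //.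
  + exact: simplicial_flip.
  + exact: simplicial_flip.
  + exact: simplicial_rot (simplicial_rot sB1).
  + exact: simplicial_swap.
  + exact: simplicial_rot (simplicial_swap (simplicial_rot (simplicial_rot sX))).
have [s [t [u [s0 t0 u0 e]]]] := simplicial_coord sB Bx.
have [s' [t' [u' [s'0 t'0 u'0 e']]]] := simplicial_coord sB1 B1x.
have nB1A : B1 <> A.
  move=> h; rewrite h in B1Q.
  have [|h1 _ _] := @simp_in _ _ _ _ _ (-1) a' 0 _ sA _ B1Q; first by vring.
  by move: h1; rewrite oppr_ge0 ler10.
have nBA : B <> A.
  move=> h; rewrite h in BP.
  have [|_ h1 _] := @simp_in _ _ _ _ _ a (-1) 0 _ sA _ BP; first by vring.
  by move: h1; rewrite oppr_ge0 ler10.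
have Bx' := Bx; rewrite e' in Bx'; have B1x' := B1x; rewrite e in B1x'.
have [/(_ _)s00 _ _] := simplicial_coord_eq0 hK KB KB1 sB s0 t0 u0 B1x'.
have [/(_ _)s'00 _ _] := simplicial_coord_eq0 hK KB1 KB sB1 s'0 t'0 u'0 Bx'.
have {}s00 : s = 0.
  by apply: s00 => B1r; apply: nB1A; symmetry; exact: (simplicial_subset hK KA KB1 sA).
have {}s'00 : s' = 0.
  by apply: s'00 => B1e; apply: nBA; symmetry; exact: (simplicial_subset hK KA KB sA).
have un0 : u != 0.
  apply/eqP => u00; have [|_ /eqP] := ind2 t (-1).
    by rewrite e s00 u00; vring.
  by rewrite oppr_eq0 oner_eq0.
have [|ea eb et] := @indep3_inj _ _ _ _ (u * a) (- u) t (- u') (u' * a') t' ind.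
  transitivity x; first by rewrite e s00; vring.
  by rewrite e' s'00; vring.
have up : 0 < u by rewrite lt0r un0.
have u'p : 0 < u'.
  rewrite lt0r u'0 andbT; apply/eqP => z; move: eb un0.
  by rewrite z mul0r => /eqP; rewrite oppr_eq0 => /eqP ->; rewrite eqxx.
have an : a < 0 by nra.
have P : u *: (a *: r - e1) = u' *: (a' *: e1 - r).
  rewrite (_ : u *: _ = (u * a) *: r + (- u) *: e1); last by vring.
  by rewrite ea eb; vring.
(* the scale that makes the sum of the three points of the equator 0 *)
pose c := - a^-1.
have c0 : 0 < c by rewrite /c oppr_gt0 invr_lt0.
have eP : c *: (a *: r - e1) = - r - c *: e1.
  by rewrite scalerBr scalerA /c mulNr mulVf ?lt_eqF // scaleN1r.
have eQ : (c * (u^-1 * u')) *: (a' *: e1 - r) = - r - c *: e1.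
  by rewrite -eP -scalerA -[(u^-1 * u') *: _]scalerA -P scalerK.
have cQ : 0 < c * (u^-1 * u') by rewrite !mulr_gt0 // invr_gt0.
have z (v : E) : 0 *: v - e2 = - e2 by vring.
rewrite !z in sC sD sC1.
apply: (@bipyramid _ _ hK A B C D B1 C1 r (c *: e1) e2 (- r - c *: e1)) => //.
- by have := simplicial_scale ltr01 c0 ltr01 sA; rewrite !scale1r.
- by have := simplicial_scale ltr01 ltr01 c0 sB; rewrite !scale1r eP.
- by have := simplicial_scale ltr01 c0 ltr01 sC; rewrite !scale1r eP.
- by have := simplicial_scale ltr01 ltr01 c0 sD; rewrite !scale1r.
- by have := simplicial_scale c0 ltr01 cQ sB1; rewrite !scale1r eQ.
- by have := simplicial_scale c0 cQ ltr01 sC1; rewrite !scale1r eQ.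
Qed.

Lemma star_third r (e1 e2 : E) (a b : R) A B C D X X' : star K r e1 e2 a b A B C D ->
  K X -> X <> A -> X e1 -> X e2 ->
  K X' -> X' <> D -> X' e1 -> X' (b *: r - e2) -> X <> X' -> polytopal K.
Proof.
move=> st KX XA X1 X2 KX' XD X'1 X'b XX'.
have [b0 [a' [B1 [C1 st1]]]] := star_second hK st KX XA X1 X2 KX' XD X'1 X'b XX'.
by rewrite b0 in st; exact: two_stars st st1.
Qed.

(** The fan is determined by the cells across the outer facets of a star: if
    they all coincide it is a pyramid, otherwise two consecutive ones are
    distinct and the ray between them is four-valent as well. *)
Lemma star_polytopal r (e1 e2 : E) (a b : R) A B C D :
  star K r e1 e2 a b A B C D -> polytopal K.
Proof.
move=> st; case: (st) => KA KB KC KD sA sB sC sD.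
have [XA [KXA AA A1 A2]] := simplicial_neighbour hK KA sA.
have [XB [KXB BB B1 B2]] := simplicial_neighbour hK KB sB.
have [XC [KXC CC C1 C2]] := simplicial_neighbour hK KC sC.
have [XD [KXD DD D1 D2]] := simplicial_neighbour hK KD sD.
have back (c : R) (v : E) : c *: r - (c *: r - v) = v by vring.
have [AD|AD] := pselect (XA = XD); last first.
  exact: (star_third st KXA AA A1 A2 KXD DD D2 D1 AD).
have [BA|BA] := pselect (XB = XA); last first.
  by apply: (star_third (star_rot st) KXB BB B1 B2 KXA AA A2 _ BA); rewrite back.
have [CB|CB] := pselect (XC = XB); last first.
  by apply: (star_third (star_rot (star_rot st)) KXC CC C1 C2 KXB BB B2 _ CB); rewrite back.
apply: (pyramid hK st KXA AA A1 A2).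
- by rewrite -BA.
- by rewrite AD.
Qed.

Lemma four_valent_polytopal A C r : K A -> K C -> C <> A -> A r -> C r -> r <> 0 ->
  line_meet A C r -> polytopal K.
Proof.
move=> KA KC CA Ar Cr r0 line.
have [e1 [e2 sA]] := simplicial_ray hK KA KC CA Ar Cr r0 line.
have [a [b [B [D st]]]] := star_ex hK KA sA KC CA Cr line.
exact: star_polytopal st.
Qed.

End FourValentTheorem.

(** * Fans without four-valent rays or antipodes *)

Section NoFourValent.
Variable R : realType.
Local Notation E := 'rV[R]_3.
Variable K : set (set E).
Hypothesis hK : tight_cells K.
Hypothesis no4 : forall A C r, K A -> K C -> C <> A -> A r -> C r -> r <> 0 ->
  ~ line_meet A C r.
Implicit Types (A B C D N X Y Z : set E) (q r u w x y : E).

Definition share_wall X Y := exists u w, [/\ X u, X w, Y u, Y w & indep2 u w].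

Lemma share_wall_of X Y r : K X -> K Y -> Y <> X -> X r -> Y r -> r <> 0 ->
  share_wall X Y.
Proof.
move=> KX KY YX Xr Yr r0; have [line|[x [Xx Yx ind]]] := line_or_indep X Y r0.
  by case: (no4 KX KY YX Xr Yr r0 line).
by exists r, x.
Qed.

Section Rep.
Variables (k : nat) (A : set E) (n p : 'I_k -> E).
Hypotheses (KA : K A) (fA : facets A n p).

(** [crossing_cells] would make two independent vectors multiples of [y]. *)
Lemma cross_contra i l j m Ni Nl Nj Nm : uniq [:: i; l; j; m] ->
  across K A (p i) Ni -> across K A (p l) Nl -> across K A (p j) Nj ->
  across K A (p m) Nm -> share_wall Ni Nl -> share_wall Nj Nm ->
  ~ paired (p i) (p l) (p j) (p m).
Proof.
move=> dif ai al aj am [u [w [iu iw lu lw ind]]] [y [y' [jy _ my _ ind']]] pr.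
have nz (v v' : E) : indep2 v v' -> v <> 0.
  move=> iv v0; have [|/eqP] := iv 1 0; last by rewrite oner_eq0.
  by rewrite v0 scaler0 scale0r addr0.
have w0 : w <> 0.
  move=> w0; have [|_ /eqP] := ind 0 1; last by rewrite oner_eq0.
  by rewrite w0 scaler0 scale0r addr0.
have [c c0 ec] := crossing_cells hK KA fA dif ai al aj am pr iu lu (nz _ _ ind) jy my (nz _ _ ind').
have [d d0 ed] := crossing_cells hK KA fA dif ai al aj am pr iw lw w0 jy my (nz _ _ ind').
apply: (indep2_not_line (r := y) ind).
  by exists c^-1; rewrite ec scalerK // gt_eqF.
by exists d^-1; rewrite ed scalerK // gt_eqF.
Qed.

Lemma facets3_simplicial : (k <= 3)%N -> exists a b c : E, simplicial A a b c.
Proof.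
move=> k3; have k30 : (0 < k)%N := leq_trans (isT : (0 < 3)%N) (facets_ge3 hK KA fA).
pose i := Ordinal k30; have [j [ij _]] := facet_other hK KA fA i i.
have [l [il jl]] := facet_other hK KA fA i j.
have [a [b [c D]]] := indep3_dual (facet_indep3 fA ij il jl).
have ind := dual_bases_indep D; case: D => _ ev.
exists a, b, c; split=> // s t r; have [/= ei ej el] := ev s t r.
split=> [/(facet_in fA) h|[s0 t0 r0]].
  by split; [rewrite -ei|rewrite -ej|rewrite -el].
apply/(facet_in fA) => i'.
by have [|->|->|->] := @four_indices _ i j l i' k3;
  rewrite ?ei ?ej ?el //= !inE negb_or ij il jl.
Qed.

End Rep.

Lemma tetrahedron A N0 N1 N2 (a0 a1 a2 b : E) : b = - a0 - a1 - a2 ->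
  [/\ K A, K N0, K N1 & K N2] ->
  simplicial A a0 a1 a2 -> simplicial N0 a1 a2 b -> simplicial N1 a0 a2 b ->
  simplicial N2 a0 a1 b -> polytopal K.
Proof.
move=> eb [KA KN0 KN1 KN2] sA s0 s1 s2; have [ind _] := sA.
set S := [:: a0; a1; a2; b]; exists S.
have val (s t u : R) : exists l, [/\ dot l a0 = s, dot l a1 = t, dot l a2 = u &
    dot l b = - s - t - u].
  have [l [l0 l1 l2]] := indep3_functional s t u ind; exists l.
  by rewrite eb !dotBr !dotNr l0 l1 l2.
have hA : exists l, supports S A l.
  by have [l [v1 v2 v3 v4]] := val 1 1 1; exists l; supported sA.
have h0 : exists l, supports S N0 l.
  by have [l [v1 v2 v3 v4]] := val (-3) 1 1; exists l; supported s0.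
have h1 : exists l, supports S N1 l.
  by have [l [v1 v2 v3 v4]] := val 1 (-3) 1; exists l; supported s1.
have h2 : exists l, supports S N2 l.
  by have [l [v1 v2 v3 v4]] := val 1 1 (-3); exists l; supported s2.
apply: (cells_among hK) => x; have [c [d [t ->]]] := indep3_coord x ind.
have [/and3P[c0 d0 t0]|neg] := boolP [&& 0 <= c, 0 <= d & 0 <= t].
  by apply: (cover_with c d t KA hA sA).
have {}neg : [\/ c < 0, d < 0 | t < 0].
  by move: neg; rewrite !negb_and -!ltNge => /or3P.
have [cd|cd] := leP c d.
  have [ct|ct] := leP c t.
    have c0 : c < 0 by case: neg; lra.
    by apply: (cover_with (d - c) (t - c) (- c) KN0 h0 s0); [lra|lra|lra|rewrite eb; vring].
  have t0 : t < 0 by case: neg; lra.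
  by apply: (cover_with (c - t) (d - t) (- t) KN2 h2 s2); [lra|lra|lra|rewrite eb; vring].
have [dt|dt] := leP d t.
  have d0 : d < 0 by case: neg; lra.
  by apply: (cover_with (c - d) (t - d) (- d) KN1 h1 s1); [lra|lra|lra|rewrite eb; vring].
have t0 : t < 0 by case: neg; lra.
by apply: (cover_with (c - t) (d - t) (- t) KN2 h2 s2); [lra|lra|lra|rewrite eb; vring].
Qed.

(** A vector of [N] with a negative coordinate would be the sum of a positive
    multiple of [v0 = - v1 - v2 - v3] and a vector of the same other cell, so
    that [N] would contain [v0]. *)
Lemma tetra_cell N M1 M2 M3 (v0 v1 v2 v3 : E) : K N -> K M1 -> K M2 -> K M3 ->
  v0 + v1 + v2 + v3 = 0 -> indep3 v1 v2 v3 -> ~ N v0 -> N v1 -> N v2 -> N v3 ->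
  M1 v0 -> M1 v2 -> M1 v3 -> M2 v0 -> M2 v1 -> M2 v3 -> M3 v0 -> M3 v1 -> M3 v2 ->
  simplicial N v1 v2 v3.
Proof.
move=> KN KM1 KM2 KM3 sum ind nN N1 N2 N3 M10 M12 M13 M20 M21 M23 M30 M31 M32.
have e0 : v0 = - v1 - v2 - v3.
  by apply/eqP; rewrite -subr_eq0 -[X in _ == X]sum; apply/eqP; vring.
split=> // s t u; split=> [Nx|[s0 t0 u0]]; last first.
  by do 2?apply: (cellD hK) => //; apply: (cellZ hK).
have key M w w' (c d m : R) : K M -> M v0 -> M w -> M w' -> 0 <= c -> 0 <= d -> m < 0 ->
    s *: v1 + t *: v2 + u *: v3 = c *: w + d *: w' + (- m) *: v0 -> False.
  move=> KM Mv0 Mw Mw' c0 d0 m0 e; apply: nN; rewrite -oppr_gt0 in m0.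
  have My : M (c *: w + d *: w') by apply: (cellD hK) => //; apply: (cellZ hK).
  by apply: (cell_face hK KM KN Mv0 My m0 ler01); rewrite scale1r addrC -e.
have h1 : s < 0 -> s <= t -> s <= u -> False.
  move=> s0 st su; by apply: (key M1 v2 v3 (t - s) (u - s) s) => //; [lra|lra|rewrite e0; vring].
have h2 : t < 0 -> t <= s -> t <= u -> False.
  move=> t0 st su; by apply: (key M2 v1 v3 (s - t) (u - t) t) => //; [lra|lra|rewrite e0; vring].
have h3 : u < 0 -> u <= s -> u <= t -> False.
  move=> t0 st su; by apply: (key M3 v1 v2 (s - u) (t - u) u) => //; [lra|lra|rewrite e0; vring].
have min0 : ~ (s < 0 \/ t < 0 \/ u < 0).
  move=> neg; have [st|st] := leP s t.
    have [su|su] := leP s u; first by apply: h1 => //; case: neg => [|[]]; lra.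
    by apply: h3 => //; [case: neg => [|[]]; lra|lra|lra].
  have [tu|tu] := leP t u; first by apply: h2 => //; [case: neg => [|[]]; lra|lra].
  by apply: h3 => //; [case: neg => [|[]]; lra|lra|lra].
by split; rewrite leNgt; apply/negP => neg; apply: min0; [left|right; left|right; right].
Qed.

Hypothesis noanti : forall X Y, K X -> K Y -> Y <> X -> share_wall X Y.

(** Four facets would have crossing diagonals for one of their pairings,
    against [cross_contra]. *)
Lemma no_antipodes_three k A (n p : 'I_k -> E) : K A -> facets A n p -> (k <= 3)%N.
Proof.
move=> KA fA; rewrite leqNgt; apply/negP => k4.
have k0 : (0 < k)%N := ltn_trans (isT : (0 < 3)%N) k4.
have k1 : (1 < k)%N := ltn_trans (isT : (1 < 3)%N) k4.
have k2 : (2 < k)%N := ltn_trans (isT : (2 < 3)%N) k4.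
pose i := Ordinal k0; pose j := Ordinal k1; pose l := Ordinal k2; pose m := Ordinal k4.
have dif : uniq [:: i; j; l; m] by [].
have [Ni ai] := across_ex hK KA fA i; have [Nj aj] := across_ex hK KA fA j.
have [Nl al] := across_ex hK KA fA l; have [Nm am] := across_ex hK KA fA m.
have adj a b N N' : a != b -> across K A (p a) N -> across K A (p b) N' -> share_wall N N'.
  move=> ab aN aN'; have [KN _ _] := aN; have [KN' _ _] := aN'.
  by apply: noanti => //; apply/nesym; exact: (across_neq hK KA fA ab aN aN').
case: (facets_paired fA dif).
- exact: (cross_contra KA fA _ ai aj al am (adj i j _ _ isT ai aj) (adj l m _ _ isT al am)).
- exact: (cross_contra KA fA _ ai al aj am (adj i l _ _ isT ai al) (adj j m _ _ isT aj am)).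
- exact: (cross_contra KA fA _ ai am aj al (adj i m _ _ isT ai am) (adj j l _ _ isT aj al)).
Qed.

(** The three neighbours of a simplicial cell share a ray [b], opposite to the
    cell; after scaling, the generators of the cell and [b] have sum 0. *)
Lemma no_antipodes_polytopal : polytopal K.
Proof.
have [A KA _] := tc_cover hK 0; have [k [n0 [p0 fA0]]] := cell_facets hK KA.
have [a0 [a1 [a2 sA]]] := facets3_simplicial KA fA0 (no_antipodes_three KA fA0).
have [ind cA] := sA.
have [n [fA [n00 n01 n02] [n10 n11 n12] [n20 n21 n22]]] := simplicial_facets sA.
have [A0 A1 A2] := simplicial_gens sA.
have [N0 aN0] := across_ex hK KA fA 0; have [N1 aN1] := across_ex hK KA fA 1.
have [N2 aN2] := across_ex hK KA fA 2.
have d01 := across_neq hK KA fA (isT : (0 : 'I_3) != 1) aN0 aN1.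
have d02 := across_neq hK KA fA (isT : (0 : 'I_3) != 2) aN0 aN2.
have d12 := across_neq hK KA fA (isT : (1 : 'I_3) != 2) aN1 aN2.
have [KN0 NA0 Np0] := aN0; have [KN1 NA1 Np1] := aN1; have [KN2 NA2 Np2] := aN2.
have N01 := facet_sub_neighbour hK KA fA KN0 Np0 A1 n01.
have N02 := facet_sub_neighbour hK KA fA KN0 Np0 A2 n02.
have N10 := facet_sub_neighbour hK KA fA KN1 Np1 A0 n10.
have N12 := facet_sub_neighbour hK KA fA KN1 Np1 A2 n12.
have N20 := facet_sub_neighbour hK KA fA KN2 Np2 A0 n20.
have N21 := facet_sub_neighbour hK KA fA KN2 Np2 A1 n21.
(* the third ray of [N0] is where its facets shared with [N1] and [N2] meet *)
have [b [b0 N0b N1b N2b]] : exists b, [/\ b <> 0, N0 b, N1 b & N2 b].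
  have [k' [m [p fN]]] := cell_facets hK KN0; have k3 := no_antipodes_three KN0 fN.
  have cross Y : K Y -> Y <> N0 -> exists i, across K N0 (p i) Y.
    move=> KY YN; have [u [w [Nu Nw Yu Yw i2]]] := noanti KN0 KY YN.
    by have [i [ai _ _]] := shared_across hK KN0 fN KY YN Nu Yu Nw Yw i2; exists i.
  have [i ai] := cross A KA (nesym NA0); have [j aj] := cross N1 KN1 (nesym d01).
  have [l al] := cross N2 KN2 (nesym d02).
  have ne (i1 i2 : 'I_k') Y Y' : across K N0 (p i1) Y -> across K N0 (p i2) Y' ->
      Y <> Y' -> i1 != i2.
    move=> [KY YN Yp] [KY' YN' Yp'] YY; apply/eqP => e; apply: YY; rewrite -e in Yp'.
    exact: (neighbour_uniq hK KN0 fN KY YN Yp KY' YN' Yp').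
  have ij := ne _ _ _ _ ai aj (nesym NA1); have il := ne _ _ _ _ ai al (nesym NA2).
  have jl := ne _ _ _ _ aj al d12.
  have [b [c [d D]]] := indep3_dual (facet_indep3 fN ij il jl).
  have [_ ev] := D; have [/= ei ej el] := ev 1 0 0.
  rewrite !scale0r !addr0 scale1r in ei ej el.
  have N0b : N0 b.
    apply/(facet_in fN) => i'.
    by have [|->|->|->] := @four_indices _ i j l i' k3;
      rewrite ?ei ?ej ?el //= !inE negb_or ij il jl.
  exists b; split=> //.
  - exact: (indep3_neq0 (dual_bases_indep D)).
  - by case: aj => KY _ Yp; exact: (facet_sub_neighbour hK KN0 fN KY Yp N0b ej).
  - by case: al => KY _ Yp; exact: (facet_sub_neighbour hK KN0 fN KY Yp N0b el).
have [be0 [be1 [be2 eb]]] := indep3_coord b ind.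
have nA0 : ~ N0 a0.
  by move=> h; apply: NA0; rewrite (simplicial_subset hK KA KN0 sA h N01 N02).
have nA1 : ~ N1 a1.
  by move=> h; apply: NA1; rewrite (simplicial_subset hK KA KN1 sA N10 h N12).
have nA2 : ~ N2 a2.
  by move=> h; apply: NA2; rewrite (simplicial_subset hK KA KN2 sA N20 N21 h).
have nb : ~ A b.
  move=> Ab; apply: b0; have z := neighbour_meet hK KA fA.
  have z0 := z _ _ _ KN0 NA0 Np0 Ab N0b; have z1 := z _ _ _ KN1 NA1 Np1 Ab N1b.
  have z2 := z _ _ _ KN2 NA2 Np2 Ab N2b.
  exact: (facet_eq0 fA (isT : (0 : 'I_3) != 1) (isT : (0 : 'I_3) != 2) (isT : (1 : 'I_3) != 2) z0 z1 z2).
have v0 : dot (n 0) b = be0 by rewrite eb !dotE n00 n01 n02; ring.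
have v1 : dot (n 1) b = be1 by rewrite eb !dotE n10 n11 n12; ring.
have v2 : dot (n 2) b = be2 by rewrite eb !dotE n20 n21 n22; ring.
have g0 := neighbour_side hK KA fA KN0 NA0 Np0 N0b.
have g1 := neighbour_side hK KA fA KN1 NA1 Np1 N1b.
have g2 := neighbour_side hK KA fA KN2 NA2 Np2 N2b.
rewrite v0 in g0; rewrite v1 in g1; rewrite v2 in g2.
have neg (c0 c1 c2 : R) N (v1' v2' : E) : K N -> N b -> N v1' -> N v2' -> c1 <= 0 -> c2 <= 0 ->
    c0 <= 0 -> (c0 = 0 -> b = c1 *: v1' + c2 *: v2') -> c0 < 0.
  move=> KN Nb Nv1 Nv2 h1 h2; rewrite le_eqVlt => /orP[/eqP c00|//] /(_ c00) e.
  case: b0; apply: (tc_pointed hK KN Nb); rewrite e opprD -!scaleNr.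
  by apply: (cellD hK) => //; apply: (cellZ hK) => //; rewrite oppr_ge0.
have l0 : be0 < 0.
  by apply: (neg _ be1 be2 _ _ _ KN0 N0b N01 N02) => // z; rewrite eb z; vring.
have l1 : be1 < 0.
  by apply: (neg _ be0 be2 _ _ _ KN1 N1b N10 N12) => // z; rewrite eb z; vring.
have l2 : be2 < 0.
  by apply: (neg _ be0 be1 _ _ _ KN2 N2b N20 N21) => // z; rewrite eb z; vring.
have pos0 : 0 < - be0 by rewrite oppr_gt0.
have pos1 : 0 < - be1 by rewrite oppr_gt0.
have pos2 : 0 < - be2 by rewrite oppr_gt0.
have sA' := simplicial_scale pos0 pos1 pos2 sA; have [ind' _] := sA'.
have sc N c v : K N -> N v -> 0 < c -> N (c *: v).
  by move=> KN Nv c0; apply: (cellZ hK KN (ltW c0)).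
have nsc N c v : K N -> ~ N v -> 0 < c -> ~ N (c *: v).
  by move=> KN nN c0 /(cellZK hK KN c0).
have [_ sub0 sub1] := simplicial_gens sA'.
have A0' : A (- be0 *: a0) by exact: sc.
have N10' : N1 (- be0 *: a0) by exact: sc.
have N20' : N2 (- be0 *: a0) by exact: sc.
have N01' : N0 (- be1 *: a1) by exact: sc.
have N21' : N2 (- be1 *: a1) by exact: sc.
have N02' : N0 (- be2 *: a2) by exact: sc.
have N12' : N1 (- be2 *: a2) by exact: sc.
have nA0' : ~ N0 (- be0 *: a0) by exact: nsc.
have nA1' : ~ N1 (- be1 *: a1) by exact: nsc.
have nA2' : ~ N2 (- be2 *: a2) by exact: nsc.
have eb' : b = - (- be0 *: a0) - (- be1 *: a1) - (- be2 *: a2) by rewrite eb; vring.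
move: (- be0 *: a0) (- be1 *: a1) (- be2 *: a2) sA' ind' sub0 sub1 A0' N10' N20' N01' N21' N02'
  N12' nA0' nA1' nA2' eb'.
move=> v0' v1' v2' sA' ind' A1' A2' A0' N10' N20' N01' N21' N02' N12' nA0' nA1' nA2' eb'.
have last (x y z : E) : indep3 x y z -> indep3 y z (- x - y - z).
  move=> i3 s t u e; have [|/eqP + h1 h2] := i3 (- u) (s - u) (t - u).
    by rewrite -[RHS]e; vring.
  by rewrite oppr_eq0 => /eqP h; split; lra.
apply: (tetrahedron eb' (And4 KA KN0 KN1 KN2) sA').
- apply: (tetra_cell (v0 := v0') KN0 KN1 KN2 KA) => //; first by rewrite eb'; vring.
  by rewrite eb'; exact: last.
- apply: (tetra_cell (v0 := v1') KN1 KN0 KN2 KA) => //; first by rewrite eb'; vring.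
  rewrite (_ : b = - v1' - v0' - v2'); last by rewrite eb'; vring.
  by apply: last; exact: indep3_swap.
- apply: (tetra_cell (v0 := v2') KN2 KN0 KN1 KA) => //; first by rewrite eb'; vring.
  rewrite (_ : b = - v2' - v0' - v1'); last by rewrite eb'; vring.
  by apply: last; exact: indep3_rot (indep3_rot ind').
Qed.

End NoFourValent.

(** * Centrally symmetric fans without four-valent rays *)

Section Antipodal.
Variable R : realType.
Local Notation E := 'rV[R]_3.
Variable K : set (set E).
Hypothesis hK : tight_cells K.
Hypothesis no4 : forall A C r, K A -> K C -> C <> A -> A r -> C r -> r <> 0 ->
  ~ line_meet A C r.
Implicit Types (A B C D M N X Y Z : set E) (q r u w x y : E).

Definition antipode B : set E := [set x | B (- x)].

Hypothesis Kopp : forall B, K B -> K (antipode B).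

Lemma oppK B : antipode (antipode B) = B.
Proof. by apply/seteqP; split=> x; rewrite /antipode /= opprK. Qed.

Lemma share_wall_or_opp X Y : K X -> K Y -> Y <> X -> share_wall X Y \/ Y = antipode X.
Proof.
move=> KX KY YX.
have [[r [Xr Yr r0]]|no] := pselect (exists r, [/\ X r, Y r & r <> 0]).
  by left; exact: (share_wall_of no4 KX KY YX Xr Yr r0).
right; have [|e _] := tc_anti hK KX KY (nesym YX).
  by move=> x Xx Yx; apply: contrapT => x0; apply: no; exists x.
apply/seteqP; split=> x; rewrite /antipode /=; first by move=> Yx; apply/e; rewrite opprK.
by move=> /e; rewrite opprK.
Qed.

Lemma fresh_index k (s : seq 'I_k) : (size s < k)%N -> exists x : 'I_k, x \notin s.
Proof.
move=> sk; apply: contrapT => no; move: sk; rewrite ltnNge => /negP; apply.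
have sub : {subset enum 'I_k <= s}.
  by move=> x _; apply/negPn/negP => xs; apply: no; exists x.
by have := uniq_leq_size (enum_uniq 'I_k) sub; rewrite size_enum_ord.
Qed.

Lemma paired_swap (a b c d : E) : paired a b c d -> paired a b d c.
Proof.
by move=> [s [t [r [z [[? ? ? ?] e]]]]]; exists s, t, z, r; rewrite [RHS]addrC.
Qed.

Section Rep.
Variables (k : nat) (A : set E) (n p : 'I_k -> E).
Hypotheses (KA : K A) (fA : facets A n p).

Lemma across_inj i j N : across K A (p i) N -> across K A (p j) N -> i = j.
Proof.
move=> ai aj; apply/eqP/negPn/negP => ij.
exact: (across_neq hK KA fA ij ai aj).
Qed.

Lemma across_uniq i N N' : across K A (p i) N -> across K A (p i) N' -> N = N'.
Proof.
move=> [KN NA Np] [KN' NA' Np'].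
exact: (neighbour_uniq hK KA fA KN NA Np KN' NA' Np').
Qed.

(** The antipode of a neighbour [N] of [A] is not antipodal to [A], so that it
    shares a wall with [A]. *)
Lemma partner i N : across K A (p i) N ->
  exists j, i != j /\ across K A (p j) (antipode N).
Proof.
move=> ai; have [KN NA Np] := ai; have KO := Kopp KN.
have p0 := facet_pt_neq0 hK KA fA (i := i).
have OA : antipode N <> A.
  move=> e; apply: p0; apply: (tc_pointed hK KN Np).
  by have := facet_pt_in fA i; rewrite -e.
have [[u [w [Au Aw Ou Ow ind]]]|e] := share_wall_or_opp KA KO OA; last first.
  by case: NA; rewrite -[LHS]oppK e oppK.
have [j [aj _ _]] := shared_across hK KA fA KO OA Au Ou Aw Ow ind.
exists j; split=> //; apply/eqP => ij; rewrite -ij in aj.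
by apply: p0; apply: (tc_pointed hK KN Np); case: aj.
Qed.

(** The cell across [i] contains [p i] and [- p j], the one across [l] contains
    [p l] and [- p m]; the pairing would give these cells a common point inside
    both segments, so that [p i] would be in the second one. *)
Lemma antipodes_not_paired i j l m N M : across K A (p i) N ->
  across K A (p j) (antipode N) -> across K A (p l) M -> across K A (p m) (antipode M) ->
  i != l -> ~ paired (p i) (p m) (p l) (p j).
Proof.
move=> [KN NA Np] [_ _ Op] [KM MA Mp] [_ _ OMp] il [a [b [c [d [[a0 b0 c0 d0] e]]]]].
have Mi : M (p i).
  apply: (cell_face hK KN KM Np Op a0 (ltW d0)).
  rewrite (_ : _ + _ = c *: p l + b *: - p m).
    by apply: (cellD hK) => //; apply: (cellZ hK) => //; apply: ltW.
  apply/eqP; rewrite !scalerN subr_eq addrAC -subr_eq opprK; apply/eqP.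
  by rewrite e.
have h := neighbour_meet hK KA fA KM MA Mp (facet_pt_in fA i) Mi.
by rewrite eq_sym in il; have := facet_off fA il; rewrite h ltxx.
Qed.

(** For the other pairings the cells share walls, against [cross_contra]. *)
Lemma partners_paired i j l m N L M : uniq [:: i; j; l; m] ->
  across K A (p i) N -> across K A (p j) (antipode N) ->
  across K A (p l) L -> across K A (p m) M -> paired (p i) (p j) (p l) (p m).
Proof.
move=> dif ai aj al am.
have := dif; rewrite /= !inE !negb_or andbT.
move=> /andP[/and3P[ij il im] /andP[/andP[jl jm] lm]].
have adj a b X Y : a != b -> across K A (p a) X -> across K A (p b) Y ->
    ~ across K A (p b) (antipode X) -> share_wall X Y.
  move=> ab aX aY nO; have [KX _ _] := aX; have [KY _ _] := aY.
  have [|//|e] := share_wall_or_opp KX KY.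
    by apply/nesym; exact: (across_neq hK KA fA ab aX aY).
  by case: nO; rewrite -e.
have nO a b X : a != b -> across K A (p a) X -> ~ across K A (p b) X.
  by move=> ab aX bX; move/eqP: ab; apply; exact: (across_inj aX bX).
have ai' : across K A (p i) (antipode (antipode N)) by rewrite oppK.
have [//|pr|pr] := facets_paired fA dif; exfalso.
- apply: (cross_contra hK KA fA _ ai al aj am _ _ pr).
  + by rewrite /= !inE !negb_or il ij im (eq_sym l) jl lm jm.
  + by apply: (adj _ _ _ _ il ai al); apply: (nO _ _ _ _ aj).
  + by apply: (adj _ _ _ _ jm aj am); apply: (nO _ _ _ _ ai').
- apply: (cross_contra hK KA fA _ ai am aj al _ _ pr).
  + by rewrite /= !inE !negb_or im ij il (eq_sym m) jm (eq_sym m) lm jl.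
  + by apply: (adj _ _ _ _ im ai am); apply: (nO _ _ _ _ aj).
  + by apply: (adj _ _ _ _ jl aj al); apply: (nO _ _ _ _ ai').
Qed.

(** Let the cells across [i] and [j] be antipodal, and let [x], [l], [m] be
    three other facets, the last two with antipodal cells as well.  Then [p i]
    and [p j] are paired with any two of them, and the plane of [p i] and [p j]
    would separate the three other points pairwise. *)
Lemma antipodes_four : (k <= 4)%N.
Proof.
rewrite leqNgt; apply/negP => k5.
have k0 : (0 < k)%N := ltn_trans (isT : (0 < 4)%N) k5.
pose i := Ordinal k0; have [N aN] := across_ex hK KA fA i.
have [j [ij aO]] := partner aN.
have [l] := @fresh_index k [:: i; j] (ltn_trans (isT : (2 < 4)%N) k5).
rewrite !inE negb_or => /andP[li lj].
have [M aM] := across_ex hK KA fA l; have [m [lm aOM]] := partner aM.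
have mi : m != i.
  apply/eqP => e; move: aOM; rewrite e => aOM; have e1 := across_uniq aN aOM.
  by move: aO; rewrite e1 oppK => /(across_inj aM)/eqP; rewrite (negbTE lj).
have mj : m != j.
  apply/eqP => e; move: aOM; rewrite e => aOM; have e1 := across_uniq aO aOM.
  have e2 : N = M by rewrite -[N]oppK e1 oppK.
  by move: aN; rewrite e2 => /(across_inj aM)/eqP; rewrite (negbTE li).
have [x] := @fresh_index k [:: i; j; l; m] k5.
rewrite !inE !negb_or => /and4P[xi xj xl xm].
have [L aL] := across_ex hK KA fA x.
have [r1 [z1 [q1 [w1 [[r10 z10 q10 w10] e1]]]]] : paired (p i) (p j) (p x) (p l).
  apply: (partners_paired _ aN aO aL aM).
  by rewrite /= !inE !negb_or ij (eq_sym i) xi (eq_sym i) li (eq_sym j) xj (eq_sym j) lj xl.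
have [r2 [z2 [q2 [w2 [[r20 z20 q20 w20] e2]]]]] : paired (p i) (p j) (p x) (p m).
  apply: (partners_paired _ aN aO aL aOM).
  by rewrite /= !inE !negb_or ij (eq_sym i) xi (eq_sym i) mi (eq_sym j) xj (eq_sym j) mj xm.
have dif : uniq [:: i; j; l; m].
  by rewrite /= !inE !negb_or ij (eq_sym i) li (eq_sym i) mi (eq_sym j) lj (eq_sym j) mj lm.
have aM' : across K A (p l) (antipode (antipode M)) by rewrite oppK.
have [r3 [z3 [q3 [w3 [[r30 z30 q30 w30] e3]]]]] : paired (p i) (p j) (p l) (p m).
  have [//|pr|pr] := facets_paired fA dif; exfalso.
    have im : i != m by rewrite eq_sym.
    exact: (antipodes_not_paired aN aO aOM aM' im (paired_swap pr)).
  have il : i != l by rewrite eq_sym.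
  exact: (antipodes_not_paired aN aO aM aOM il (paired_swap pr)).
have ix : i != x by rewrite eq_sym.
have jx : j != x by rewrite eq_sym.
have [t [ti tj tx]] := indep3_functional 0 0 1 (facet_pts_indep3 fA ij ix jx).
have := congr1 (dot t) e1; have := congr1 (dot t) e2; have := congr1 (dot t) e3.
rewrite !dotDr !dotZr ti tj tx !mulr0 !addr0 mulr1 => h3 h2 h1.
have tl : dot t (p l) < 0 by nra.
have tm : dot t (p m) < 0 by nra.
by nra.
Qed.

End Rep.

End Antipodal.

Section Cube.
Variable R : realType.
Local Notation E := 'rV[R]_3.
Variable K : set (set E).
Hypothesis hK : tight_cells K.
Hypothesis no4 : forall A C r, K A -> K C -> C <> A -> A r -> C r -> r <> 0 ->
  ~ line_meet A C r.
Hypothesis Kopp : forall B, K B -> K (antipode B).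
Implicit Types (A B C D M N X Y Z : set E) (q r u w x y : E).

(** A cell of the fan of a cube: the cone over the parallelogram with vertices
    [b], [b + c], [a + c], [a], where opposite sides are shared with antipodal
    cells, [N] and its antipode on one pair of sides and [M] and its antipode
    on the other. *)
Record quad A N M (a b c : E) : Prop := Quad {
  qd_indep : indep3 a b c;
  qd_in : forall s t u : R, A (s *: a + t *: b + u *: c) <->
    [/\ 0 <= s, 0 <= t, 0 <= u & u <= s + t];
  qd_N : [/\ N b, N (b + c), N (- a) & N (- (a + c))];
  qd_M : [/\ M a, M b, M (- (a + c)) & M (- (b + c))];
  qd_cells : forall C, K C -> [\/ C = A \/ C = antipode A, C = N \/ C = antipode N |
    C = M \/ C = antipode M]
}.

(** Opposite facets are shared with antipodal cells, hence meet in the vertex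
    only.  So the four normals are paired like the facets, and scaling them in
    this relation turns the base of the cell into a parallelogram. *)
Lemma quad_ex A N k (n p : 'I_k -> E) i : K A -> facets A n p ->
  across K A (p i) N -> exists M a b c, K M /\ quad A N M a b c.
Proof.
move=> KA fA aN; have [KN NA Np] := aN.
have k4 := antipodes_four hK no4 Kopp KA fA.
have [j [ij aO]] := partner hK no4 Kopp KA fA aN.
have [l [il jl]] := facet_other hK KA fA i j.
have [M aM] := across_ex hK KA fA l; have [KM MA Mp] := aM.
have [m [lm aOM]] := partner hK no4 Kopp KA fA aM.
have im : i != m.
  apply/eqP => e; move: aOM; rewrite -e => aOM.
  have e1 := across_uniq hK KA fA aN aOM.
  by move: aO; rewrite e1 oppK => /(across_inj hK KA fA aM)/eqP; rewrite eq_sym (negbTE jl).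
have jm : j != m.
  apply/eqP => e; move: aOM; rewrite -e => aOM.
  have e1 := across_uniq hK KA fA aO aOM.
  have e2 : N = M by rewrite -[N]oppK e1 oppK.
  by move: aN; rewrite e2 => /(across_inj hK KA fA aM)/eqP; rewrite eq_sym (negbTE il).
have dif : uniq [:: i; j; l; m] by rewrite /= !inE !negb_or ij il im jl jm lm.
have all4 d : d \in [:: i; j; l; m].
  apply/negPn/negP => dn; have u : uniq (d :: [:: i; j; l; m]) by rewrite cons_uniq dn.
  have := max_card (mem (d :: [:: i; j; l; m])); rewrite (card_uniqP u) card_ord /=.
  by move=> /leq_trans/(_ k4).
have [KO OA Op] := aO; have [KOM OMA OMp] := aOM.
(* opposite facets meet in the vertex only *)
have apart x : A x -> dot (n i) x = 0 -> dot (n j) x = 0 -> x = 0.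
  move=> Ax xi xj; apply: (tc_pointed hK KN).
    exact: (facet_sub_neighbour hK KA fA KN Np Ax xi).
  exact: (facet_sub_neighbour hK KA fA KO Op Ax xj).
have [a0 [b0 [c0 D]]] := indep3_dual (facet_indep3 fA ij il jl).
have [_ ev] := D; have [/= ci cj cl] := ev 0 0 1.
rewrite !scale0r !add0r scale1r in ci cj cl.
have c00 : c0 <> 0 by move=> e; move/eqP: cl; rewrite e dot0r eq_sym oner_eq0.
have notc : ~ 0 <= dot (n m) c0.
  move=> cm; apply: c00; apply: apart => //; apply/(facet_in fA) => d.
  by have := all4 d; rewrite !inE => /or4P[] /eqP->; rewrite ?ci ?cj ?cl.
have [pr|[s [t [r [z [[s0 t0 r0 z0] e]]]]]|[s [t [r [z [[s0 t0 r0 z0] e]]]]]] :=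
  normals_paired fA dif; last 2 first.
- exfalso; apply: notc; have := congr1 (fun v => dot v c0) e.
  rewrite !dotDl !dotZl ci cj cl !mulr0 add0r add0r mulr1 => h.
  by rewrite -(pmulr_rge0 _ z0) -h ltW.
- exfalso; apply: notc; have := congr1 (fun v => dot v c0) e.
  rewrite !dotDl !dotZl ci cj cl !mulr0 !add0r mulr1 => h.
  by rewrite -(pmulr_rge0 _ t0) h ltW.
move: pr => [s [t [r [z [[s0 t0 r0 z0] e]]]]].
have ind : indep3 (s *: n i) (t *: n j) (r *: n l).
  move=> s' t' r'; rewrite !scalerA => /(facet_indep3 fA ij il jl) [].
  move=> /eqP + /eqP + /eqP; rewrite !mulf_eq0 (gt_eqF s0) (gt_eqF t0) (gt_eqF r0) !orbF.
  by move=> /eqP -> /eqP -> /eqP ->.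
have [a [b [c D']]] := indep3_dual ind; exists M, a, b, c; split=> //.
have indv := dual_bases_indep D'; have [_ ev'] := D'.
have vals (s' t' r' : R) : let x := s' *: a + t' *: b + r' *: c in
    [/\ s * dot (n i) x = s', t * dot (n j) x = t', r * dot (n l) x = r' &
        z * dot (n m) x = s' + t' - r'].
  move=> x; have [/= h1 h2 h3] := ev' s' t' r'; rewrite -/x !dotZl in h1 h2 h3.
  split=> //; have := congr1 (fun v => dot v x) e; rewrite !dotDl !dotZl; lra.
have inA (s' t' r' : R) : A (s' *: a + t' *: b + r' *: c) <->
    [/\ 0 <= s', 0 <= t', 0 <= r' & r' <= s' + t'].
  have [/= h1 h2 h3 h4] := vals s' t' r'; split=> [/(facet_in fA) h|[g1 g2 g3 g4]].
    by split; [rewrite -h1|rewrite -h2|rewrite -h3|rewrite -subr_ge0 -h4];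
      apply: mulr_ge0 => //; apply: ltW.
  apply/(facet_in fA) => d; have := all4 d; rewrite !inE => /or4P[] /eqP->.
  - by rewrite -(pmulr_rge0 _ s0) h1.
  - by rewrite -(pmulr_rge0 _ t0) h2.
  - by rewrite -(pmulr_rge0 _ r0) h3.
  - by rewrite -(pmulr_rge0 _ z0) h4 subr_ge0.
have pt (s' t' r' : R) x d N' : x = s' *: a + t' *: b + r' *: c ->
    [/\ 0 <= s', 0 <= t', 0 <= r' & r' <= s' + t'] -> across K A (p d) N' ->
    (d = i /\ s' = 0) \/ (d = j /\ t' = 0) \/ (d = l /\ r' = 0) \/
    (d = m /\ s' + t' - r' = 0) -> N' x.
  move=> ex /inA Ax [KN' NA' Np'] cs; rewrite -ex in Ax.
  apply: (facet_sub_neighbour hK KA fA KN' Np' Ax).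
  have [] := vals s' t' r'; rewrite /= -ex => h1 h2 h3 h4.
  have zero (w v : R) : 0 < w -> w * v = 0 -> v = 0.
    by move=> w0 /eqP; rewrite mulf_eq0 (gt_eqF w0) => /eqP.
  by case: cs => [[-> c1]|[[-> c1]|[[-> c1]|[-> c1]]]];
    [apply: (zero s)|apply: (zero t)|apply: (zero r)|apply: (zero z)];
    rewrite ?h1 ?h2 ?h3 ?h4.
have lev (s' t' r' : R) : 0 <= s' -> 0 <= t' -> 0 <= r' -> r' <= s' + t' ->
    [/\ 0 <= s', 0 <= t', 0 <= r' & r' <= s' + t'] by [].
split=> //.
- split.
  + by apply: (pt 0 1 0 b i N _ _ aN); [vring|apply: lev; rewrite ?(add0r, addr0) ?lexx ?ler01
      |left].
  + by apply: (pt 0 1 1 (b + c) i N _ _ aN); [vring|apply: lev; rewrite ?(add0r, addr0) ?lexx ?ler01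
      |left].
  + by apply: (pt 1 0 0 a j (antipode N) _ _ aO); [vring|apply: lev; rewrite ?(add0r, addr0) ?lexx ?ler01
      |right; left].
  + by apply: (pt 1 0 1 (a + c) j (antipode N) _ _ aO);
      [vring|apply: lev; rewrite ?(add0r, addr0) ?lexx ?ler01
      |right; left].
- split.
  + by apply: (pt 1 0 0 a l M _ _ aM); [vring|apply: lev; rewrite ?(add0r, addr0) ?lexx ?ler01
      |right; right; left].
  + by apply: (pt 0 1 0 b l M _ _ aM); [vring|apply: lev; rewrite ?(add0r, addr0) ?lexx ?ler01
      |right; right; left].
  + by apply: (pt 1 0 1 (a + c) m (antipode M) _ _ aOM);
      [vring|apply: lev; rewrite ?(add0r, addr0) ?lexx ?ler01
      |right; right; right; split=> //; ring].
  + by apply: (pt 0 1 1 (b + c) m (antipode M) _ _ aOM);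
      [vring|apply: lev; rewrite ?(add0r, addr0) ?lexx ?ler01
      |right; right; right; split=> //; ring].
move=> C KC; have [->|CA] := pselect (C = A); first by apply: Or31; left.
have [[u [w [Au Aw Cu Cw iuw]]]|->] := share_wall_or_opp hK no4 KA KC CA; last first.
  by apply: Or31; right.
have [d [aC _ _]] := shared_across hK KA fA KC CA Au Cu Aw Cw iuw.
have := all4 d; rewrite !inE => /or4P[] /eqP ed; rewrite ed in aC.
- by apply: Or32; left; exact: (across_uniq hK KA fA aC aN).
- by apply: Or32; right; exact: (across_uniq hK KA fA aC aO).
- by apply: Or33; left; exact: (across_uniq hK KA fA aC aM).
- by apply: Or33; right; exact: (across_uniq hK KA fA aC aOM).
Qed.

Lemma quad_coord A N M a b c x : quad A N M a b c -> A x ->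
  exists s t u v : R, [/\ 0 <= s, 0 <= t, 0 <= u & 0 <= v] /\
    x = s *: a + t *: b + u *: (a + c) + v *: (b + c).
Proof.
move=> [ind inA _ _ _] Ax; have [s [t [u e]]] := indep3_coord x ind.
move: Ax; rewrite e => /inA [s0 t0 u0 ust]; have [ut|ut] := leP u t.
  by exists s, (t - u), 0, u; split; [split=> //; lra|vring].
by exists (s - (u - t)), 0, (u - t), t; split; [split=> //; lra|vring].
Qed.

Lemma quad_split A N M a b c x : K A -> K N -> quad A N M a b c -> A x ->
  exists y y', [/\ A y, N y, A y', N (- y') & x = y + y'].
Proof.
move=> KA KN q Ax; have [s [t [u [v [[s0 t0 u0 v0] e]]]]] := quad_coord q Ax.
have [Nb Nbc Na Nac] := qd_N q.
exists (t *: b + v *: (b + c)), (s *: a + u *: (a + c)).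
have inA (s' t' u' v' : R) : 0 <= s' -> 0 <= t' -> 0 <= u' -> 0 <= v' ->
    A (s' *: a + t' *: b + u' *: (a + c) + v' *: (b + c)).
  move=> *; rewrite (_ : _ + _ = (s' + u') *: a + (t' + v') *: b + (u' + v') *: c).
    by apply/(qd_in q); split; lra.
  by vring.
split.
- by have := inA 0 t 0 v; rewrite !scale0r add0r addr0; apply.
- by apply: (cellD hK) => //; apply: (cellZ hK).
- by have := inA s 0 u 0; rewrite !scale0r !addr0; apply.
- by rewrite opprD -!scalerN; apply: (cellD hK) => //; apply: (cellZ hK).
- by rewrite e; vring.
Qed.

Lemma supports_opp S C (l : E) : (forall s, s \in S -> - s \in S) ->
  supports S C l -> supports S (antipode C) (- l).
Proof.
move=> Sopp [h1 h2 h3]; split=> [s sS|s sS|x].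
- by rewrite dotNl -dotNr; apply/h1/Sopp.
- by rewrite dotNl -dotNr => e; apply: h2 => //; exact: Sopp.
move=> /h3 h; rewrite -[x]opprK; elim: h => [|a s y a0 [sS ls] _ IH].
  by rewrite oppr0; exact: pos_span0.
rewrite opprD -scalerN; apply: pos_span_cons => //; split; first exact: Sopp.
by rewrite dotNl dotNr opprK.
Qed.

(** A cell [N] that, like [A], is spanned by two opposite facets shared with
    [A] and its antipode is spanned by the vertices on these facets. *)
Lemma opposite_span A N (V W : E -> Prop) x : K A -> K N ->
  (forall y, A y -> exists v w, [/\ pos_span V v, pos_span W w & y = v + w]) ->
  (forall v, V v -> A v /\ N v) -> (forall w, W w -> A w /\ N (- w)) ->
  (exists y y', [/\ N y, A y, N y', A (- y') & x = y + y']) ->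
  pos_span (fun v => V v \/ W (- v)) x.
Proof.
move=> KA KN dec VN WN [y [y' [Ny Ay Ny' Ay' ->]]].
have inV v : pos_span V v -> A v /\ N v.
  elim=> [|a s z a0 /VN [As Ns] _ [Az Nz]]; first by split; [exact: (cell0 hK KA)|exact: (cell0 hK KN)].
  by split; apply: (cellD hK) => //; apply: (cellZ hK).
have inW w : pos_span W w -> A w /\ N (- w).
  elim=> [|a s z a0 /WN [As Ns] _ [Az Nz]].
    by rewrite oppr0; split; [exact: (cell0 hK KA)|exact: (cell0 hK KN)].
  by rewrite opprD -scalerN; split; apply: (cellD hK) => //; apply: (cellZ hK).
apply: pos_spanD.
  have [v [w [pv pw e]]] := dec _ Ay; have [Av Nv] := inV _ pv; have [Aw Nw] := inW _ pw.
  have w0 : w = 0.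
    by apply: (tc_pointed hK KN _ Nw); apply: (tc_face hK KA KN Aw Av); rewrite addrC -e.
  rewrite e w0 addr0; elim: pv => [|a s z a0 Vs _ IH]; first exact: pos_span0.
  by apply: pos_span_cons => //; left.
have [v [w [pv pw e]]] := dec _ Ay'; have [Av Nv] := inV _ pv; have [Aw Nw] := inW _ pw.
have v0 : v = 0.
  apply: (tc_pointed hK KN Nv); apply: (tc_face hK KA (Kopp KN) Av Aw).
  by rewrite /antipode /= -e opprK.
rewrite -[y']opprK e v0 add0r; elim: pw => [|a s z a0 Ws _ IH].
  by rewrite oppr0; exact: pos_span0.
by rewrite opprD -scalerN; apply: pos_span_cons => //; right; rewrite opprK.
Qed.

Lemma pos_span_sub (P Q : E -> Prop) x : (forall s, P s -> Q s) ->
  pos_span P x -> pos_span Q x.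
Proof.
move=> PQ; elim=> [|a s y a0 /PQ Qs _ IH]; first exact: pos_span0.
exact: pos_span_cons.
Qed.

(** [quad_split] applied to the cell [N], of which [A] is a neighbour. *)
Lemma neighbour_split A N x : K A -> K N -> N <> A -> N <> antipode A ->
  N x -> exists y y', [/\ N y, A y, N y', A (- y') & x = y + y'].
Proof.
move=> KA KN NA NOA Nx; have [k [n [p fN]]] := cell_facets hK KN.
have [[v [w [Nv Nw Av Aw iv]]]|e] := share_wall_or_opp hK no4 KN KA (nesym NA); last first.
  by case: NOA; rewrite e oppK.
have [i [aA _ _]] := shared_across hK KN fN KA (nesym NA) Nv Av Nw Aw iv.
have [M [a [b [c [_ q]]]]] := quad_ex KN fN aA.
have [y [y' [Ny Ay Ny' Ay' e]]] := quad_split KN KA q Nx.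
by exists y, y'.
Qed.

Lemma neighbour_span A N (y1 y2 z1 z2 : E) x : K A -> K N -> N <> A ->
  N <> antipode A -> [/\ A y1, A y2, A z1 & A z2] ->
  [/\ N y1, N y2, N (- z1) & N (- z2)] ->
  (forall y, A y -> exists s t u v : R, [/\ 0 <= s, 0 <= t, 0 <= u & 0 <= v] /\
    y = s *: y1 + t *: y2 + (u *: z1 + v *: z2)) ->
  N x -> pos_span (fun s => s \in [:: y1; y2; - z1; - z2]) x.
Proof.
move=> KA KN NA NOA [A1 A2 A3 A4] [N1 N2 N3 N4] dec Nx.
apply: (pos_span_sub _ (@opposite_span A N (fun v => v = y1 \/ v = y2)
  (fun v => v = z1 \/ v = z2) x KA KN _ _ _ _)).
- by move=> s [[]->|[]/(canRL opprK)->]; rewrite !inE eqxx ?orbT.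
- move=> y /dec [s [t [u [v [[s0 t0 u0 v0] ->]]]]].
  exists (s *: y1 + t *: y2), (u *: z1 + v *: z2); split=> //;
    by apply: pos_spanD; apply: pos_spanZ => //; [left|right].
- by move=> v [->|->].
- by move=> v [->|->].
- exact: neighbour_split.
Qed.

(** The vertices of the parallelogram [A] and their opposites are the eight
    vertices of a parallelepiped. *)
Lemma antipodes_polytopal : polytopal K.
Proof.
have [A KA _] := tc_cover hK 0; have [k [n [p fA]]] := cell_facets hK KA.
have k0 : (0 < k)%N := leq_trans (isT : (0 < 3)%N) (facets_ge3 hK KA fA).
have [N aN] := across_ex hK KA fA (Ordinal k0); have [KN NA Np] := aN.
have [M [a [b [c [KM q]]]]] := quad_ex KA fA aN.
have [ind inA [Nb Nbc Na Nac] [Ma Mb Mac Mbc] cells] := q.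
have Aa : A a by rewrite (_ : a = 1 *: a + 0 *: b + 0 *: c); [apply/inA; split; lra|vring].
have Ab : A b by rewrite (_ : b = 0 *: a + 1 *: b + 0 *: c); [apply/inA; split; lra|vring].
have Aac : A (a + c).
  by rewrite (_ : a + c = 1 *: a + 0 *: b + 1 *: c); [apply/inA; split; lra|vring].
have Abc : A (b + c).
  by rewrite (_ : b + c = 0 *: a + 1 *: b + 1 *: c); [apply/inA; split; lra|vring].
have a0 := indep3_neq0 ind; have b0 := indep3_neq0 (indep3_rot ind).
have NOA : N <> antipode A.
  by move=> e; apply: b0; apply: (tc_pointed hK KA Ab); move: Nb; rewrite e.
have MA : M <> A.
  move=> e; rewrite e in Mac; have c10 : a + c = 0 by exact: (tc_pointed hK KA Aac Mac).
  have [|/eqP] := ind 1 0 1; last by rewrite oner_eq0.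
  by rewrite -c10; vring.
have MOA : M <> antipode A.
  by move=> e; apply: b0; apply: (tc_pointed hK KA Ab); move: Mb; rewrite e.
set S := [:: a; b; a + c; b + c; - a; - b; - (a + c); - (b + c)]; exists S.
have Sopp s : s \in S -> - s \in S.
  by rewrite !inE; repeat case/orP; move=> /eqP->; rewrite ?opprK eqxx ?orbT.
have val (s t u : R) : exists l, [/\ dot l a = s, dot l b = t, dot l (a + c) = s + u &
     dot l (b + c) = t + u] /\ [/\ dot l (- a) = - s, dot l (- b) = - t,
     dot l (- (a + c)) = - (s + u) & dot l (- (b + c)) = - (t + u)].
  have [l [la lb lc]] := indep3_functional s t u ind; exists l.
  by rewrite !dotNr !dotDr la lb lc.
have hA : exists l, supports S A l.
  have [l [[v1 v2 v3 v4] [v5 v6 v7 v8]]] := val 1 1 0; exists l; split.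
  - by move=> s; rewrite !inE; repeat case/orP; move/eqP=> ->; lra.
  - by move=> s; rewrite !inE; repeat case/orP; move/eqP=> -> //; lra.
  move=> x Ax; have [s [t [u [v [[s0 t0 u0 v0] ->]]]]] := quad_coord q Ax.
  by do 3?apply: pos_spanD; apply: pos_spanZ => //; split; rewrite ?inE ?eqxx ?orbT //; lra.
have hN : exists l, supports S N l.
  have [l [[v1 v2 v3 v4] [v5 v6 v7 v8]]] := val (-1) 1 0; exists l; split.
  - by move=> s; rewrite !inE; repeat case/orP; move/eqP=> ->; lra.
  - by move=> s; rewrite !inE; repeat case/orP; move/eqP=> -> //; lra.
  move=> x Nx; apply: (pos_span_sub _ (neighbour_span (y1 := b) (y2 := b + c)
    (z1 := a) (z2 := a + c) KA KN NA NOA _ _ _ Nx)) => //.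
    by move=> s; rewrite !inE => /or4P[] /eqP->; (split; [rewrite ?inE eqxx ?orbT|lra]).
  move=> y /(quad_coord q) [s [t [u [v [[s0 t0 u0 v0] ->]]]]].
  by exists t, v, s, u; split=> //; vring.
have hM : exists l, supports S M l.
  have [l [[v1 v2 v3 v4] [v5 v6 v7 v8]]] := val 1 1 (-2); exists l; split.
  - by move=> s; rewrite !inE; repeat case/orP; move/eqP=> ->; lra.
  - by move=> s; rewrite !inE; repeat case/orP; move/eqP=> -> //; lra.
  move=> x Mx; apply: (pos_span_sub _ (neighbour_span (y1 := a) (y2 := b)
    (z1 := a + c) (z2 := b + c) KA KM MA MOA _ _ _ Mx)) => //.
    by move=> s; rewrite !inE => /or4P[] /eqP->; (split; [rewrite ?inE eqxx ?orbT|lra]).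
  move=> y /(quad_coord q) [s [t [u [v [h ->]]]]].
  by exists s, t, u, v; split=> //; rewrite !addrA.
have sop C : (exists l, supports S C l) -> exists l, supports S (antipode C) l.
  by move=> [l h]; exists (- l); exact: supports_opp.
move=> C /cells [] [] ->; by [exact: hA|exact: sop|exact: hN|exact: hM] || exact: sop.
Qed.

End Cube.

(** * The classification *)

Section Classification.
Variable R : realType.
Local Notation E := 'rV[R]_3.
Variable K : set (set E).

Lemma tight_cells_polytopal : tight_cells K -> polytopal K.
Proof.
move=> hK.
have [[A [C [r [[KA KC CA] [Ar Cr r0] line]]]]|no] := pselect (exists A C r,
    [/\ [/\ K A, K C & C <> A], [/\ A r, C r & r <> 0] & line_meet A C r]).
  exact: (four_valent_polytopal hK KA KC CA Ar Cr r0 line).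
have no4 A C r : K A -> K C -> C <> A -> A r -> C r -> r <> 0 -> ~ line_meet A C r.
  by move=> KA KC CA Ar Cr r0 line; apply: no; exists A, C, r.
have [walls|nw] := pselect (forall X Y, K X -> K Y -> Y <> X -> share_wall X Y).
  exact: (no_antipodes_polytopal hK walls).
apply: (antipodes_polytopal hK no4) => B KB.
have [X [Y [[KX KY YX] nXY]]] : exists X Y, [/\ K X, K Y & Y <> X] /\ ~ share_wall X Y.
  apply: contrapT => no'; apply: nw => X Y KX KY YX; apply: contrapT => nXY.
  by apply: no'; exists X, Y.
have [|_ op] := tc_anti hK KX KY (nesym YX); last exact: op KB.
move=> r Xr Yr; apply: contrapT => r0; apply: nXY.
exact: (share_wall_of no4 KX KY YX Xr Yr r0).
Qed.

End Classification.

(** * The cells of a tight fan *)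

Section Fan.
Variable R : realType.
Local Notation E := 'rV[R]_3.
Variables (F : set (set E)) (v : E).
Hypotheses (hF : tight_fan F) (mv : minimal_cone F [set v]).
Implicit Types (C D f : set E) (p u w x y : E).

Definition dirs C : set E := [set x | C (v + x)].

Definition cells : set (set E) :=
  [set D | exists C, [/\ F C, has_dim C 3 & D = dirs C]].

Lemma vertex_in C : F C -> C v.
Proof. by move=> FC; apply: (proj2 mv) FC _ _. Qed.

(** The vertex is a face of every cone, hence exposed by a linear form. *)
Lemma vertex_face C : F C ->
  exists u, forall x, C x -> dot u x <= dot u v /\ (dot u x = dot u v -> x = v).
Proof.
move=> FC; have [_ _ [u [b [ub e]]]] := fan_meet (tight_is_fan hF) (proj1 mv) FC.
have ev : ([set v] `&` C) v by split=> //; exact: vertex_in.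
have uv : dot u v = b by move: ev; rewrite e => -[].
exists u => x Cx; rewrite uv; split; first exact: ub.
by move=> ux; have [->] : ([set v] `&` C) x by rewrite e.
Qed.

(** The apex [p] of a representation of [C] is the vertex: the form that exposes
    [v] is maximal on [C] at [v = p + z] only, and [C] contains [p] and
    [p + 2 z]. *)
Lemma dirs_gcone C : F C -> exists k (w : 'I_k -> E), dirs C = gcone w.
Proof.
move=> FC; have [p [k [w Cw]]] := fan_cone (tight_is_fan hF) FC.
have [u uv] := vertex_face FC.
have := vertex_in FC; rewrite {1}Cw => -[a [a0 ev]]; set z := \sum_i _ in ev.
have Cp : C p.
  rewrite Cw; exists (fun=> 0); split=> //; rewrite big1 ?addr0 // => i _.
  by rewrite scale0r.
have Cpz : C (p + (z + z)).
  rewrite Cw; exists (fun i => a i + a i); split=> [i|]; first by rewrite addr_ge0.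
  by congr (_ + _); rewrite /z -big_split; apply: eq_bigr => i _; rewrite scalerDl.
have [h1 h2] := uv _ Cp; have [h3 _] := uv _ Cpz.
have pv : p = v.
  by apply: h2; move: h1 h3; rewrite ev !dotDr; lra.
exists k, w; apply/seteqP; split=> x.
  rewrite /dirs /= Cw pv => -[c [c0 /addrI e]]; by exists c.
by move=> [c [c0 e]]; rewrite /dirs /= Cw pv; exists c; rewrite e.
Qed.

Lemma dirs_hcone C : F C -> exists s, dirs C = hcone s.
Proof.
by move=> /dirs_gcone [k [w ->]]; have [s es] := gcone_hcone w; exists s.
Qed.

Lemma dirsD C x y : F C -> dirs C x -> dirs C y -> dirs C (x + y).
Proof.
move=> /dirs_hcone [s ->] Cx Cy n ns; rewrite dotDr addr_ge0 ?Cx ?Cy //.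
Qed.

Lemma dirsZ C a x : F C -> 0 <= a -> dirs C x -> dirs C (a *: x).
Proof.
by move=> /dirs_hcone [s ->] a0 Cx n ns; rewrite dotZr mulr_ge0 ?Cx.
Qed.

Lemma dirsZE C a x : F C -> 0 < a -> dirs C (a *: x) <-> dirs C x.
Proof.
move=> FC a0; split; last by apply: dirsZ => //; apply: ltW.
move=> h; rewrite -[x](scalerK (lt0r_neq0 a0)).
by apply: dirsZ => //; rewrite invr_ge0 ltW.
Qed.

Lemma dirs_pointed C x : F C -> dirs C x -> dirs C (- x) -> x = 0.
Proof.
move=> FC; have [u uv] := vertex_face FC => Cx Cnx.
have [h1 h2] := uv _ Cx; have [h3 _] := uv _ Cnx.
rewrite !dotDr dotNr in h1 h2 h3; apply: (addrI v); rewrite addr0; apply: h2; lra.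
Qed.

Lemma dirs_face C D x y : F C -> F D -> dirs C x -> dirs C y -> dirs D (x + y) ->
  dirs D x.
Proof.
move=> FC FD Cx Cy Dxy.
have [_ [u [b [ub e]]] _] := fan_meet (tight_is_fan hF) FC FD.
have uv : dot u v = b.
  have : (C `&` D) v by split; exact: vertex_in.
  by rewrite e => -[].
have : (C `&` D) (v + (x + y)) by split=> //; exact: dirsD.
rewrite e => -[_ /= exy]; have h1 := ub _ Cx; have h2 := ub _ Cy.
have : (C `&` D) (v + x); last by case.
by rewrite e; split=> //=; move: exy h1 h2; rewrite !dotDr uv; lra.
Qed.

Lemma full_space A : has_dim A 3 -> forall x, affine_hull A x.
Proof.
move=> [p [U [dU ->]]] x /=; suff -> : U = fullv by rewrite memvf.
apply/eqP; rewrite eqEdim subvf dU dimvf /= dim_matrix.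
by [].
Qed.

(** If no half-space of the description of the cone is a plane for it, the sum
    of points strictly inside each of them is an interior point. *)
Lemma core_or_flat C : F C -> (exists q, core (dirs C) q) \/
  exists2 n, n <> 0 & forall w, dirs C w -> dot n w = 0.
Proof.
move=> FC; have [flat|nf] := pselect (exists2 n, n <> 0 & forall w, dirs C w -> dot n w = 0).
  by right.
left; have [s es] := dirs_hcone FC.
have pos n : n \in s -> n <> 0 -> exists2 w, dirs C w & 0 < dot n w.
  move=> ns n0; apply: contrapT => no; apply: nf; exists n => // w Cw.
  apply/eqP; rewrite eq_le; apply/andP; split; last by move: Cw; rewrite es; apply.
  by rewrite leNgt; apply/negP => nw; apply: no; exists w.
have [q [Cq qs]] : exists q, dirs C q /\ forall n, n \in s -> n <> 0 -> 0 < dot n q.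
  have : {subset s <= s} by [].
  elim: {1 3}s => [|n t IH] sub.
    by exists 0; split=> //; rewrite es => n _; rewrite dot0r.
  have [m mt|q [Cq qt]] := IH; first by apply: sub; rewrite inE mt orbT.
  have [n0|n0] := pselect (n = 0).
    by exists q; split=> // m; rewrite inE => /orP[/eqP->|]; [|exact: qt].
  have [w Cw nw] := pos n (sub _ (mem_head _ _)) n0.
  have ge x m : dirs C x -> m \in n :: t -> 0 <= dot m x.
    by rewrite es => Cx /sub; exact: Cx.
  exists (q + w); split; first exact: dirsD.
  move=> m mnt m0; rewrite dotDr.
  have h1 := ge _ _ Cq mnt; have h2 := ge _ _ Cw mnt.
  move: mnt; rewrite inE => /orP[/eqP e|mt]; first by rewrite e in h1 *; lra.
  by have := qt m mt m0; lra.
exists q => x; apply: small_ex; rewrite es.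
apply: (@small_seq _ _ s (fun n e => 0 <= dot n (q + e *: x))) => n ns.
have [n0|n0] := pselect (n = 0).
  by apply: small_always => e _; rewrite n0 dot0l.
apply: small_imp (small_affine_gt (dot n x) (qs n ns n0)) => e _ h.
by rewrite dotDr dotZr ltW.
Qed.

Lemma core_has_dim A q : core (dirs A) q -> has_dim A 3.
Proof.
move=> cq; exists 0, fullv; split; first by rewrite dimvf /= dim_matrix.
apply/seteqP; split=> x _ /=; first exact: memvf.
have [e e0 Ae] := cq (x - (v + q)).
exists 2, (fun i : 'I_2 => [:: 1 - e^-1; e^-1]`_i),
  (fun i : 'I_2 => [:: v + q; v + (q + e *: (x - (v + q)))]`_i); split.
- case=> -[|[|//]] ? //=; exact: core_cell cq.
- by rewrite !big_ord_recl big_ord0 /= addr0 subrK.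
- rewrite !big_ord_recl big_ord0 /= addr0.
  by vfield; rewrite gt_eqF.
Qed.

Lemma core_dim C : F C -> has_dim C 3 <-> exists q, core (dirs C) q.
Proof.
move=> FC; split=> [dC|[q cq]].
  have [//|[n n0 flat]] := core_or_flat FC; case: n0; apply: dot_eq0.
  have [k [a [y [Cy a1 e]]]] := full_space dC (v + n).
  have : dot n (v + n) = dot n v.
    rewrite e dot_sumr -[RHS]mul1r -a1 mulr_suml; apply: eq_bigr => i _.
    rewrite dotZr; congr (_ * _); apply/eqP; rewrite -subr_eq0 -dotBr; apply/eqP.
    by apply: flat; rewrite /dirs /= addrC subrK.
  by rewrite dotDr; lra.
exact: core_has_dim cq.
Qed.

Lemma avoid_planes (L : seq E) : (forall n, n \in L -> n <> 0) ->
  exists w, forall n, n \in L -> dot n w != 0.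
Proof.
elim: L => [|n L IH] L0; first by exists 0.
have [m mL|w wL] := IH; first by apply: L0; rewrite inE mL orbT.
have [nw|nw] := eqVneq (dot n w) 0; last first.
  by exists w => m; rewrite inE => /orP[/eqP->|/wL].
have : small (fun e => forall m, m \in L -> dot m (w + e *: n) != 0).
  apply: small_seq => m mL; have := wL _ mL; rewrite neq_lt => /orP[] h.
    rewrite -oppr_gt0 in h; apply: small_imp (small_affine_gt (- dot m n) h) => e _ h'.
    by rewrite dotDr dotZr lt_eqF // -oppr_gt0 opprD -mulrN.
  apply: small_imp (small_affine_gt (dot m n) h) => e _ h'.
  by rewrite dotDr dotZr gt_eqF.
move=> /small_ex [e e0 ok]; exists (w + e *: n) => m; rewrite inE => /orP[/eqP->|/ok //].
rewrite dotDr dotZr nw add0r mulf_neq0 ?gt_eqF //.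
by apply: dot_gt0; apply: L0; rewrite mem_head.
Qed.

(** The full-dimensional cones already cover the space: a generic segment
    issued from any point leaves the planes of the other cones at once. *)
Lemma cells_cover x : exists2 D, cells D & D x.
Proof.
have [s Fs] := (finite_seqP _).1 (fan_finite (tight_is_fan hF)).
have [L L0 Lflat] : exists2 L : seq E, (forall n, n \in L -> n <> 0) &
    forall C, F C -> ~ (exists q, core (dirs C) q) ->
    exists2 n, n \in L & forall w, dirs C w -> dot n w = 0.
  have : forall C, C \in s -> F C by move=> C Cs; rewrite Fs.
  suff : forall t : seq (set E), (forall C, C \in t -> F C) ->
      exists2 L : seq E, (forall n, n \in L -> n <> 0) &
      forall C, C \in t -> ~ (exists q, core (dirs C) q) ->
      exists2 n, n \in L & forall w, dirs C w -> dot n w = 0.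
    move=> /[apply] -[L L0 h]; exists L => // C FC; apply: h.
    by move: FC; rewrite Fs.
  elim=> [|C t IH] tF; first by exists [::].
  have [D Dt|L L0 h] := IH; first by apply: tF; rewrite inE Dt orbT.
  have [core|[n n0 flat]] := core_or_flat (tF C (mem_head _ _)).
    by exists L => // D; rewrite inE => /orP[/eqP-> //|]; exact: h.
  exists (n :: L) => [m|D]; first by rewrite inE => /orP[/eqP->|/L0].
  rewrite inE => /orP[/eqP-> _|Dt nD]; first by exists n; rewrite ?mem_head.
  by have [m mL fm] := h D Dt nD; exists m; rewrite // inE mL orbT.
have [w wL] := avoid_planes L0.
have cov y : exists2 C, F C & C y.
  by have : setT y by []; rewrite -(tight_complete hF) => -[C FC Cy]; exists C.
have [C FC oC] := often_cover (P := fun C e => dirs C (x + e *: w))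
  (fan_finite (tight_is_fan hF)) (small_often (small_always (fun e _ => cov _))).
have [q cq] : exists q, core (dirs C) q.
  apply: contrapT => nc; have [n nL flat] := Lflat C FC nc.
  have [e1 [e10 _ /flat h1]] := oC 1 ltr01.
  have [|e2 [e20 e21 /flat h2]] := oC (e1 / 2); first by rewrite divr_gt0.
  move: h1 h2; rewrite !dotDr !dotZr => h1 h2.
  have /eqP : (e1 - e2) * dot n w = 0 by lra.
  rewrite mulf_eq0 (negbTE (wL _ nL)) orbF => /eqP; lra.
exists (dirs C); first by exists C; split=> //; apply/core_dim => //; exists q.
have [s' es] := dirs_hcone FC; rewrite es => n ns.
apply: (@often_affine _ _ (dot n w)) => e0 e00.
have [e [h1 h2 Ce]] := oC e0 e00; exists e; split=> //.
by move: Ce; rewrite es => /(_ n ns); rewrite dotDr dotZr.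
Qed.

Lemma small_eball p (r : R) x : 0 < r -> small (fun e => eball p r (p + e *: x)).
Proof.
move=> r0; apply: small_imp (small_affine_gt (- Num.sqrt (dot x x)) r0) => e e0.
rewrite /eball /= (_ : p + e *: x - p = e *: x); last by vring.
rewrite dotZr dotZl mulrA -expr2 sqrtrM ?sqr_ge0 // sqrtr_sqr gtr0_norm //; lra.
Qed.

(** Every vector, scaled down, is in the ball of the local symmetry. *)
Lemma reflection_local C D p (r : R) x : 0 < r ->
  reflection p @` (C `&` eball p r) = D `&` eball p r ->
  small (fun e => C (p + e *: x) <-> D (p - e *: x)).
Proof.
move=> r0 eCD; have := small_and (small_eball p x r0) (small_eball p (- x) r0).
apply: small_imp => e _ [b1 b2]; rewrite scalerN in b2.
have refl : reflection p (p + e *: x) = p - e *: x.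
  by rewrite /reflection (scalerDl p 1 1); vring.
split=> [Cx|Dx].
  have : (reflection p @` (C `&` eball p r)) (p - e *: x) by exists (p + e *: x).
  by rewrite eCD => -[].
have : (D `&` eball p r) (p - e *: x) by [].
rewrite -eCD => -[y [Cy _] ey].
suff -> : p + e *: x = y by [].
by move: ey; rewrite -refl /reflection => /addrI/oppr_inj.
Qed.

Lemma scale_small (P : R -> Prop) t : 0 < t -> small (fun e => P (t * e)) -> small P.
Proof.
move=> t0 [a a0 h]; exists (t * a); first exact: mulr_gt0.
move=> e e0 ea; rewrite -[e](divfK (lt0r_neq0 t0)) mulrC; apply: h.
  exact: divr_gt0.
by rewrite ler_pdivrMr // mulrC.
Qed.

(** The centre of the local symmetry is in the relative interior of the ray,
    hence a positive multiple of [r] from the vertex, and scaling moves it to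
    [r]. *)
Lemma cells_ray C D r : F C -> F D -> has_dim C 3 -> has_dim D 3 -> C <> D ->
  r <> 0 -> dirs C r -> dirs D r ->
  (forall x, dirs C x -> dirs D x -> exists t, x = t *: r) ->
  forall x, small (fun e => dirs C (r + e *: x) <-> dirs D (r - e *: x)).
Proof.
move=> FC FD dC dD CD r0 Cr Dr line x.
have [_ [p [rho [[pCD [rho' [rho'0 rel]]] rho0 sym]]]] := tight_meet hF FC FD dC dD CD.
have [t pt] : exists t, p - v = t *: r.
  by apply: line; rewrite /dirs /= addrC subrK; case: pCD.
have {pt} pt : p = v + t *: r by rewrite -pt addrC subrK.
have Ct : dirs C (t *: r) by rewrite /dirs /= -pt; case: pCD.
have t0 : 0 <= t.
  rewrite leNgt; apply/negP => t0; apply: r0; apply: (dirs_pointed FC Cr).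
  have h : 0 < - t by rewrite oppr_gt0.
  by apply/(dirsZE _ FC h); rewrite scalerN scaleNr opprK.
(* the ray is no neighbourhood of its end in its own line *)
have {t0} t0 : 0 < t.
  rewrite lt0r t0 andbT; apply/eqP => t00; apply: r0; rewrite t00 scale0r addr0 in pt.
  have [e e0 be] := small_ex (small_eball p (- r) rho'0).
  have [Ce _] : (C `&` D) (p + e *: - r).
    apply: rel; split=> //; exists 2, (fun i : 'I_2 => [:: 1 + e; - e]`_i),
      (fun i : 'I_2 => [:: v; v + r]`_i); split.
    - by case=> -[|[|//]] ? //=; split=> //; exact: vertex_in.
    - by rewrite !big_ord_recl big_ord0 /= addr0 addrK.
    - by rewrite !big_ord_recl big_ord0 /= addr0 pt; vring.
  by apply: (dirs_pointed FC Cr); apply/(dirsZE _ FC e0); rewrite /dirs /= -pt.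
have tinv : 0 < t^-1 by rewrite invr_gt0.
apply: (scale_small tinv); apply: small_imp (reflection_local x rho0 sym) => e e0.
rewrite pt -!addrA => h.
have eq1 : t *: r + e *: x = t *: (r + (t^-1 * e) *: x) by vfield; rewrite gt_eqF.
have eq2 : t *: r - e *: x = t *: (r - (t^-1 * e) *: x) by vfield; rewrite gt_eqF.
by rewrite -(dirsZE (r + _) FC t0) -(dirsZE (r - _) FD t0) -eq1 -eq2.
Qed.

Lemma small_dirs C D : F C -> F D ->
  (forall x, small (fun e => C (v + e *: x) <-> D (v - e *: x))) ->
  forall x, dirs C x <-> dirs D (- x).
Proof.
move=> FC FD h x; have [e e0] := small_ex (h x).
rewrite -(dirsZE x FC e0) -(dirsZE (- x) FD e0) scalerN; exact.
Qed.

(** The vertex is the only possible centre, and local symmetry about the vertex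
    is global for cones. *)
Lemma cells_anti C D : F C -> F D -> has_dim C 3 -> has_dim D 3 -> C <> D ->
  (forall x, dirs C x -> dirs D x -> x = 0) ->
  (forall x, dirs C x <-> dirs D (- x)) /\
  forall B, cells B -> cells [set x | B (- x)].
Proof.
move=> FC FD dC dD CD zero.
have [[Fm [p' [rho' [[p'CD _] rho'0 fam]]]] [p [rho [[pCD _] rho0 sym]]]] :=
  tight_meet hF FC FD dC dD CD.
have isv q : (C `&` D) q -> q = v.
  move=> [Cq Dq]; apply/eqP; rewrite -subr_eq0; apply/eqP; apply: zero;
    by rewrite /dirs /= addrC subrK.
have ep := isv _ pCD; have ep' := isv _ p'CD; rewrite ep in sym; rewrite ep' in fam.
split; first by apply: small_dirs => // x; exact: (reflection_local x rho0 sym).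
move=> _ [B [FB dB ->]].
have : fan_inside F (eball v rho') (reflection v @` (B `&` eball v rho')).
  by rewrite -fam; exists (B `&` eball v rho') => //; exists B.
move=> [B' FB' eB].
have sym' : reflection v @` (B `&` eball v rho') = B' `&` eball v rho' by rewrite eB.
have hB : forall x, dirs B x <-> dirs B' (- x).
  by apply: small_dirs => // x; exact: (reflection_local x rho'0 sym').
have e : [set x | dirs B (- x)] = dirs B'.
  by apply/seteqP; split=> x /=; [move=> /hB; rewrite opprK|move=> h; apply/hB; rewrite opprK].
rewrite e; exists B'; split=> //; apply/core_dim => //.
have [q cq] := (core_dim FB).1 dB; exists (- q) => x.
have [d d0 h] := cq (- x); exists d => //.
by rewrite -e /= opprD opprK -scalerN.
Qed.

Lemma tight_fan_cells : tight_cells cells.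
Proof.
split.
- apply: (@sub_finite_set _ _ [set dirs C | C in F]); last first.
    by apply: finite_image; exact: fan_finite (tight_is_fan hF).
  by move=> D [C [FC _ ->]]; exists C.
- by move=> D [C [FC _ ->]]; exact: dirs_hcone.
- by move=> D [C [FC dC ->]]; apply/core_dim.
- by move=> D x [C [FC _ ->]]; exact: dirs_pointed.
- exact: cells_cover.
- by move=> D D' x y [C [FC _ ->]] [C' [FC' _ ->]]; exact: dirs_face.
- move=> D D' r [C [FC dC ->]] [C' [FC' dC' ->]] CC'; apply: cells_ray => //.
  by move=> e; apply: CC'; rewrite e.
- move=> D D' [C [FC dC ->]] [C' [FC' dC' ->]] CC'; apply: cells_anti => //.
  by move=> e; apply: CC'; rewrite e.
Qed.

End Fan.

(** * The polytope *)

Section Weighted.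
Variable R : realType.
Local Notation E := 'rV[R]_3.
Implicit Types (P Q : E -> Prop) (s u x y : E).

(** The convex hull of [P] scaled by [t]: nonnegative combinations of total
    weight [t]. *)
Inductive wspan P : R -> E -> Prop :=
| wspan0 : wspan P 0 0
| wspan_cons a s t y : 0 <= a -> P s -> wspan P t y -> wspan P (a + t) (a *: s + y).

Lemma wspanD P t x t' y : wspan P t x -> wspan P t' y -> wspan P (t + t') (x + y).
Proof.
move=> px py; elim: px => [|a s b z a0 Ps _ IH]; first by rewrite !add0r.
by rewrite -!addrA; exact: wspan_cons.
Qed.

Lemma wspanZ P c t x : 0 <= c -> wspan P t x -> wspan P (c * t) (c *: x).
Proof.
move=> c0; elim=> [|a s b z a0 Ps _ IH]; first by rewrite mulr0 scaler0; exact: wspan0.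
by rewrite mulrDr scalerDr scalerA; apply: wspan_cons => //; apply: mulr_ge0.
Qed.

Lemma wspan1 P s : P s -> wspan P 1 s.
Proof.
move=> Ps; have := wspan_cons ler01 Ps (wspan0 P).
by rewrite scale1r !addr0.
Qed.

Lemma wspan_ge0 P t x : wspan P t x -> 0 <= t /\ (t = 0 -> x = 0).
Proof.
elim=> [|a s b z a0 Ps _ [b0 IH]]; first by [].
split=> [|ab]; first exact: addr_ge0.
have a00 : a = 0 by lra.
by rewrite a00 scale0r add0r IH //; lra.
Qed.

Lemma wspan_sub P Q t x : (forall s, P s -> Q s) -> wspan P t x -> wspan Q t x.
Proof.
move=> PQ; elim=> [|a s b z a0 Ps _ IH]; first exact: wspan0.
by apply: wspan_cons => //; exact: PQ.
Qed.

Lemma wspan_le P u (c : R) t x : (forall s, P s -> dot u s <= c) -> wspan P t x ->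
  dot u x <= c * t.
Proof.
move=> Pu; elim=> [|a s b z a0 Ps _ IH]; first by rewrite dot0r mulr0.
rewrite dotDr dotZr mulrDr; apply: lerD => //.
by rewrite mulrC; apply: ler_wpM2r => //; exact: Pu.
Qed.

Lemma wspan_tight P u (c : R) t x : (forall s, P s -> dot u s <= c) -> wspan P t x ->
  dot u x = c * t -> wspan (fun s => P s /\ dot u s = c) t x.
Proof.
move=> Pu; elim=> [|a s b z a0 Ps Pz IH e]; first by move=> _; exact: wspan0.
have h := Pu s Ps; have h1 := wspan_le Pu Pz; move: e; rewrite dotDr dotZr => e.
have h2 : a * dot u s <= a * c by exact: ler_wpM2l.
have /IH pz : dot u z = c * b by lra.
have [a00|a00] := eqVneq a 0; first by rewrite a00 scale0r !add0r.
apply: wspan_cons => //; split=> //; apply: (mulfI a00); lra.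
Qed.

Lemma wspan_pos P t x : wspan P t x -> pos_span P x.
Proof.
by elim=> [|a s b z a0 Ps _ IH]; [exact: pos_span0|exact: pos_span_cons].
Qed.

Lemma pos_wspan P u x : pos_span (fun s => P s /\ dot u s = 1) x -> wspan P (dot u x) x.
Proof.
elim=> [|a s y a0 [Ps us] _ IH]; first by rewrite dot0r; exact: wspan0.
by rewrite dotDr dotZr us mulr1; apply: wspan_cons.
Qed.

Lemma wspan_sum P t x : wspan P t x <->
  exists n (a : 'I_n -> R) (q : 'I_n -> E),
    [/\ forall i, P (q i), forall i, 0 <= a i, \sum_i a i = t & x = \sum_i a i *: q i].
Proof.
split.
  elim=> [|a s b z a0 Ps _ [n [c [q [Pq c0 cb ez]]]]].
    exists 0, (fun=> 0), (fun=> 0); split=> [[]//|//||]; by rewrite big_ord0.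
  exists n.+1, (fun i => if unlift ord0 i is Some j then c j else a),
    (fun i => if unlift ord0 i is Some j then q j else s); split.
  - by move=> i; case: unliftP.
  - by move=> i; case: unliftP.
  - rewrite big_ord_recl unlift_none -cb; congr (_ + _).
    by apply: eq_bigr => i _; rewrite liftK.
  - rewrite big_ord_recl unlift_none ez; congr (_ + _).
    by apply: eq_bigr => i _; rewrite liftK.
move=> [n [a [q [Pq a0 <- ->]]]]; elim: n a q Pq a0 => [|n IH] a q Pq a0.
  by rewrite !big_ord0; exact: wspan0.
by rewrite !big_ord_recl; apply: wspan_cons => //; apply: IH.
Qed.

Lemma pos_span_sum P x : pos_span P x ->
  exists n (a : 'I_n -> R) (q : 'I_n -> E),
    [/\ forall i, P (q i), forall i, 0 <= a i & x = \sum_i a i *: q i].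
Proof.
move=> px; have [t pt] : exists t, wspan P t x.
  elim: px => [|a s y a0 Ps _ [t pt]]; first by exists 0; exact: wspan0.
  by exists (a + t); exact: wspan_cons.
by have [n [a [q [Pq a0 _ e]]]] := (wspan_sum _ _ _).1 pt; exists n, a, q.
Qed.

Lemma sum_pos_span P n (a : 'I_n -> R) (q : 'I_n -> E) :
  (forall i, 0 <= a i) -> (forall i, pos_span P (q i)) ->
  pos_span P (\sum_i a i *: q i).
Proof.
move=> a0 Pq; elim/big_ind: _ => [|x y px py|i _]; first exact: pos_span0.
  exact: pos_spanD.
elim: (Pq i) => [|c s y c0 Ps _ IH]; first by rewrite scaler0; exact: pos_span0.
by rewrite scalerDr scalerA; apply: pos_span_cons => //; apply: mulr_ge0.
Qed.

End Weighted.

Section FaceFan.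
Variable R : realType.
Local Notation E := 'rV[R]_3.
Variables (F : set (set E)) (v : E).
Hypotheses (hF : tight_fan F) (mv : minimal_cone F [set v]).
Variable S : seq E.
Hypothesis hS : forall D, cells F v D -> exists l, supports S D l.
Implicit Types (C D f : set E) (p u l w x y : E).

Definition hull : set E := convex_hull [set v + s | s in [set` S]].

Local Notation inS := (fun s => s \in S).

Lemma hullP x : hull (v + x) <-> wspan inS 1 x.
Proof.
rewrite wspan_sum; split.
  move=> [n [a [q [Sq a0 a1 e]]]]; have /choice [s sq] : forall i, exists s,
      s \in S /\ v + s = q i by move=> i; have [s ? ?] := Sq i; exists s.
  exists n, a, s; split=> // [i|]; first by case: (sq i).
  apply: (addrI v); rewrite e -[v in RHS]scale1r -a1 scaler_suml -big_split.
  by apply: eq_bigr => i _; rewrite -(proj2 (sq i)) scalerDr.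
move=> [n [a [q [Sq a0 a1 e]]]]; exists n, a, (fun i => v + q i); split=> //.
  by move=> i; exists (q i) => //; exact: Sq.
rewrite e -[v in LHS]scale1r -a1 scaler_suml -big_split.
by apply: eq_bigr => i _; rewrite scalerDr.
Qed.

Lemma span_all x : exists t, wspan inS t x.
Proof.
have [D cD Dx] := cells_cover hF mv x; have [l [_ _ /(_ x Dx)]] := hS cD.
by move=> /pos_wspan h; exists (dot l x).
Qed.

(** The cells cover the space, so that 0 is a nontrivial combination of the
    points of [S]. *)
Lemma span_zero : wspan inS 1 0.
Proof.
pose x : E := delta_mx 0 0.
have x0 : x <> 0.
  by move/rowP => /(_ 0); rewrite !mxE !eqxx /= => /eqP; rewrite oner_eq0.
have [t tx] := span_all x; have [t' tx'] := span_all (- x).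
have [t0 tz] := wspan_ge0 tx; have [t'0 _] := wspan_ge0 tx'.
have tt : 0 < t + t'.
  rewrite lt0r addr_ge0 // andbT; apply/eqP => e; apply: x0; apply: tz; lra.
have := wspanZ (ltW (etrans (invr_gt0 _) tt)) (wspanD tx tx').
by rewrite subrr scaler0 mulVf ?gt_eqF.
Qed.

Lemma span_pad t t' x : wspan inS t x -> t <= t' -> wspan inS t' x.
Proof.
move=> tx tt; rewrite -[t'](subrK t) addrC -[x]addr0; apply: wspanD => //.
have := wspanZ (_ : 0 <= t' - t) span_zero; rewrite scaler0 mulr1; apply.
by rewrite subr_ge0.
Qed.

Lemma hull_vertex : hull v.
Proof. by rewrite -[v]addr0; apply/hullP; exact: span_zero. Qed.

Lemma hull_core : core (dirs v hull) 0.
Proof.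
move=> x; have [t tx] := span_all x; have [t0 _] := wspan_ge0 tx.
have t1 : 0 < (1 + t)^-1 by rewrite invr_gt0; lra.
exists (1 + t)^-1 => //; rewrite add0r; apply/hullP.
apply: span_pad (wspanZ (ltW t1) tx) _.
by rewrite mulrC ler_pdivrMr; lra.
Qed.

(** The vectors [+- delta_mx 0 i] are combinations of bounded weight of the
    points of [S], hence so are the vectors of a small cube around 0. *)
Lemma hull_interior : interior hull v.
Proof.
(* a common bound for the six weights *)
have [T [T0 hT]] : exists T : R, 0 < T /\ forall (i : 'I_3) (c : R),
    wspan inS (`|c| * T) (c *: delta_mx 0 i).
  have /choice [t ht] (i : 'I_3) : exists t : R, 0 <= t /\ forall c : R,
      wspan inS (`|c| * t) (c *: delta_mx 0 i).
    have [t tx] := span_all (delta_mx 0 i); have [t' tx'] := span_all (- delta_mx 0 i).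
    have [t0 _] := wspan_ge0 tx; have [t'0 _] := wspan_ge0 tx'.
    exists (t + t'); split=> [|c]; first exact: addr_ge0.
    have [c0|c0] := leP 0 c.
      rewrite ger0_norm //; apply: span_pad (wspanZ c0 tx) _.
      by apply: ler_wpM2l => //; lra.
    rewrite ltr0_norm // -[c *: _]opprK -scaleNr -scalerN.
    have c0' : 0 <= - c by lra.
    by apply: span_pad (wspanZ c0' tx') _; apply: ler_wpM2l => //; lra.
  exists (1 + t 0 + t 1 + t 2).
  have [t0 _] := ht 0; have [t1 _] := ht 1; have [t2 _] := ht 2.
  split=> [|i c]; first lra.
  apply: span_pad (proj2 (ht i) c) _; apply: ler_wpM2l => //.
  case: i => -[|[|[|//]]] lti.
  - by rewrite (_ : Ordinal lti = 0); [lra|exact/val_inj].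
  - by rewrite (_ : Ordinal lti = 1); [lra|exact/val_inj].
  - by rewrite (_ : Ordinal lti = 2); [lra|exact/val_inj].
apply/nbhs_ballP; exists (3 * T)^-1 => /= [|y yv].
  by rewrite invr_gt0 mulr_gt0.
rewrite -[y](subrK v) addrC; apply/hullP; set x := y - v.
have xi (i : 'I_3) : `|x 0 i| * T <= 3^-1.
  have : `|x 0 i| < (3 * T)^-1.
    have [_ /(_ 0 i)] := yv; rewrite /x !mxE -ball_normE /= distrC; exact.
  rewrite invfM => h; rewrite -ler_pdivlMr //; exact: ltW.
have ex : x = \sum_i x 0 i *: delta_mx 0 i by exact: row_sum_delta.
rewrite [X in wspan _ _ X]ex !big_ord_recl big_ord0 addr0.
apply: span_pad (wspanD (hT _ _) (wspanD (hT _ _) (hT _ _))) _.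
have h0 := xi ord0; have h1 := xi (lift ord0 ord0).
have h2 := xi (lift ord0 (lift ord0 ord0)).
lra.
Qed.

Lemma hull_polytope : convex_polytope hull 3.
Proof.
split; last exact: core_has_dim hull_core.
exists [set v + s | s in [set` S]] => //; apply: finite_image.
exact: finite_seq.
Qed.

(** Let [T] be the set of points of [S] on the face.  The cell [D] that contains
    their sum has its linear form equal to 1 on all of [T], so that the cone over
    the face is the face of [D] where [u] and [c *: l] agree. *)
Lemma hull_face_fan f : proper_face f hull -> F (cone_over v f).
Proof.
move=> [[u [b [ub ef]]] fM].
have uvb : dot u v < b.
  rewrite lt_neqAle ub ?andbT; last exact: hull_vertex.
  apply/eqP => e; apply: fM; rewrite ef; apply/seteqP; split=> x; first by case.
  move=> Mx; split=> //=; apply/eqP; rewrite eq_le ub //=.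
  have [d d0 Md] := hull_core (- (x - v)).
  have := ub _ Md; rewrite add0r dotDr dotZr dotNr dotBr -e => h.
  by have := ub _ Mx; rewrite -e; nra.
have [c c0 ec] : exists2 c, 0 < c & c = b - dot u v.
  by exists (b - dot u v); rewrite // subr_gt0.
have Sc s : s \in S -> dot u s <= c.
  move=> sS; have : hull (v + s) by apply/hullP; exact: wspan1.
  by move=> /ub; rewrite dotDr; lra.
pose T s := s \in S /\ dot u s = c.
have inf x : f (v + x) <-> wspan T 1 x.
  rewrite ef; split=> [[/hullP Mx /= e]|Tx].
    by apply: (wspan_tight Sc Mx); move: e; rewrite dotDr; lra.
  have ux : dot u x = c.
    have le s : T s -> dot u s <= c by case=> _ ->.
    have ge s : T s -> dot (- u) s <= - c by case=> _ us; rewrite dotNl us.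
    by have := wspan_le le Tx; have := wspan_le ge Tx; rewrite dotNl; lra.
  split; first by apply/hullP; apply: wspan_sub Tx => s [].
  by rewrite /= dotDr ux; lra.
have cone x : cone_over v f (v + x) <-> pos_span T x.
  split=> [[n [a [q [fq a0 /addrI ->]]]]|].
    apply: sum_pos_span => // i; apply: (@wspan_pos _ _ 1); apply/inf.
    by rewrite addrC subrK; exact: fq.
  move=> /pos_span_sum [n [a [q [Tq a0 ->]]]].
  exists n, a, (fun i => v + q i); split=> // [i|].
    by apply/inf; apply: wspan1; exact: Tq.
  by congr (_ + _); apply: eq_bigr => i _; rewrite addrC addKr.
pose x0 := \sum_(s <- S | dot u s == c) s.
have [D cD Dx0] := cells_cover hF mv x0; have [l [l1 lD lspan]] := hS cD.
have [C [FC dC eD]] := cD.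
have ul x : D x -> dot u x <= c * dot l x.
  by move=> /lspan /pos_wspan /(wspan_le Sc).
(* the sum of the nonnegative [1 - dot l s] over [T] is nonpositive *)
have lT s : T s -> dot l s = 1.
  move=> [sS us].
  have dsum w : dot w x0 = \sum_(s <- S | dot u s == c) dot w s.
    by rewrite /x0; elim/big_ind2: _ => [|? ? ? ? <- <-|//]; rewrite ?dot0r ?dotDr.
  have sum0 : \sum_(s <- S | dot u s == c) (1 - dot l s) = 0.
    apply: le_anti; apply/andP; split; last first.
      rewrite big_seq_cond; apply: sumr_ge0 => s' /andP[s'S _].
      by rewrite subr_ge0 l1.
    have := ul _ Dx0; rewrite !dsum.
    rewrite (eq_bigr (fun=> c)) => [|s' /eqP //].
    rewrite -[\sum_(s <- S | _) (_ - _) <= 0](pmulr_rle0 _ c0) sumrB mulrBr subr_le0.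
    by rewrite [c * \sum_(_ <- _ | _) 1]mulr_sumr mulr1.
  have : (\sum_(s <- S | (s \in S) && (dot u s == c)) (1 - dot l s)) == 0.
    by rewrite -big_seq_cond sum0.
  rewrite psumr_eq0 => [/allP/(_ s sS)|s' /andP[s'S _]]; last by rewrite subr_ge0 l1.
  by rewrite sS us eqxx /= subr_eq0 => /eqP.
apply: (fan_face (tight_is_fan hF) FC); last first.
  by exists v; have := (cone 0).2 (pos_span0 _); rewrite addr0.
exists (u - c *: l), (dot (u - c *: l) v); split=> [x Cx|].
  have Dx : D (x - v) by rewrite eD /dirs /= addrC subrK.
  by have := ul _ Dx; rewrite !dotBl !dotZl !dotBr; lra.
apply/seteqP; split=> x; rewrite -[x](subrK v) [x - v + v]addrC; move: (x - v) => {}x.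
  move=> /cone Tx; suff [Dx e] : D x /\ dot u x = c * dot l x.
    split; first by move: Dx; rewrite eD.
    by rewrite /= !dotBl !dotZl !dotDr e; lra.
  elim: Tx => [|a s y a0 Ts _ [Dy ey]].
    rewrite !dot0r mulr0 eD; split=> //; rewrite /dirs /= addr0.
    exact: (vertex_in mv FC).
  have [sS us] := Ts; split; last by rewrite !dotDr !dotZr us (lT s Ts) ey; lra.
  have Ds := lD _ sS (lT _ Ts); move: Dy Ds; rewrite eD => Dy Ds.
  by apply: (dirsD hF mv FC) => //; exact: (dirsZ hF mv FC).
move=> [Cx /= e]; apply/cone.
have Dx : D x by rewrite eD.
have := lspan _ Dx => /pos_wspan; rewrite !dotBl !dotZl !dotDr in e => Tx.
apply: (@wspan_pos _ _ (dot l x)); apply: (wspan_tight Sc Tx); lra.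
Qed.

(** A cone [f] of the fan is a face of a cell [D], cut out by a form [u0] that
    is nonpositive on [D].  For small [e > 0] the form [l + e *: u0] is at most 1
    on [S], with equality on the points of [S] in [f] only; it exposes the face
    of the hull below [f]. *)
Lemma fan_hull_face f : F f -> exists g, proper_face g hull /\ f = cone_over v g.
Proof.
move=> Ff; have [k [w ew]] := dirs_gcone hF mv Ff.
have fw i : dirs v f (w i).
  rewrite ew; exists (fun j => (j == i)%:R); split=> [j|]; first exact: ler0n.
  rewrite (bigD1 i) //= eqxx scale1r big1 ?addr0 // => j ji.
  by rewrite (negbTE ji) scale0r.
(* a cell that contains an interior point of [f] contains [f] *)
have [D cD Dw] := cells_cover hF mv (\sum_i w i); have [l [l1 lD lspan]] := hS cD.
have [C [FC dC eD]] := cD.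
have fv : forall J : pred 'I_k, dirs v f (\sum_(i | J i) w i).
  move=> J; rewrite ew; exists (fun i => (J i)%:R); split=> [i|]; first exact: ler0n.
  by rewrite big_mkcond; apply: eq_bigr => i _; case: (J i); rewrite ?scale1r ?scale0r.
have Dwi i : dirs v C (w i).
  apply: (dirs_face hF mv Ff FC (fw i) (fv (fun j => j != i))).
  by move: Dw; rewrite eD (bigD1 i).
have fC : f `<=` C.
  move=> x fx; have : dirs v f (x - v) by rewrite /dirs /= addrC subrK.
  rewrite ew => -[a [a0 ex]]; rewrite -[x](subrK v) addrC ex -[C _]/(dirs v C _).
  elim/big_ind: _ => [|y z|i _]; first by rewrite /dirs /= addr0; exact: (vertex_in mv FC).
    exact: (dirsD hF mv FC).
  exact: (dirsZ hF mv FC).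
have [_ _ [u0 [b0 [ub0 ef]]]] := fan_meet (tight_is_fan hF) Ff FC.
rewrite (setIidl fC) in ef.
have u0v : dot u0 v = b0.
  by have := vertex_in mv Ff; rewrite ef => -[].
have u0D x : D x -> dot u0 x <= 0.
  by rewrite eD => /ub0; rewrite dotDr u0v; lra.
have inf x : D x -> dot u0 x = 0 -> f (v + x).
  by rewrite eD => Cx e; rewrite ef; split=> //=; rewrite dotDr e u0v addr0.
have : small (fun e => forall s, s \in S -> dot l s < 1 -> dot l s + e * dot u0 s < 1).
  apply: small_seq => s sS; have [ls|ls] := ltP (dot l s) 1; last first.
    by apply: small_always.
  rewrite -subr_gt0 in ls.
  apply: small_imp (small_affine_gt (- dot u0 s) ls) => e _; lra.
move=> /small_ex [e e0 strict]; pose u := l + e *: u0.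
have us s : dot u s = dot l s + e * dot u0 s by rewrite /u dotDl dotZl.
have S1 s : s \in S -> dot u s <= 1.
  move=> sS; rewrite us; have := l1 _ sS; rewrite le_eqVlt => /orP[/eqP ls|ls].
    by have := u0D _ (lD _ sS ls); rewrite ls; nra.
  exact: ltW (strict _ sS ls).
have tight s : s \in S -> dot u s = 1 -> dot l s = 1 /\ dot u0 s = 0.
  move=> sS; rewrite us => e1; have := l1 _ sS; rewrite le_eqVlt => /orP[/eqP ls|ls].
    split=> //; have /eqP : e * dot u0 s = 0 by lra.
    by rewrite mulf_eq0 gt_eqF //= => /eqP.
  by have := strict _ sS ls; rewrite e1 ltxx.
pose g := hull `&` [set x | dot u x = dot u v + 1].
have gP x : g (v + x) <-> wspan inS 1 x /\ dot u x = 1.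
  rewrite /g -hullP; split=> -[Mx] /=; rewrite ?dotDr => h; split=> //=; rewrite ?dotDr; lra.
have gT x : g (v + x) -> wspan (fun s => s \in S /\ dot u s = 1) 1 x.
  by move=> /gP [Mx ux]; apply: (wspan_tight S1 Mx); rewrite ux mulr1.
exists g; split.
  split.
    exists u, (dot u v + 1); split=> // x Mx.
    move: Mx; rewrite -[x](subrK v) [x - v + v]addrC; move: (x - v) => {}x.
    by move=> /hullP /(wspan_le S1); rewrite dotDr mul1r lerD2l.
  move=> eg; have : g v by rewrite eg; exact: hull_vertex.
  by case=> _ /= /eqP; rewrite -subr_eq0 opprD addNKr oppr_eq0 oner_eq0.
have fcone x : dirs v f x <-> D x /\ dot u0 x = 0.
  split=> [fx|[Dx]]; last exact: inf.
  by move: fx; rewrite /dirs /= ef eD => -[Cx /=]; rewrite dotDr u0v; split=> //; lra.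
apply/seteqP; split=> x.
  rewrite -[x](subrK v) [x - v + v]addrC; move: (x - v) => {}x.
  move=> /fcone [Dx ux]; have Tx := lspan _ Dx.
  have := wspan_tight (u := u0) (c := 0) (fun s (Ps : s \in S /\ dot l s = 1) =>
    u0D _ (lD _ Ps.1 Ps.2)) .
  have [t tx] : exists t, wspan (fun s => s \in S /\ dot l s = 1) t x.
    by have [n [a [q [Pq a0 ex]]]] := pos_span_sum Tx;
      exists (\sum_i a i); apply/wspan_sum; exists n, a, q.
  move=> /(_ _ _ tx); rewrite mul0r => /(_ ux) /wspan_pos /pos_span_sum.
  move=> [n [a [q [Pq a0 ->]]]]; exists n, a, (fun i => v + q i); split=> // [i|].
    have [[qS ql] qu] := Pq i; apply/gP; split; first exact: wspan1.
    by rewrite us ql qu mulr0 addr0.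
  by congr (_ + _); apply: eq_bigr => i _; rewrite addrC addKr.
move=> [n [a [q [gq a0 ->]]]]; rewrite -[f _]/(dirs v f _).
elim/big_ind: _ => [|y z|i _]; first by rewrite /dirs /= addr0; exact: (vertex_in mv Ff).
  exact: (dirsD hF mv Ff).
apply: (dirsZ hF mv Ff) => //.
have : g (v + (q i - v)) by rewrite addrC subrK.
move=> /gT; elim=> [|c s t z c0 [sS s1] _ IH].
  by rewrite /dirs /= addr0; exact: (vertex_in mv Ff).
apply: (dirsD hF mv Ff) => //; apply: (dirsZ hF mv Ff) => //.
by have [ls u0s] := tight _ sS s1; apply/fcone; split=> //; exact: lD.
Qed.

Lemma fan_eq_face_fan : F = face_fan v hull.
Proof.
apply/seteqP; split=> f.
  by move=> /fan_hull_face [g [pg ->]]; exists g.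
by move=> [g pg <-]; exact: hull_face_fan.
Qed.

End FaceFan.

Theorem mainTheorem5 (R : realType) (F : set (set 'rV[R]_3)) (hF : tight_fan F) :
  exists (M : set 'rV[R]_3) (v : 'rV[R]_3),
    [/\ convex_polytope M 3, interior M v & F = face_fan v M].
Proof.
have [v mv] := tight_pointed hF.
have [S hS] := tight_cells_polytopal (tight_fan_cells hF mv).
exists (hull v S), v; split.
- exact: (hull_polytope hF mv hS).
- exact: (hull_interior hF mv hS).
- exact: (fan_eq_face_fan hF mv hS).
Qed.
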